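(* Let $\mu\ge0$, let $\mathbb{G}_0\stackrel{(law)}{=}\frac{1}{1+\exp(\pi C)}$ where $C$ is a standard Cauchy variable, and let $\left(\Gamma_t\left(\frac{1}{\mu+\mathbb{G}_0}\right),\,t\ge0\right)$ denote the subordinator characterized by $$E\left(e^{-\lambda\Gamma_t\left(\frac{1}{\mu+\mathbb{G}_0}\right)}\right)=\exp\left\{-t\int_0^\infty(1-e^{-\lambda x})\frac{dx}{x}E\left(e^{-\frac{x}{\mu+\mathbb{G}_0}}\right)\right\}\qquad(\lambda,t\ge0).$$ Then: 1. (Laplace transform) For $\lambda>0$ and $t\ge0$, $$E\left(e^{-\lambda\Gamma_t\left(\frac{1}{\mu+\mathbb{G}_0}\right)}\right)=\left[\frac1\lambda\log\left(\frac{1+\lambda(1+\mu)}{1+\lambda\mu}\right)\right]^t .$$ 2. (Laws) $$\Gamma_1\left(\frac{1}{\mu+\mathbb{G}_0}\right)\stackrel{(law)}{=}\mathfrak{e}\,(U+\mu),\qquad D_1\left(\frac{1}{\mu+\mathbb{G}_0}\right)\stackrel{(law)}{=}U+\mu .$$ In particular, for $\mu=0$: $\Gamma_1(1/\mathbb{G}_0)\stackrel{(law)}{=}\mathfrak{e}\cdot U$ and $D_1(1/\mathbb{G}_0)\stackrel{(law)}{=}U$. The density of $\Gamma_1\left(\frac{1}{\mu+\mathbb{G}_0}\right)$ equals $$f_{\Gamma_1\left(\frac{1}{\mu+\mathbb{G}_0}\right)}(x)=\left(\int_0^1\frac{1}{\mu+y}\exp\left(-\frac{x}{\mu+y}\right)dy\right)1_{[0,\infty[}(x).$$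 3. (Wiener-Gamma representation) For every $\mu\ge0$ and $t\ge0$, $$\Gamma_t\left(\frac{1}{\mu+\mathbb{G}_0}\right)\stackrel{(law)}{=}\int_0^t\frac{1+\mu\left(1+\exp\left(-\cot\frac{\pi u}{t}\right)\right)}{1+\exp\left(-\cot\frac{\pi u}{t}\right)}\,d\gamma_u .$$
   Context: $(\gamma_t,\,t\ge0)$ is the standard gamma process, i.e. the subordinator without drift and with Lévy measure $\frac{dx}{x}e^{-x}$, $x>0$. For fixed $t>0$, $\gamma_t$ is a gamma variable with density $e^{-a}a^{t-1}/\Gamma(t)$ on $(0,\infty)$. Integrals $\int_0^th(u)\,d\gamma_u$ with $h\ge0$ are pathwise Stieltjes integrals. $\mathfrak{e}$ is a standard exponential variable and $U$ is uniform on $[0,1]$. Random variables occurring together on one side of an equality in law are assumed independent. $D_1\left(\frac{1}{\mu+\mathbb{G}_0}\right)$ is the random variable whose law is characterized by $\Gamma_1\left(\frac{1}{\mu+\mathbb{G}_0}\right)\stackrel{(law)}{=}\gamma_1\cdot D_1\left(\frac{1}{\mu+\mathbb{G}_0}\right)$, with independent factors.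
   Formalization: In item 3 the kernel's exp(-cot(πu/t)) is corrected to exp(-π cot(πu/t)) in both places; as printed it fails for every t>0 (e.g. μ=0, t=1: the variance of the integral is below 5/12 = Var(𝔢U)), since G_0 = 1/(1+exp(πC)) forces the factor π. *)

(* Defs.v *)
From HB Require Import structures.
From mathcomp Require Import all_boot all_order all_algebra.
From mathcomp Require Import all_classical all_reals all_analysis.
From mathcomp Require Import measurable_realfun.

Set Implicit Arguments.
Unset Strict Implicit.
Unset Printing Implicit Defensive.

Import Order.TTheory GRing.Theory Num.Theory.
Import numFieldNormedType.Exports.

Local Open Scope classical_set_scope.
Local Open Scope ring_scope.

Section Laws.
Context {R : realType}.

(* Laws are compared on measurable sets only: [pushforward] is also defined,
   but carries no information, on the other sets. *)
Definition has_law d (T : measurableType d) (P : probability T R)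
    d' (T' : measurableType d') (X : T -> T') (m : set T' -> \bar R) : Prop :=
  forall A, measurable A -> pushforward P X A = m A.

Definition eq_law d1 (T1 : measurableType d1) (P1 : probability T1 R)
    d2 (T2 : measurableType d2) (P2 : probability T2 R)
    d' (T' : measurableType d') (X : T1 -> T') (Y : T2 -> T') : Prop :=
  has_law P1 X (pushforward P2 Y).

(* The density is extended-real valued, since a density may be infinite at a
   point. *)
Definition has_density d (T : measurableType d) (P : probability T R)
    (X : T -> R) (f : R -> \bar R) : Prop :=
  [/\ measurable_fun setT f, forall x, (0 <= f x)%E &
      has_law P X (fun A => \int[lebesgue_measure]_(x in A) f x)%E].

(* The full product rule over I implies the rule for every subfamily, by taking
   A i = setT for the other indices. *)
Definition mutually_independent d (T : measurableType d) (P : probability T R)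
    (I : finType) (X : I -> T -> R) : Prop :=
  forall A : I -> set R, (forall i, measurable (A i)) ->
    P (\bigcap_(i in [set: I]) (X i @^-1` A i)) =
    (\prod_(i : I) P (X i @^-1` A i))%E.

Definition independent d (T : measurableType d) (P : probability T R)
    (X Y : T -> R) : Prop :=
  forall A B : set R, measurable A -> measurable B ->
    P (X @^-1` A `&` Y @^-1` B) = (P (X @^-1` A) * P (Y @^-1` B))%E.

Definition standard_cauchy d (T : measurableType d) (P : probability T R)
    (X : T -> R) : Prop :=
  has_density P X (fun x => ((pi * (1 + x ^+ 2))^-1)%:E).

Definition standard_exponential d (T : measurableType d)
    (P : probability T R) (X : T -> R) : Prop :=
  has_law P X (exponential_prob (1 : R)).

Definition uniform01 d (T : measurableType d) (P : probability T R)
    (X : T -> R) : Prop :=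
  has_law P X (uniform_prob (@ltr01 R)).

Definition Gamma (t : R) : R :=
  \int[lebesgue_measure]_(x in `]0, +oo[) (x `^ (t - 1) * expR (- x)).

Definition gamma_pdf (t a : R) : \bar R :=
  if 0 < a then (expR (- a) * a `^ (t - 1) / Gamma t)%:E else 0%E.

Definition gamma_variable d (T : measurableType d) (P : probability T R)
    (t : R) (X : T -> R) : Prop :=
  has_density P X (gamma_pdf t).

(* D has the law of D_1 attached to X = Gamma_1: X is equal in law to
   gamma_1 * D_1 with independent factors, on some probability space. *)
Definition is_D1 dX (TX : measurableType dX) (PX : probability TX R)
    dD (TD : measurableType dD) (PD : probability TD R)
    (X : TX -> R) (D : TD -> R) : Prop :=
  exists (d : measure_display) (T : measurableType d) (P : probability T R)
    (g D' : {RV P >-> R}),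
    [/\ gamma_variable P 1 g,
        eq_law P PD D' D,
        independent P g D' &
        eq_law PX P X (fun w => g w * D' w)].

End Laws.

Section Subordinators.
Context {R : realType}.

(* Processes are indexed by all of R; only times t >= 0 are meaningful. *)
Record is_subordinator d (T : measurableType d) (P : probability T R)
    (X : R -> {RV P >-> R}) : Prop := IsSubordinator {
  subordinator0 : {ae P, forall w, X 0 w = 0} ;
  subordinator_nondecreasing :
    {ae P, forall w, forall s t : R, 0 <= s -> s <= t -> X s w <= X t w} ;
  subordinator_right_continuous :
    {ae P, forall w, forall t : R, 0 <= t -> X u w @[u --> t^'+] --> X t w} ;
  subordinator_stationary : forall s t : R, 0 <= s -> 0 <= t ->
    eq_law P P (fun w => X (s + t) w - X s w) (X t) ;
  subordinator_independent : forall (n : nat) (t : nat -> R),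
    0 <= t 0%N -> (forall i, t i <= t i.+1) ->
    mutually_independent P
      (fun (i : 'I_n) w => X (t i.+1) w - X (t i) w) }.

(* Subordinator without drift whose Levy measure is rho(x) dx on ]0, +oo[. *)
Definition driftless_subordinator d (T : measurableType d)
    (P : probability T R) (rho : R -> \bar R) (X : R -> {RV P >-> R}) : Prop :=
  is_subordinator X /\
  forall lambda t : R, 0 <= lambda -> 0 <= t ->
    ('E_P[fun w => expR (- (lambda * X t w))%R] =
    expeR (- (t%:E * \int[lebesgue_measure]_(x in `]0%R, +oo[)
                      ((1 - expR (- (lambda * x)))%:E * rho x))))%E.

Definition gamma_process d (T : measurableType d) (P : probability T R)
    (X : R -> {RV P >-> R}) : Prop :=
  driftless_subordinator (fun x => (expR (- x) / x)%:E) X.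

(* y is the Stieltjes integral of h >= 0 over ]0, t] against the path F, which
   must be nondecreasing and right-continuous on [0, +oo[; its values at
   negative times are irrelevant. The library attaches Stieltjes measures to
   functions that are cumulative on all of R, hence the extension G; the measure
   of G on ]0, t] depends only on F. *)
Definition is_stieltjes_integral (F h : R -> R) (t : R) (y : \bar R) : Prop :=
  exists2 G : cumulative R R, (forall u, 0 <= u -> G u = F u) &
    (y = \int[lebesgue_stieltjes_measure G]_(u in `]0%R, t]) (h u)%:E)%E.

Definition cot (x : R) : R := cos x / sin x.

(* The factor pi in the exponent is forced by G0 ~ 1 / (1 + exp (pi C)): if V is
   uniform on [0, 1], then - cot (pi V) is standard Cauchy. Without it, the
   integral against the gamma process has a different law. *)
Definition wiener_gamma_kernel (mu t u : R) : R :=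
  let E := expR (- (pi * cot (pi * u / t))) in
  (1 + mu * (1 + E)) / (1 + E).

End Subordinators.

(* Main.v *)
(** Everything rests on E[ln((e^r + e^(pi C)) / (1 + e^(pi C)))] = ln((e^r - 1) / r),
    whose r-derivative is E[1 / (1 + e^(pi C - r))] = 1 / (1 - e^(-r)) - 1 / r.
    The latter follows by expanding tanh in partial fractions: averaging over a
    standard Cauchy variable moves the poles (2 k + 1) i of the expansion to
    (2 k + 2) i, which are those of coth. Both expansions come from the recurrence
    satisfied by the integrals of cosh(y x) cos(x)^n and x sinh(y x) cos(x)^n over
    [0, pi / 2]. With Frullani's integral this gives the Laplace transform of Gamma_t,
    and e (U + mu) has the same transform for t = 1.

    Laplace transforms determine laws, by Hausdorff's moment argument. For D_1, the
    tail P(gamma_1 D > x) = E[exp(- x / D)] is the Laplace transform of 1 / D.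
    For the Wiener-Gamma representation, the Laplace transform of the Riemann sums of
    the Stieltjes integral is the exponential of a Riemann sum of ln(1 + l h), and
    - cot(pi u / t) is standard Cauchy for u uniform on [0, t]. *)

Require Import Defs.
From HB Require Import structures.
From mathcomp Require Import all_boot all_order all_algebra.
From mathcomp Require Import all_classical all_reals all_analysis.
From mathcomp Require Import measurable_realfun.
From mathcomp Require Import ring lra.

Set Implicit Arguments.
Unset Strict Implicit.
Unset Printing Implicit Defensive.

Import Order.TTheory GRing.Theory Num.Theory.
Import numFieldNormedType.Exports.

Local Open Scope classical_set_scope.
Local Open Scope ring_scope.

(** * Integrals over a segment by antiderivatives *)

Section integral_antiderivative.
Context {R : realType}.
Local Notation leb := (@lebesgue_measure R).

(** The subordinator and the gamma integral have exponents of the same kind. Frullani's integral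
    turns the exponent of [Gamma_t] into [t] times the average of [ln (1 + l (mu + G0))], and that
    of a gamma increment of length [s] with weight [c] into [s ln (1 + l c)]. So the kernel has to
    be distributed like [mu + G0] when [u] is uniform, and the cotangent is there to produce the
    Cauchy variable. The average is elementary because of the Cauchy law: its density is the Poisson
    kernel of the half-plane at height 1, each pair of poles of tanh gives a conjugate Poisson
    kernel, and heights add under convolution. An odd pole thus becomes the next even one. The point
    r = 0 is delicate, since the two terms of the derivative in r blow up there; the integration in
    r starts at a positive e, which then tends to 0. *)

Lemma is_derive_continuous (f : R -> R) x df :
  is_derive x (1 : R) f df -> {for x, continuous f}.
Proof. by move=> h; exact/differentiable_continuous/derivable1_diffP/ex_derive. Qed.

Lemma integral_antiderivative (f F : R -> R) a b : a <= b ->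
  (forall x, a <= x <= b -> {for x, continuous f}) ->
  (forall x, a <= x <= b -> is_derive x (1 : R) F (f x)) ->
  (\int[leb]_(x in `[a, b]) (f x)%:E = (F b - F a)%:E)%E.
Proof.
rewrite le_eqVlt => /predU1P[<-|ab] cf dF.
  by rewrite set_itv1 integral_set1 subrr.
rewrite (@continuous_FTC2 _ f F)//.
- by apply: continuous_in_subspaceT => x /set_mem /=; rewrite in_itv; exact: cf.
- split => [x /subset_itv_oo_cc||].
  + by rewrite in_itv => /= /dF h; exact: ex_derive.
  + by apply/cvg_at_right_filter/(is_derive_continuous (dF _ _)); rewrite lexx ltW.
  + by apply/cvg_at_left_filter/(is_derive_continuous (dF _ _)); rewrite lexx ltW.
- move=> x /subset_itv_oo_cc; rewrite in_itv derive1E => /= /dF h.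
  exact: derive_val.
Qed.

End integral_antiderivative.

(** * Partial fractions of tanh and coth *)

(** Instance resolution finds the derivative; what remains is its equality with the announced
    expression. *)
Ltac derive_rule :=
  apply: is_derive_eq; rewrite /GRing.scale /= ?mulr1 ?mul1r ?expr1.

Section cosine_moments.
Context {R : realType}.
Variable y : R.
Hypothesis y_gt0 : 0 < y.
Local Notation leb := (@lebesgue_measure R).
Local Notation D := (`[0%R, pi / 2]%classic : set R).

Definition ch (x : R) : R := (expR (y * x) + expR (- (y * x))) / 2.
Definition sh (x : R) : R := (expR (y * x) - expR (- (y * x))) / 2.

#[local] Instance is_derive_ch x : is_derive x (1 : R) ch (y * sh x).
Proof.
rewrite /ch; derive_rule.
by rewrite /sh; field.
Qed.

#[local] Instance is_derive_sh x : is_derive x (1 : R) sh (y * ch x).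
Proof.
rewrite /sh; derive_rule.
by rewrite /ch; field.
Qed.

#[local] Instance is_derive_cosX n x :
  is_derive x (1 : R) (fun x => cos x ^+ n.+1) (n.+1%:R * cos x ^+ n * - sin x).
Proof.
have -> : (fun x : R => cos x ^+ n.+1) = cos ^+ n.+1 by apply/funext => z; rewrite fctE.
by derive_rule; rewrite -mulr_natl.
Qed.

(** [cosB n] is the derivative of [cosA n] in the parameter [y]. Accordingly, each antiderivative
    given below for [cosB] is the [y]-derivative of the one for [cosA]; it is checked directly,
    which avoids differentiating under the integral sign. *)
Definition cosA n (x : R) : R := ch x * cos x ^+ n.
Definition cosB n (x : R) : R := x * sh x * cos x ^+ n.

(** Two integrations by parts packed into one antiderivative. It vanishes at [pi / 2] through [cos]
    and at 0 through [sh] and [sin], so integration leaves a recurrence without boundary terms. *)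
Lemma cosA_antideriv n x : is_derive x (1 : R)
  (fun x => y * sh x * cos x ^+ n.+2 + n.+2%:R * ch x * cos x ^+ n.+1 * sin x)
  ((n.+2%:R ^+ 2 + y ^+ 2) * cosA n.+2 x - n.+2%:R * n.+1%:R * cosA n x).
Proof.
derive_rule.
have : sin x ^+ 2 = 1 - cos x ^+ 2 by rewrite sin2cos2.
rewrite /cosA !exprS; set e := cos x ^+ n => h.
have -> : n.+2%:R = n.+1%:R + 1 :> R by rewrite -natr1.
ring: h.
Qed.

Lemma cosB_antideriv n x : is_derive x (1 : R)
  (fun x => (sh x + y * (x * ch x)) * cos x ^+ n.+2
            + n.+2%:R * (x * sh x) * cos x ^+ n.+1 * sin x)
  ((n.+2%:R ^+ 2 + y ^+ 2) * cosB n.+2 x + 2 * y * cosA n.+2 x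
   - n.+2%:R * n.+1%:R * cosB n x).
Proof.
derive_rule.
have : sin x ^+ 2 = 1 - cos x ^+ 2 by rewrite sin2cos2.
rewrite /cosA /cosB !exprS; set e := cos x ^+ n => h.
have -> : n.+2%:R = n.+1%:R + 1 :> R by rewrite -natr1.
ring: h.
Qed.

Lemma cosA0_antideriv x : is_derive x (1 : R) (fun x => sh x / y) (cosA 0 x).
Proof.
derive_rule.
by rewrite /cosA; field; rewrite gt_eqF.
Qed.

Lemma cosB0_antideriv x : is_derive x (1 : R)
  (fun x => x * ch x / y - sh x / y ^+ 2) (cosB 0 x).
Proof.
derive_rule.
by rewrite /cosB; field; rewrite gt_eqF.
Qed.

Lemma cosA1_antideriv x : is_derive x (1 : R)
  (fun x => y * sh x * cos x + ch x * sin x) ((1 + y ^+ 2) * cosA 1 x).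
Proof. derive_rule; rewrite /cosA; ring. Qed.

Lemma cosB1_antideriv x : is_derive x (1 : R)
  (fun x => (sh x + y * (x * ch x)) * cos x + x * sh x * sin x)
  ((1 + y ^+ 2) * cosB 1 x + 2 * y * cosA 1 x).
Proof. derive_rule; rewrite /cosA /cosB; ring. Qed.

Lemma continuous_cosA n : continuous (cosA n).
Proof.
move=> x; rewrite /cosA; case: n => [|n].
  have -> : (fun x => ch x * cos x ^+ 0) = ch by apply/funext => z; rewrite mulr1.
  exact: is_derive_continuous (is_derive_ch x).
by apply: is_derive_continuous; derive_rule; reflexivity.
Qed.

Lemma continuous_cosB n : continuous (cosB n).
Proof.
move=> x; rewrite /cosB; case: n => [|n].
  have -> : (fun x => x * sh x * cos x ^+ 0) = (fun x => x * sh x).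
    by apply/funext => z; rewrite mulr1.
  by apply: is_derive_continuous; derive_rule; reflexivity.
by apply: is_derive_continuous; derive_rule; reflexivity.
Qed.

Lemma nondecreasing_antideriv (f F : R -> R) a b : a <= b ->
  (forall x, {for x, continuous f}) -> (forall x : R, a <= x <= b -> is_derive x (1 : R) F (f x)) ->
  (forall x, a <= x <= b -> 0 <= f x) -> F a <= F b.
Proof.
move=> ab cf dF f0; rewrite -subr_ge0 -lee_fin -(integral_antiderivative ab)//.
by apply: integral_ge0 => x; rewrite /= in_itv/= lee_fin; exact: f0.
Qed.

Lemma ch_gt0 x : 0 < ch x.
Proof. by rewrite divr_gt0// addr_gt0// expR_gt0. Qed.

Lemma sh0 : sh 0 = 0.
Proof. by rewrite /sh mulr0 oppr0 subrr mul0r. Qed.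

Lemma sh_ge0 x : 0 <= x -> 0 <= sh x.
Proof.
move=> x0; rewrite divr_ge0// subr_ge0 ler_expR.
by rewrite (le_trans (y := 0))// ?oppr_le0 mulr_ge0// ltW.
Qed.

Lemma sh_gt0 x : 0 < x -> 0 < sh x.
Proof.
move=> x0; rewrite divr_gt0// subr_gt0 ltr_expR.
by rewrite (lt_trans (y := 0))// ?oppr_lt0 mulr_gt0.
Qed.

(** The difference of the two sides vanishes at 0 and has derivative [y ^ 2 x sh x], which is
    nonnegative. *)
Lemma sh_le_ch x : 0 <= x -> sh x <= y * x * ch x.
Proof.
move=> x0; rewrite -subr_ge0.
have -> : 0 = y * 0 * ch 0 - sh 0 by rewrite sh0 mulr0 mul0r subr0.
apply: (@nondecreasing_antideriv (fun x => y * (y * (x * sh x)))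
  (fun x => y * x * ch x - sh x) 0 x) => //.
- move=> z; apply: is_derive_continuous; derive_rule; reflexivity.
- by move=> z _; derive_rule; ring.
- move=> z /andP[z0 _]; have y0 := ltW y_gt0; have := sh_ge0 z0 => sz.
  by do 2! apply: mulr_ge0 => //; apply: mulr_ge0.
Qed.

Lemma mulr_cos_le_sin (x : R) : 0 <= x <= pi / 2 -> x * cos x <= sin x.
Proof.
move=> /andP[x0 xp]; rewrite -subr_ge0.
have -> : 0 = sin 0 - 0 * cos 0 :> R by rewrite sin0 mul0r subr0.
apply: (@nondecreasing_antideriv (fun x => x * sin x)
  (fun x => sin x - x * cos x) 0 x) => //.
- move=> z; apply: is_derive_continuous; derive_rule; reflexivity.
- by move=> z _; derive_rule; ring.
- move=> z /andP[z0 zx]; apply: mulr_ge0 => //; apply: sin_ge0_pi.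
  by rewrite z0; have := pi_ge0 R; lra.
Qed.

End cosine_moments.

Section cosine_moment_recurrence.
Context {R : realType}.
Local Notation leb := (@lebesgue_measure R).

Lemma continuous_integrable (f : R -> R) a b :
  continuous f -> leb.-integrable `[a, b] (EFin \o f).
Proof.
move=> cf; apply: continuous_compact_integrable; first exact: segment_compact.
exact: continuous_subspaceT.
Qed.

Lemma Rintegral_antiderivative (f F : R -> R) a b : a <= b ->
  continuous f -> (forall x, is_derive x (1 : R) F (f x)) ->
  \int[leb]_(x in `[a, b]) f x = F b - F a.
Proof.
move=> ab cf dF; rewrite /Rintegral (integral_antiderivative (F := F) ab)//.
move=> x _; exact: cf.
Qed.

Variable y : R.
Hypothesis y_gt0 : 0 < y.
Local Notation D := (`[0%R, pi / 2]%classic : set R).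

Definition momA n := \int[leb]_(x in D) cosA y n x.
Definition momB n := \int[leb]_(x in D) cosB y n x.

Let pi2_ge0 : 0 <= pi / 2 :> R. Proof. by rewrite divr_ge0// pi_ge0. Qed.

Let mD : measurable D. Proof. exact: measurable_itv. Qed.

Let iA n k : leb.-integrable D (EFin \o (fun x => k * cosA y n x)).
Proof.
apply: continuous_integrable => x; apply: cvgM; first exact: cvg_cst.
exact: continuous_cosA.
Qed.

Let iB n k : leb.-integrable D (EFin \o (fun x => k * cosB y n x)).
Proof.
apply: continuous_integrable => x; apply: cvgM; first exact: cvg_cst.
exact: continuous_cosB.
Qed.

Let iA1 n : leb.-integrable D (EFin \o cosA y n).
Proof. apply: continuous_integrable; exact: continuous_cosA. Qed.

Let iB1 n : leb.-integrable D (EFin \o cosB y n).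
Proof. apply: continuous_integrable; exact: continuous_cosB. Qed.

Lemma momA_rec n : (n.+2%:R ^+ 2 + y ^+ 2) * momA n.+2 = n.+2%:R * n.+1%:R * momA n.
Proof.
apply/eqP; rewrite -subr_eq0 -!RintegralZl// -RintegralB//.
rewrite (Rintegral_antiderivative pi2_ge0 _ (cosA_antideriv y n)).
  by rewrite cos_pihalf sin0 sh0 !exprS !(mul0r, mulr0, subr0, addr0).
move=> x; apply: cvgB; apply: cvgM; try exact: cvg_cst; exact: continuous_cosA.
Qed.

Lemma momB_rec n : (n.+2%:R ^+ 2 + y ^+ 2) * momB n.+2 + 2 * y * momA n.+2
  = n.+2%:R * n.+1%:R * momB n.
Proof.
apply/eqP; rewrite -subr_eq0 -!RintegralZl// -RintegralD// -RintegralB//; last first.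
  apply: continuous_integrable => x; apply: cvgD; apply: cvgM; try exact: cvg_cst.
    exact: continuous_cosB.
  exact: continuous_cosA.
rewrite (Rintegral_antiderivative pi2_ge0 _ (cosB_antideriv y n)).
  by rewrite cos_pihalf sin0 sh0 !exprS !(mul0r, mulr0, subr0, addr0).
move=> x; apply: cvgB; last first.
  by apply: cvgM; [exact: cvg_cst|exact: continuous_cosB].
apply: cvgD; apply: cvgM; try exact: cvg_cst.
  exact: continuous_cosB.
exact: continuous_cosA.
Qed.

Lemma momA0 : momA 0 = sh y (pi / 2) / y.
Proof.
rewrite /momA (Rintegral_antiderivative pi2_ge0 _ (cosA0_antideriv y_gt0)).
  by rewrite sh0 mul0r subr0.
exact: continuous_cosA.
Qed.

Lemma momB0 : momB 0 = pi / 2 * ch y (pi / 2) / y - sh y (pi / 2) / y ^+ 2.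
Proof.
rewrite /momB (Rintegral_antiderivative pi2_ge0 _ (cosB0_antideriv y_gt0)).
  by rewrite sh0 !mul0r !subr0.
exact: continuous_cosB.
Qed.

Lemma momA1 : (1 + y ^+ 2) * momA 1 = ch y (pi / 2).
Proof.
rewrite -RintegralZl// (Rintegral_antiderivative pi2_ge0 _ (cosA1_antideriv y)).
  by rewrite cos_pihalf sin_pihalf sin0 sh0 !(mul0r, mulr0, subr0, addr0, mulr1, add0r).
by move=> x; apply: cvgM; [exact: cvg_cst|exact: continuous_cosA].
Qed.

Lemma momB1 : (1 + y ^+ 2) * momB 1 + 2 * y * momA 1 = pi / 2 * sh y (pi / 2).
Proof.
rewrite -!RintegralZl// -RintegralD//.
rewrite (Rintegral_antiderivative pi2_ge0 _ (cosB1_antideriv y)).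
  by rewrite cos_pihalf sin_pihalf sin0 sh0 !(mul0r, mulr0, subr0, addr0, mulr1, add0r).
move=> x; apply: cvgD; apply: cvgM; try exact: cvg_cst.
  exact: continuous_cosB.
exact: continuous_cosA.
Qed.

Let rec_gt0 n : 0 < n.+2%:R ^+ 2 + y ^+ 2.
Proof. by rewrite ltr_wpDl ?sqr_ge0// exprn_gt0. Qed.

(** The recurrence carries strict positivity from [n] to [n.+2], so the induction runs over two
    consecutive indices, started by the closed forms of [momA 0] and [momA 1]. *)
Lemma momA_gt0 n : 0 < momA n.
Proof.
suff: 0 < momA n /\ 0 < momA n.+1 by case.
elim: n => [|n [A0 A1]].
  rewrite momA0 divr_gt0 ?sh_gt0 ?divr_gt0 ?pi_gt0//; split => //.
  rewrite -(pmulr_rgt0 _ (x := 1 + y ^+ 2)) ?momA1 ?ch_gt0//.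
  by rewrite ltr_wpDr ?sqr_ge0.
split=> //; rewrite -(pmulr_rgt0 _ (rec_gt0 n)) momA_rec.
by rewrite !mulr_gt0.
Qed.

Lemma momB_ge0 n : 0 <= momB n.
Proof.
apply: Rintegral_ge0 => x /=; rewrite in_itv/= => /andP[x0 x1].
rewrite /cosB mulr_ge0 ?exprn_ge0 ?cos_ge0_pihalf//; last lra.
by rewrite mulr_ge0// sh_ge0.
Qed.

(** The right-hand side is [y] times the integral of [ch x cos^n x sin^2 x], so that
    [sh x <= y x ch x] and [x cos x <= sin x] compare the integrands pointwise. *)
Lemma momB_le n : momB n.+2 <= y * (momA n - momA n.+2).
Proof.
rewrite -RintegralB// -RintegralZl//; last first.
  apply: continuous_integrable => x; apply: cvgB; exact: continuous_cosA.
apply: le_Rintegral => //.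
  apply: continuous_integrable => x; apply: cvgM; first exact: cvg_cst.
  by apply: cvgB; exact: continuous_cosA.
move=> x /=; rewrite in_itv/= => /andP[x0 x1].
have c0 : 0 <= cos x by apply: cos_ge0_pihalf; lra.
have := sh_le_ch y_gt0 x0; have := @mulr_cos_le_sin R x.
rewrite x0 x1 => /(_ isT) h1 h2.
have C0 := ch_gt0 y x; have cn0 := exprn_ge0 n c0.
rewrite /cosA /cosB !exprS.
have : sin x ^+ 2 = 1 - cos x ^+ 2 by rewrite sin2cos2.
set c := cos x; set s := sin x; set e := _ ^+ n => h.
have -> : y * (ch y x * e - ch y x * (c * (c * e))) = y * ch y x * e * s ^+ 2.
  by rewrite h; ring.
apply: (@le_trans _ _ (y * ch y x * e * (x * c) ^+ 2)).
  have -> : y * ch y x * e * (x * c) ^+ 2 = x * c ^+ 2 * e * (y * x * ch y x) by ring.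
  have -> : x * sh y x * (c * (c * e)) = x * c ^+ 2 * e * sh y x by ring.
  by rewrite ler_wpM2l// !mulr_ge0// sqr_ge0.
rewrite ler_wpM2l ?mulr_ge0// ?(ltW y_gt0) ?(ltW C0)//.
by rewrite ler_sqr ?nnegrE ?mulr_ge0 ?(le_trans _ h1) ?mulr_ge0.
Qed.

(** The logarithmic derivative of [momA n] in [y]. The recurrence of [momA] is multiplicative, so
    that of the ratio is additive, and each step releases one pair of poles. This is the logarithmic
    derivative of the argument for Euler's product. *)
Definition mom_ratio n := momB n / momA n.

Lemma mom_ratio_rec n :
  mom_ratio n = mom_ratio n.+2 + 2 * y / (n.+2%:R ^+ 2 + y ^+ 2).
Proof.
rewrite /mom_ratio; have A0 := momA_gt0 n; have A2 := momA_gt0 n.+2.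
have hA := momA_rec n; have hB := momB_rec n; have r0 := rec_gt0 n.
set r := _ ^+ 2 + _ in hA hB r0 *; set q := n.+2%:R * n.+1%:R in hA hB.
have q0 : 0 < q by rewrite mulr_gt0.
apply: (mulfI (x := q * momA n)); first by rewrite gt_eqF// mulr_gt0.
rewrite [in RHS]mulrDr -[in X in _ = X * _ + _]hA -[in X in _ = _ + X * _]hA.
have -> : q * momA n * (momB n / momA n) = q * momB n by field; rewrite gt_eqF.
by rewrite -hB; field; rewrite !gt_eqF.
Qed.

Lemma mom_ratio_ge0 n : 0 <= mom_ratio n.
Proof. by rewrite divr_ge0 ?momB_ge0// ltW// momA_gt0. Qed.

(** By [momB_le] the ratio is at most [y (momA n / momA n.+2 - 1)], which [momA_rec] evaluates to
    [y (n + 2 + y^2) / ((n + 2) (n + 1))]. *)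
Lemma mom_ratio_le n : mom_ratio n.+2 <= y * (1 + y ^+ 2) / n.+1%:R.
Proof.
have A0 := momA_gt0 n; have A2 := momA_gt0 n.+2.
have := momB_le n; rewrite /mom_ratio ler_pdivrMr// => /le_trans; apply.
rewrite -!mulrA ler_pM2l//.
rewrite -(ler_pM2l (x := n.+2%:R * n.+1%:R)) ?mulr_gt0// mulrBr -momA_rec.
rewrite -mulrBl.
have -> : n.+2%:R * n.+1%:R * ((1 + y ^+ 2) * (n.+1%:R^-1 * momA n.+2))
  = n.+2%:R * (1 + y ^+ 2) * momA n.+2.
  have : n.+1%:R != 0 :> R by rewrite pnatr_eq0.
  by set N := n.+1%:R => N0; field.
rewrite ler_pM2r// -(natr1 n.+1) -subr_ge0.
set N := n.+1%:R.
have -> : (N + 1) * (1 + y ^+ 2) - ((N + 1) ^+ 2 + y ^+ 2 - (N + 1) * N) = N * y ^+ 2.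
  by ring.
by rewrite mulr_ge0// sqr_ge0.
Qed.

End cosine_moment_recurrence.

Section partial_fractions.
Context {R : realType}.
Variable y : R.
Hypothesis y_gt0 : 0 < y.

(* The terms with poles at y = +/- (2 k + j) i, k < m: j = 1 gives tanh and j = 2
   gives coth. *)
Definition pole_sum (j m : nat) : R :=
  \sum_(k < m) 2 * y / ((k.*2 + j)%:R ^+ 2 + y ^+ 2).

Let mom_ratioE n m : mom_ratio y n = pole_sum n.+2 m + mom_ratio y (m.*2 + n).
Proof.
elim: m => [|m IH]; first by rewrite /pole_sum big_ord0 add0r.
rewrite IH /pole_sum big_ord_recr/= mom_ratio_rec//.
by rewrite doubleS !addSn !addnS [X in _ = X]addrAC -addrA (addrC (mom_ratio _ _)).
Qed.

Let mom_ratio_cvg n : mom_ratio y (m.*2 + n) @[m --> \oo] --> (0 : R).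
Proof.
rewrite -(cvg_shiftS (fun m => mom_ratio y (m.*2 + n)))/=.
apply: (@squeeze_cvgr _ _ _ _ (fun=> 0) (fun m : nat => y * (1 + y ^+ 2) * m.+1%:R^-1)).
- near=> m; rewrite mom_ratio_ge0//= doubleS !addSn.
  rewrite (le_trans (mom_ratio_le y_gt0 _))// ler_pM2l ?mulr_gt0//; last first.
    by rewrite ltr_wpDr ?sqr_ge0.
  by rewrite lef_pV2 ?posrE// ler_nat ltnS -addnn -addnA leq_addr.
- exact: cvg_cst.
- rewrite -[X in _ --> X](mulr0 (y * (1 + y ^+ 2))).
  by apply: cvgM; [exact: cvg_cst|exact: cvg_harmonic].
Unshelve. all: end_near. Qed.

Lemma pole_sum_cvg n : pole_sum n.+2 m @[m --> \oo] --> mom_ratio y n.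
Proof.
have -> : (fun m => pole_sum n.+2 m) = (fun m => mom_ratio y n - mom_ratio y (m.*2 + n)).
  by apply/funext => m; rewrite (mom_ratioE n m) addrK.
rewrite -[X in _ --> X]subr0.
by apply: cvgB; [exact: cvg_cst|exact: mom_ratio_cvg].
Qed.

Lemma pole_sum_le n m : pole_sum n.+2 m <= mom_ratio y n.
Proof. by rewrite (mom_ratioE n m) lerDl mom_ratio_ge0. Qed.

Lemma pole_sum_ge0 n m : 0 <= pole_sum n m.
Proof.
apply: sumr_ge0 => k _; rewrite divr_ge0 ?mulr_ge0// ?(ltW y_gt0)//.
by rewrite addr_ge0 ?sqr_ge0.
Qed.

Let expR_gt1 : 1 < expR (pi * y).
Proof. by rewrite -expR0 ltr_expR mulr_gt0 ?pi_gt0. Qed.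

Let chE : ch y (pi / 2) = (expR (pi * y) + 1) / (2 * expR (y * (pi / 2))).
Proof.
have -> : pi * y = y * (pi / 2) + y * (pi / 2) by field.
by rewrite expRD /ch expRN; field; rewrite gt_eqF ?expR_gt0.
Qed.

Let shE : sh y (pi / 2) = (expR (pi * y) - 1) / (2 * expR (y * (pi / 2))).
Proof.
have -> : pi * y = y * (pi / 2) + y * (pi / 2) by field.
by rewrite expRD /sh expRN; field; rewrite gt_eqF ?expR_gt0.
Qed.

Lemma coth_partial_fractions : pole_sum 2 m @[m --> \oo] -->
  pi / 2 * ((expR (pi * y) + 1) / (expR (pi * y) - 1)) - y^-1.
Proof.
have -> : pi / 2 * ((expR (pi * y) + 1) / (expR (pi * y) - 1)) - y^-1
    = mom_ratio y 0; last exact: pole_sum_cvg.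
rewrite /mom_ratio momA0// momB0// chE shE.
by field; rewrite !gt_eqF ?expR_gt0 ?subr_gt0.
Qed.

Let mom_ratio1 : mom_ratio y 1 =
  pi / 2 * ((expR (pi * y) - 1) / (expR (pi * y) + 1)) - 2 * y / (1 + y ^+ 2).
Proof.
have y20 : 0 < 1 + y ^+ 2 by rewrite ltr_wpDr ?sqr_ge0.
have A1 := momA_gt0 y_gt0 1.
have -> : (expR (pi * y) - 1) / (expR (pi * y) + 1) = sh y (pi / 2) / ch y (pi / 2).
  by rewrite chE shE; field; rewrite !gt_eqF ?expR_gt0 ?addr_gt0 ?expR_gt0.
rewrite mulrA -momB1// -momA1// /mom_ratio.
by field; rewrite !gt_eqF.
Qed.

(** [pole_sum_cvg] starts at pole index 2, so the poles at [+/- i] are split off; their term is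
    exactly what [mom_ratio1] subtracts. *)
Let pole_sum1S m : pole_sum 1 m.+1 = 2 * y / (1 + y ^+ 2) + pole_sum 3 m.
Proof.
rewrite /pole_sum big_ord_recl/= expr1n; congr (_ + _).
by apply: eq_bigr => i _; rewrite /bump/= add1n doubleS addSn addSn addn1 addn3.
Qed.

Lemma tanh_partial_fractions : pole_sum 1 m @[m --> \oo] -->
  pi / 2 * ((expR (pi * y) - 1) / (expR (pi * y) + 1)).
Proof.
rewrite -(cvg_shiftS (pole_sum 1))/=.
under eq_fun do rewrite pole_sum1S.
have -> : pi / 2 * ((expR (pi * y) - 1) / (expR (pi * y) + 1))
    = 2 * y / (1 + y ^+ 2) + mom_ratio y 1 by rewrite mom_ratio1 [RHS]addrC subrK.
by apply: cvgD; [exact: cvg_cst|exact: pole_sum_cvg].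
Qed.

(** A bound uniform in [y] and [m], which dominates the partial sums under the Cauchy average. *)
Lemma pole_sum1_le m : pole_sum 1 m <= pi / 2.
Proof.
(* One more term, so that [pole_sum1S] applies for [m = 0] too. *)
apply: (@le_trans _ _ (pole_sum 1 m.+1)).
  rewrite [leRHS]/pole_sum big_ord_recr/= lerDl.
  by rewrite divr_ge0 ?mulr_ge0 ?(ltW y_gt0)// addr_ge0 ?sqr_ge0.
rewrite pole_sum1S (le_trans (lerD (lexx _) (pole_sum_le _ _)))// mom_ratio1.
rewrite [leLHS]addrC subrK -[leRHS]mulr1 ler_pM2l ?divr_gt0 ?pi_gt0//.
rewrite ler_pdivrMr ?mul1r ?addr_gt0 ?expR_gt0//.
by rewrite lerD2l (le_trans (y := 0)).
Qed.

End partial_fractions.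

(** * Cauchy averages *)

Section dominated_convergence_real.
Context d (T : measurableType d) {R : realType}.
Variables (m : {measure set T -> \bar R}) (D : set T) (mD : measurable D).
Variables (f_ : nat -> T -> R) (f g : T -> R).
Hypothesis mf_ : forall n, measurable_fun D (f_ n).
Hypothesis f_f : forall x, D x -> f_ n x @[n --> \oo] --> f x.
Hypothesis ig : m.-integrable D (EFin \o g).
Hypothesis f_g : forall n x, D x -> `|f_ n x| <= g x.

Let dom : [/\ m.-integrable D (EFin \o f),
  [sequence \int[m]_(x in D) `|(EFin \o f_ n) x - (EFin \o f) x|]_n @ \oo --> 0 &
  [sequence \int[m]_(x in D) (EFin \o f_ n) x]_n @ \oo --> \int[m]_(x in D) (EFin \o f) x]%E.
Proof.
apply: (dominated_convergence mD (f_ := fun n => EFin \o f_ n)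
  (f := EFin \o f) (g := EFin \o g)) => //.
- by move=> n; exact/measurable_EFinP.
- by apply/measurable_EFinP; exact: (measurable_fun_cvg mf_ f_f).
- by apply/aeW => x Dx; apply: cvg_EFin; [exact: nearW|exact: f_f].
- by apply/aeW => x n Dx /=; rewrite lee_fin f_g.
Qed.

Lemma dominated_integrable_real : m.-integrable D (EFin \o f).
Proof. by case: dom. Qed.

Lemma dominated_cvg_real :
  (\int[m]_(x in D) (f_ n x)%:E @[n --> \oo] --> \int[m]_(x in D) (f x)%:E)%E.
Proof. by case: dom. Qed.

End dominated_convergence_real.

Section cauchy_integral.
Context {R : realType}.
Local Notation leb := (@lebesgue_measure R).

Definition cauchy_pdf (x : R) : R := (pi * (1 + x ^+ 2))^-1.

Lemma cauchy_pdf_gt0 x : 0 < cauchy_pdf x.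
Proof. by rewrite invr_gt0 mulr_gt0 ?pi_gt0// ltr_wpDr ?sqr_ge0. Qed.

Lemma continuous_cauchy_pdf : continuous cauchy_pdf.
Proof.
move=> x; rewrite /cauchy_pdf; apply: cvgV.
  by rewrite gt_eqF// -invr_gt0 cauchy_pdf_gt0.
by apply: cvgM; [exact: cvg_cst|exact: continuous_oneDsqr].
Qed.

Lemma integral_cauchy_pdf : (\int[leb]_x (cauchy_pdf x)%:E = 1)%E.
Proof.
have mO : measurable_fun setT (fun x : R => (1 + x ^+ 2)^-1).
  exact: continuous_measurable_fun (@continuous_oneDsqrV R).
rewrite ge0_symfun_integralT//; last 3 first.
- by move=> x; rewrite ltW// cauchy_pdf_gt0.
- exact: continuous_cauchy_pdf.
- by move=> x; rewrite /cauchy_pdf/= sqrrN.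
rewrite -set_itvcy.
under eq_integral do rewrite /cauchy_pdf invfM EFinM.
rewrite ge0_integralZl//; last 3 first.
- exact/measurable_EFinP/measurable_funTS.
- by move=> x _; rewrite lee_fin invr_ge0 addr_ge0 ?sqr_ge0.
- by rewrite lee_fin invr_ge0 pi_ge0.
rewrite integral0y_oneDsqr -!EFinM; congr EFin.
by move: (pi_gt0 R); move: pi => p p0; field; rewrite gt_eqF.
Qed.

Lemma integrable_cauchy_pdf : leb.-integrable setT (EFin \o cauchy_pdf).
Proof.
apply/integrableP; split.
  apply/measurable_EFinP; apply: continuous_measurable_fun.
  exact: continuous_cauchy_pdf.
under eq_integral do rewrite /= ger0_norm ?(ltW (cauchy_pdf_gt0 _))//.
by rewrite integral_cauchy_pdf ltry.
Qed.

Lemma integral_line (f F : R -> R) (l l' : R) :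
  continuous f -> leb.-integrable setT (EFin \o f) ->
  (forall x, is_derive x (1 : R) F (f x)) ->
  F n%:R @[n --> \oo] --> l -> F (- n%:R) @[n --> \oo] --> l' ->
  (\int[leb]_x (f x)%:E = (l - l')%:E)%E.
Proof.
move=> cf intf dF Fl Fl'.
pose fn (n : nat) := f \_ `[- n%:R, n%:R].
have mf : measurable_fun setT f by exact: continuous_measurable_fun.
have h : (\int[leb]_x (fn n x)%:E @[n --> \oo] --> \int[leb]_x (f x)%:E)%E.
  apply: (@dominated_cvg_real _ _ _ leb _ measurableT fn f (fun x => `|f x|)) => //.
  - by move=> n; apply/(measurable_restrictT f) => //; exact: measurable_funTS.
  - move=> x _; apply: cvg_near_cst.
    near=> n; rewrite /fn patchE ifT// inE/= in_itv/= -ler_norml.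
    near: n; exact: nbhs_infty_ger.
  - exact: integrable_norm intf.
  - by move=> n x _; rewrite /fn patchE; case: ifP => // _; rewrite normr0.
have e n : (\int[leb]_x (fn n x)%:E = (F n%:R - F (- n%:R))%:E)%E.
  have nn : - n%:R <= n%:R :> R by rewrite (le_trans (y := 0))// oppr_le0.
  rewrite -(integral_antiderivative (F := F) (f := f) nn)// => [|x _]; last exact: cf.
  by rewrite [RHS]integral_mkcond; apply: eq_integral => x _; rewrite restrict_EFin.
have h' : (\int[leb]_x (fn n x)%:E @[n --> \oo] --> (l - l')%:E)%E.
  by rewrite (eq_cvg _ _ e); apply: cvg_EFin; [exact: nearW|exact: cvgB].
exact: cvg_unique h h'.
Unshelve. all: end_near. Qed.

End cauchy_integral.

Section cauchy_lorentz.
Context {R : realType}.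
Local Notation leb := (@lebesgue_measure R).
Variables (rho a : R).
Hypotheses (rho_gt0 : 0 < rho) (a_gt0 : 0 < a).

(** The summand of [pole_sum] with poles at [+/- i a]. Up to a constant factor, it is the conjugate
    Poisson kernel of the half-plane at height [a]. *)
Definition lorentz (w : R) : R := 2 * w / (a ^+ 2 + w ^+ 2).

Let den_gt0 w : 0 < a ^+ 2 + w ^+ 2.
Proof. by rewrite ltr_wpDr ?sqr_ge0// exprn_gt0. Qed.

Lemma continuous_lorentz : continuous lorentz.
Proof.
move=> w; apply: cvgM; first by apply: cvgM; [exact: cvg_cst|exact: cvg_id].
apply: cvgV; first by rewrite gt_eqF.
by apply: cvgD; [exact: cvg_cst|exact: exprn_continuous].
Qed.

Lemma lorentz_bounded w : `|lorentz w| <= a^-1.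
Proof.
rewrite /lorentz normrM normrM normfV (gtr0_norm (den_gt0 w)) ler_pdivrMr//.
rewrite ger0_norm// -[leRHS]/(_ * _) ler_pdivlMl// -(real_normK (num_real w)).
by rewrite -subr_ge0 (_ : _ - _ = (a - `|w|) ^+ 2) ?sqr_ge0//; ring.
Qed.

(** [M] and [P] are the squared distances from the pole [i] to the poles [rho + i a] and
    [rho - i a]. For [a = 1], the height of the first pole of tanh, [M] is positive because [rho]
    is. *)
Let P : R := rho ^+ 2 + (a + 1) ^+ 2.
Let M : R := rho ^+ 2 + (a - 1) ^+ 2.
Let p : R := (a + 1) / P - (a - 1) / M.
Let q : R := rho / P + rho / M.
Let s : R := rho / P - rho / M.

Let P_gt0 : 0 < P. Proof. by rewrite ltr_wpDr ?sqr_ge0// exprn_gt0. Qed.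
Let M_gt0 : 0 < M. Proof. by rewrite ltr_wpDr ?sqr_ge0// exprn_gt0. Qed.

Let N (x : R) : R := 1 + x ^+ 2.
Let N_gt0 x : 0 < N x. Proof. by rewrite ltr_wpDr ?sqr_ge0. Qed.
Let L (x : R) : R := a ^+ 2 + (rho - x) ^+ 2.
Let L_gt0 x : 0 < L x. Proof. exact: den_gt0. Qed.

(* Residues at i and rho + i a of 2 (rho - x) / ((1 + x^2) (a^2 + (rho - x)^2)). *)
Let F (x : R) : R := pi^-1 *
  (p / 2 * (ln (N x) - ln (L x)) + q * atan x + s * atan (a^-1 * (x - rho))).

Let f x : R := cauchy_pdf x * lorentz (rho - x).

Let F_derive x : is_derive x (1 : R) F (f x).
Proof.
have dN : is_derive x (1 : R) (fun x => ln (N x)) ((N x)^-1 * (2 * x)).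
  have d1 : is_derive x (1 : R) N (2 * x) by rewrite /N; derive_rule; ring.
  exact: is_derive1_comp (is_derive1_ln (N_gt0 x)) d1.
have dL : is_derive x (1 : R) (fun x => ln (L x)) ((L x)^-1 * (-2 * (rho - x))).
  have d1 : is_derive x (1 : R) L (-2 * (rho - x)) by rewrite /L; derive_rule; ring.
  exact: is_derive1_comp (is_derive1_ln (L_gt0 x)) d1.
have dA : is_derive x (1 : R) (fun x => atan (a^-1 * (x - rho)))
    ((1 + (a^-1 * (x - rho)) ^+ 2)^-1 * a^-1).
  have d1 : is_derive x (1 : R) (fun x => a^-1 * (x - rho)) a^-1 by derive_rule; ring.
  exact: is_derive1_comp (is_derive1_atan _) d1.
rewrite /F; derive_rule.
have a0 : a != 0 by rewrite gt_eqF.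
have L0 : L x != 0 by rewrite gt_eqF.
have -> : (1 + (a^-1 * (x - rho)) ^+ 2)^-1 / a = a / L x.
  have e : 1 + (a^-1 * (x - rho)) ^+ 2 = L x / a ^+ 2 by rewrite /L; field.
  by rewrite e; field; rewrite L0.
have N0 : N x != 0 by rewrite gt_eqF.
rewrite /f /cauchy_pdf /lorentz -!/(N x) -/(L x) invfM -[RHS]mulrA; congr (_ * _).
have P0 : P != 0 by rewrite gt_eqF.
have M0 : M != 0 by rewrite gt_eqF.
have key : (p * x + q) * L x + (p * (rho - x) + s * a) * N x = 2 * (rho - x).
  rewrite /p /q /s /L /N; move: P0 M0; rewrite /P /M => P0 M0.
  by field; rewrite P0 M0.
have -> : p / 2 * ((N x)^-1 * (2 * x) - (L x)^-1 * (-2 * (rho - x))) + q / N x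
   + s * (a / L x) = ((p * x + q) * L x + (p * (rho - x) + s * a) * N x) / (N x * L x).
  by field; rewrite N0 L0.
by rewrite key; field; rewrite N0 L0.
Qed.

(** With [v = 1 / u], both quadratics are [u ^ 2] times a polynomial in [v] with value 1 at 0, and
    the factor [u ^ 2] cancels in the difference of logarithms. The sequence [u] will be [n] and
    [- n]. *)
Let ln_ratio_cvg (u : nat -> R) : (u n)^-1 @[n --> \oo] --> (0 : R) ->
  (\forall n \near \oo, u n != 0) ->
  ln (N (u n)) - ln (L (u n)) @[n --> \oo] --> (0 : R).
Proof.
move=> u0 un0.
have h (g : R -> R) : continuous g -> g (u n)^-1 @[n --> \oo] --> g 0.
  by move=> cg; apply: (cvg_comp _ _ u0); exact: cg.
pose g1 (v : R) := v ^+ 2 + 1; pose g2 (v : R) := (a * v) ^+ 2 + (rho * v - 1) ^+ 2.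
have c1 : continuous g1.
  by move=> v; apply: cvgD; [exact: exprn_continuous|exact: cvg_cst].
have c2 : continuous g2.
  move=> v; apply: is_derive_continuous; rewrite /g2; derive_rule; reflexivity.
have l (g : R -> R) : continuous g -> g 0 = 1 -> ln (g (u n)^-1) @[n --> \oo] --> (0 : R).
  move=> cg g0; rewrite -[X in _ --> X]ln1 -g0.
  apply: (cvg_comp _ _ (h _ cg)); rewrite g0; exact: continuous_ln.
have : ln (g1 (u n)^-1) - ln (g2 (u n)^-1) @[n --> \oo] --> (0 : R).
  rewrite -[X in _ --> X](subr0 0); apply: cvgB; apply: l => //.
    by rewrite /g1 expr0n add0r.
  by rewrite /g2 !mulr0 expr0n add0r sub0r sqrrN expr1n.
apply: cvg_trans; apply: near_eq_cvg; near=> n.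
have u_n0 : u n != 0 by near: n.
have v0 : 0 < (u n)^-2 by rewrite invr_gt0 exprn_even_gt0.
have -> : g1 (u n)^-1 = (u n)^-2 * N (u n) by rewrite /g1 /N; field.
have -> : g2 (u n)^-1 = (u n)^-2 * L (u n) by rewrite /g2 /L; field.
by rewrite !lnM ?posrE//; ring.
Unshelve. all: end_near. Qed.

Let nat_ge (b : R) : \forall n \near \oo, b <= n%:R :> R.
Proof. exact: nbhs_infty_ger. Qed.

Let natV_cvg : n%:R^-1 @[n --> \oo] --> (0 : R).
Proof. by rewrite -cvg_shiftS; exact: cvg_harmonic. Qed.

Let atan_cvg (b : R) : atan (a^-1 * (n%:R + b)) @[n --> \oo] --> pi / 2.
Proof.
apply: (cvg_comp (fun n : nat => a^-1 * (n%:R + b)) atan _ (@cvgy_atan R)).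
apply/cvgryPge => c; near=> n.
rewrite ler_pdivlMl// -lerBlDr; near: n; exact: nat_ge.
Unshelve. all: end_near. Qed.

Let atan_nat_cvg : atan (n%:R : R) @[n --> \oo] --> pi / 2.
Proof. by apply: (cvg_comp _ _ _ (@cvgy_atan R)); exact: cvgr_idn. Qed.

Let nat_neq0 : \forall n \near \oo, n%:R != 0 :> R.
Proof. by near=> n; rewrite pnatr_eq0 -lt0n; near: n; exact: nbhs_infty_gt. Unshelve. all: end_near. Qed.

Let f_continuous : continuous f.
Proof.
move=> x; apply: cvgM; first exact: continuous_cauchy_pdf.
apply: (@continuous_comp _ _ _ (fun x => rho - x) lorentz); last exact: continuous_lorentz.
by apply: cvgB; [exact: cvg_cst|exact: cvg_id].
Qed.

Lemma integrable_cauchy_lorentz :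
  leb.-integrable setT (EFin \o (fun x => cauchy_pdf x * lorentz (rho - x))).
Proof.
have cf := f_continuous.
apply: (@le_integrable _ _ _ leb _ _ _ (EFin \o (fun x => a^-1 * cauchy_pdf x))) => //.
- apply/measurable_EFinP; exact: continuous_measurable_fun.
- move=> x _ /=; rewrite lee_fin normrM (normrM a^-1) mulrC ler_wpM2r//.
  by rewrite (le_trans (lorentz_bounded _))// ler_norm.
- exact: (integrableZl measurableT a^-1 integrable_cauchy_pdf).
Qed.

(** The logarithms of [F] cancel at both ends and each arctangent increases by [pi], so the value is
    [q + s], in which the terms over [M] cancel. The height has grown from [a] to [a + 1]. *)
Lemma integral_cauchy_lorentz :
  (\int[leb]_x (cauchy_pdf x * lorentz (rho - x))%:E
    = (2 * rho / (rho ^+ 2 + (a + 1) ^+ 2))%:E)%E.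
Proof.
have lim_pos : F n%:R @[n --> \oo] --> pi^-1 * (q * (pi / 2) + s * (pi / 2)).
  have h := ln_ratio_cvg natV_cvg nat_neq0.
  apply: cvgM; first exact: cvg_cst.
  rewrite -[X in _ --> X + _]add0r -[X in _ --> X + _ + _](mulr0 (p / 2)).
  apply: cvgD; last by apply: cvgM; [exact: cvg_cst|exact: atan_cvg].
  by apply: cvgD; apply: cvgM; [exact: cvg_cst| |exact: cvg_cst|].
have lim_neg : F (- n%:R) @[n --> \oo] -->
    pi^-1 * (q * - (pi / 2) + s * - (pi / 2)).
  have h : ln (N (- n%:R)) - ln (L (- n%:R)) @[n --> \oo] --> (0 : R).
    apply: (ln_ratio_cvg (u := fun n => - n%:R)).
      rewrite -[X in _ --> X]oppr0; under eq_fun do rewrite invrN.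
      by apply: cvgN; exact: natV_cvg.
    by near=> n; rewrite oppr_eq0; near: n; exact: nat_neq0.
  apply: cvgM; first exact: cvg_cst.
  rewrite -[X in _ --> X + _]add0r -[X in _ --> X + _ + _](mulr0 (p / 2)).
  apply: cvgD; last first.
    apply: cvgM; first exact: cvg_cst.
    under eq_fun => n do rewrite -opprD mulrN atanN.
    by apply: cvgN; exact: atan_cvg.
  apply: cvgD; apply: cvgM; [exact: cvg_cst|exact: h|exact: cvg_cst|].
  under eq_fun do rewrite atanN.
  by apply: cvgN; exact: atan_nat_cvg.
rewrite -/P (integral_line f_continuous integrable_cauchy_lorentz F_derive lim_pos lim_neg).
congr EFin; rewrite /q /s; move: (pi_gt0 R); move: pi => c c0.
by field; rewrite !gt_eqF.
Unshelve. all: end_near. Qed.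

End cauchy_lorentz.

Section cauchy_logistic.
Context {R : realType}.
Local Notation leb := (@lebesgue_measure R).

Definition logistic (y : R) : R := (1 + expR (- y))^-1.

(** This is [tanh (pi y / 2)]. *)
Let th (y : R) : R := (expR (pi * y) - 1) / (expR (pi * y) + 1).

Lemma pole_sumE (y : R) j m :
  pole_sum y j m = \sum_(k < m) lorentz (k.*2 + j)%:R y.
Proof. by []. Qed.

Lemma pole_sumN (y : R) j m : pole_sum (- y) j m = - pole_sum y j m.
Proof.
rewrite /pole_sum -sumrN; apply: eq_bigr => k _.
by rewrite sqrrN mulrN mulNr.
Qed.

Let thN y : th (- y) = - th y.
Proof.
rewrite /th mulrN expRN; have := expR_gt0 (pi * y).
by set e := expR _ => e0; field; rewrite !gt_eqF// addr_gt0.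
Qed.

Let pole_sum0 m : pole_sum (0 : R) 1 m = 0.
Proof. by rewrite /pole_sum big1// => k _; rewrite mulr0 mul0r. Qed.

(** The expansion is known for [y > 0], but the argument [rho - x] takes both signs under the
    average; oddness extends it. *)
Let pole_sum_th (y : R) : pole_sum y 1 m @[m --> \oo] --> pi / 2 * th y.
Proof.
have [y0|y0|->] := ltgtP y 0.
- rewrite -[y]opprK thN mulrN; under eq_fun do rewrite pole_sumN.
  by apply: cvgN; apply: tanh_partial_fractions; rewrite oppr_gt0.
- exact: tanh_partial_fractions.
- rewrite /th mulr0 expR0 subrr mul0r mulr0.
  by under eq_fun do rewrite pole_sum0; exact: cvg_cst.
Qed.

Let pole_sum_bounded (y : R) m : `|pole_sum y 1 m| <= pi / 2.
Proof.
have [y0|y0|->] := ltgtP y 0.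
- have y1 : 0 < - y by rewrite oppr_gt0.
  rewrite -[y]opprK pole_sumN normrN ger0_norm ?pole_sum_ge0//.
  exact: pole_sum1_le.
- by rewrite ger0_norm ?pole_sum_ge0//; exact: pole_sum1_le.
- by rewrite pole_sum0 normr0 divr_ge0// pi_ge0.
Qed.

Variable rho : R.
Hypothesis rho_gt0 : 0 < rho.

Let cont_comp (f : R -> R) : continuous f ->
  continuous (fun x => cauchy_pdf x * f (rho - x)).
Proof.
move=> cf x; apply: cvgM; first exact: continuous_cauchy_pdf.
apply: (@continuous_comp _ _ _ (fun x => rho - x) f); last exact: cf.
by apply: cvgB; [exact: cvg_cst|exact: cvg_id].
Qed.

Let integral_pole_sum m :
  (\int[leb]_x (cauchy_pdf x * pole_sum (rho - x) 1 m)%:E = (pole_sum rho 2 m)%:E)%E.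
Proof.
under eq_integral => x _.
  rewrite pole_sumE mulr_sumr -sumEFin.
  over.
rewrite integral_sum//; last first.
  by move=> k; apply: integrable_cauchy_lorentz => //; rewrite ltr0n addn1.
rewrite /pole_sum -sumEFin; apply: eq_bigr => k _.
rewrite integral_cauchy_lorentz// ?ltr0n ?addn1//; congr EFin.
by rewrite natr1 addn2 [X in _ / X]addrC.
Qed.

Let th_int :
  leb.-integrable setT (EFin \o (fun x => cauchy_pdf x * (pi / 2 * th (rho - x)))) /\
  (\int[leb]_x (cauchy_pdf x * (pi / 2 * th (rho - x)))%:E =
   (pi / 2 * ((expR (pi * rho) + 1) / (expR (pi * rho) - 1)) - rho^-1)%:E)%E.
Proof.
pose f m x := cauchy_pdf x * pole_sum (rho - x) 1 m.
have mf m : measurable_fun setT (f m).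
  apply: continuous_measurable_fun.
  apply: (cont_comp (f := fun y => pole_sum y 1 m)) => y.
  by apply: cvg_big => [|k _]; [exact: add_continuous|exact: continuous_lorentz].
have cf x : setT x -> f m x @[m --> \oo] --> cauchy_pdf x * (pi / 2 * th (rho - x)).
  by move=> _; apply: cvgM; [exact: cvg_cst|exact: pole_sum_th].
have ig : leb.-integrable setT (EFin \o (fun x => pi / 2 * cauchy_pdf x)).
  exact: (integrableZl measurableT (pi / 2) integrable_cauchy_pdf).
have fg m x : setT x -> `|f m x| <= pi / 2 * cauchy_pdf x.
  move=> _; rewrite normrM mulrC (ger0_norm (ltW (cauchy_pdf_gt0 x))).
  by rewrite ler_wpM2r ?(ltW (cauchy_pdf_gt0 _)).
have h1 := dominated_cvg_real (m := leb) measurableT mf cf ig fg.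
split; first exact: (dominated_integrable_real (m := leb) measurableT mf cf ig fg).
have h2 : (\int[leb]_x (f m x)%:E @[m --> \oo] -->
   (pi / 2 * ((expR (pi * rho) + 1) / (expR (pi * rho) - 1)) - rho^-1)%:E)%E.
  rewrite (eq_cvg _ _ integral_pole_sum).
  by apply: cvg_EFin; [exact: nearW|exact: coth_partial_fractions].
exact: cvg_unique h1 h2.
Qed.

Lemma logistic_gt0 y : 0 < logistic y.
Proof. by rewrite invr_gt0 addr_gt0// expR_gt0. Qed.

Lemma logistic_le1 y : logistic y <= 1.
Proof. by rewrite invf_le1 ?lerDl ?expR_ge0// addr_gt0 ?expR_gt0. Qed.

Lemma continuous_logistic : continuous logistic.
Proof.
move=> y; apply: cvgV; first by rewrite gt_eqF// addr_gt0// expR_gt0.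
apply: cvgD; first exact: cvg_cst.
apply: (@continuous_comp _ _ _ (fun y => - y) expR); last exact: continuous_expR.
exact: continuousN.
Qed.

Let logistic_th y : logistic (pi * y) = 2^-1 + pi^-1 * (pi / 2 * th y).
Proof.
rewrite /logistic /th expRN; have := expR_gt0 (pi * y).
set e := expR _ => e0; move: (pi_gt0 R); move: pi => c c0.
by field; rewrite !gt_eqF// addr_gt0.
Qed.

Lemma integral_cauchy_logistic :
  (\int[leb]_x (cauchy_pdf x * logistic (pi * (rho - x)))%:E =
   (expR (pi * rho) / (expR (pi * rho) - 1) - (pi * rho)^-1)%:E)%E.
Proof.
have [ith eth] := th_int.
under eq_integral => x _.
  rewrite logistic_th mulrDr mulrC [X in _ + X]mulrCA EFinD EFinM [X in (_ + X)%E]EFinM.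
  over.
rewrite integralD//; last 2 first.
- exact: (integrableZl measurableT 2^-1 integrable_cauchy_pdf).
- exact: (integrableZl measurableT pi^-1 ith).
rewrite integralZl//; last exact: integrable_cauchy_pdf.
rewrite integralZl// eth integral_cauchy_pdf -!EFinM -EFinD; congr EFin.
have : 1 < expR (pi * rho) by rewrite -expR0 ltr_expR mulr_gt0 ?pi_gt0.
set e := expR _ => e1; move: (pi_gt0 R); move: pi => c c0.
by field; rewrite !gt_eqF// subr_gt0.
Qed.

End cauchy_logistic.

(** * Integrals against laws *)

Section weighted_integral.
Context d1 (T1 : measurableType d1) d2 (T2 : measurableType d2) {R : realType}.
Variables (m1 : {measure set T1 -> \bar R}) (m2 : {measure set T2 -> \bar R}).
Variables (X : T1 -> T2) (w : T1 -> R) (v : T2 -> R).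
Hypotheses (mX : measurable_fun setT X) (mw : measurable_fun setT w)
  (mv : measurable_fun setT v).
Hypotheses (w0 : forall x, 0 <= w x) (v0 : forall y, 0 <= v y).
Hypothesis wv : forall A, measurable A ->
  (\int[m1]_x (w x * \1_A (X x))%:E = \int[m2]_y (v y * \1_A y)%:E)%E.

Import HBNNSimple.

Let weighted_nnsfun d (T : measurableType d) (m : {measure set T -> \bar R})
    (Y : T -> T2) (u : T -> R) (h : {nnsfun T2 >-> R}) :
  measurable_fun setT Y -> measurable_fun setT u -> (forall x, 0 <= u x) ->
  (\int[m]_x ((u x)%:E * (h (Y x))%:E) =
   \sum_(a \in range h) a%:E * \int[m]_x (u x * \1_(h @^-1` [set a]) (Y x))%:E)%E.
Proof.
move=> mY mu u0.
have mI a : measurable_fun setT (fun x => \1_(h @^-1` [set a]) (Y x) : R).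
  by apply: measurableT_comp.
under eq_integral => x _.
  rewrite (fimfunE h) -fsumEFin// ge0_mule_fsumr//; last first.
    by move=> a; rewrite EFinM; exact: nnfun_muleindic_ge0.
  over.
rewrite ge0_integral_fsum//; last 2 first.
- move=> a; apply: emeasurable_funM; apply/measurable_EFinP => //.
  by apply: measurable_funM.
- move=> a x _; rewrite mule_ge0 ?lee_fin//.
  by have := nnfun_muleindic_ge0 h a (Y x); rewrite -EFinM lee_fin.
apply: eq_fsbigr => a _.
have [a0|a0] := leP 0 a.
  rewrite -ge0_integralZl_EFin//.
  - by apply: eq_integral => x _; rewrite -!EFinM mulrCA.
  - by move=> x _; rewrite lee_fin mulr_ge0.
  - by apply/measurable_EFinP; apply: measurable_funM.
(* A negative [a] is not a value of [h], so its preimage is empty and both sides vanish. *)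
rewrite !integral0_eq ?mule0// => x _; rewrite (_ : \1_ _ _ = 0 :> R) ?mulr0 ?mule0//.
all: rewrite indicE memNset//= => hx; have : 0 <= h (Y x) by [].
all: by rewrite hx leNgt a0.
Qed.

(** Simple functions carry the identity from indicators to nonnegative functions. The two weights
    serve two purposes: [w = 1] with a density [v] computes expectations, and a product [w] of other
    factors with a constant [v] expresses independence. *)
Lemma weighted_integral (g : T2 -> \bar R) :
  measurable_fun setT g -> (forall y, 0 <= g y)%E ->
  (\int[m1]_x ((w x)%:E * g (X x)) = \int[m2]_y ((v y)%:E * g y))%E.
Proof.
move=> mg g0; pose h := nnsfun_approx measurableT mg.
have lim d (T : measurableType d) (m : {measure set T -> \bar R}) (Y : T -> T2)
    (u : T -> R) : measurable_fun setT Y -> measurable_fun setT u ->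
    (forall x, 0 <= u x) -> (\int[m]_x ((u x)%:E * g (Y x)) =
      limn (fun n => \int[m]_x ((u x)%:E * (h n (Y x))%:E)))%E.
  move=> mY mu u0; rewrite -monotone_convergence//=.
  - apply: eq_integral => x _; apply/esym/cvg_lim => //=.
    by apply: cvgeZl => //; exact: cvg_nnsfun_approx.
  - move=> n; apply: emeasurable_funM; apply/measurable_EFinP => //.
    exact: measurableT_comp.
  - by move=> n x _; rewrite mule_ge0 ?lee_fin.
  - move=> x _ a b ab; rewrite lee_wpmul2l ?lee_fin//.
    exact/lefP/nd_nnsfun_approx.
rewrite lim// [RHS](lim _ _ m2 id v)//.
congr (limn _); apply/funext => n; rewrite !weighted_nnsfun//.
by apply: eq_fsbigr => a _; rewrite wv.
Qed.

End weighted_integral.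

Section measurable_inverse.
Context {R : realType}.

(** The inverse is the pointwise limit of the continuous functions [x / (x ^ 2 + 1 / (n + 1))], also
    at 0, where all of them vanish. *)
Lemma measurable_inv : measurable_fun setT (fun x : R => x^-1).
Proof.
pose h (n : nat) (x : R) := x / (x ^+ 2 + n.+1%:R^-1).
apply: (measurable_fun_cvg (h := h)) => [n|x _].
  apply: continuous_measurable_fun => x; apply: cvgM; first exact: cvg_id.
  apply: cvgV; first by rewrite gt_eqF// ltr_wpDl ?sqr_ge0// invr_gt0.
  by apply: cvgD; [exact: exprn_continuous|exact: cvg_cst].
have [->|x0] := eqVneq x 0.
  by rewrite invr0; under eq_fun do rewrite /h mul0r; exact: cvg_cst.
have -> : x^-1 = x / (x ^+ 2 + 0) by field.
apply: cvgM; first exact: cvg_cst.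
apply: cvgV; first by rewrite addr0 expf_neq0.
by apply: cvgD; [exact: cvg_cst|exact: cvg_harmonic].
Qed.

Lemma measurable_invr d (T : measurableType d) (f : T -> R) :
  measurable_fun setT f -> measurable_fun setT (fun x => (f x)^-1).
Proof. by move=> mf; apply: (measurableT_comp measurable_inv). Qed.

Lemma measurable_expRr d (T : measurableType d) (f : T -> R) :
  measurable_fun setT f -> measurable_fun setT (fun x => expR (f x)).
Proof. by move=> mf; apply: (measurableT_comp (@measurable_expR R)). Qed.

Lemma measurable_lnr d (T : measurableType d) (f : T -> R) :
  measurable_fun setT f -> measurable_fun setT (fun x => ln (f x)).
Proof. by move=> mf; apply: (measurableT_comp (@measurable_ln R)). Qed.

End measurable_inverse.

Ltac mfun := repeat first
  [ assumption
  | exact: measurable_cst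
  | exact: measurable_id
  | exact: measurable_fst
  | exact: measurable_snd
  | exact: measurable_funPT
  | apply: measurable_funB
  | apply: measurable_funD
  | apply: measurable_funM
  | apply: measurable_funX
  | apply: measurable_funN
  | apply: measurable_expRr
  | apply: measurable_lnr
  | apply: measurable_invr ].

Section laws.
Context {R : realType}.

Lemma eq_law_integral d1 (T1 : measurableType d1) (P1 : probability T1 R)
    d2 (T2 : measurableType d2) (P2 : probability T2 R)
    d' (T' : measurableType d') (X : T1 -> T') (Y : T2 -> T') (g : T' -> \bar R) :
  measurable_fun setT X -> measurable_fun setT Y -> eq_law P1 P2 X Y ->
  measurable_fun setT g -> (forall y, 0 <= g y)%E ->
  (\int[P1]_x g (X x) = \int[P2]_x g (Y x))%E.
Proof.
move=> mX mY XY mg g0.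
rewrite -(@ge0_integral_pushforward _ _ _ _ R X mX P1 setT g)//.
rewrite -(@ge0_integral_pushforward _ _ _ _ R Y mY P2 setT g)//.
by apply: eq_measure_integral => A mA _; exact: XY.
Qed.

Lemma integral_EFin_indic d (T : measurableType d) (m : {measure set T -> \bar R})
    d' (T' : measurableType d') (X : T -> T') (A : set T') :
  measurable_fun setT X -> measurable A ->
  (\int[m]_x (\1_A (X x))%:E = m (X @^-1` A))%E.
Proof.
move=> mX mA; have mXA : measurable (X @^-1` A) by rewrite -[X in measurable X]setTI; exact: mX.
by rewrite -[in RHS](setIT (X @^-1` A)) -integral_indic.
Qed.

Lemma has_density_integral d (T : measurableType d) (P : probability T R)
    (X : T -> R) (f : R -> R) (g : R -> \bar R) :
  measurable_fun setT X -> has_density P X (EFin \o f) ->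
  measurable_fun setT g -> (forall y, 0 <= g y)%E ->
  (\int[P]_w g (X w) = \int[lebesgue_measure]_x ((f x)%:E * g x))%E.
Proof.
move=> mX [/measurable_EFinP mf f0 lawX] mg g0.
have f0' x : 0 <= f x by rewrite -lee_fin; exact: f0.
have wv A : measurable A ->
    (\int[P]_x (1 * \1_A (X x))%:E = \int[lebesgue_measure]_y (f y * \1_A y)%:E)%E.
  move=> mA; under eq_integral do rewrite mul1r.
  rewrite integral_EFin_indic// -[LHS]/(pushforward P X A) lawX// integral_mkcond.
  apply: eq_integral => x _; rewrite patchE indicE.
  by case: ifPn => _; rewrite ?mulr1 ?mulr0.
rewrite -(weighted_integral (m2 := lebesgue_measure) (w := fun=> 1) mX
  (measurable_cst _) mf (fun=> ler01) f0' wv)//.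
by apply: eq_integral => x _; rewrite mul1e.
Qed.

End laws.

Section tonelli.
Local Open Scope ereal_scope.
Context d1 (T1 : measurableType d1) d2 (T2 : measurableType d2) {R : realType}.
Variables (m1 : {sigma_finite_measure set T1 -> \bar R})
  (m2 : {sigma_finite_measure set T2 -> \bar R}).

(** Nonnegativity is asked on the product set only, because the kernel of the density of [Gamma_1]
    can be negative outside of it; extending by 0 reduces to the whole space. *)
Lemma fubini_tonelli_in (A : set T1) (B : set T2) (f : T1 -> T2 -> \bar R) :
  measurable A -> measurable B ->
  measurable_fun setT (fun z : T1 * T2 => f z.1 z.2) ->
  (forall x y, A x -> B y -> 0 <= f x y) ->
  \int[m1]_(x in A) \int[m2]_(y in B) f x y =
  \int[m2]_(y in B) \int[m1]_(x in A) f x y.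
Proof.
move=> mA mB mf f0.
pose g (z : T1 * T2) := ((fun z => f z.1 z.2) \_ (A `*` B)) z.
have mAB : measurable (A `*` B) by exact: measurableX.
have mg : measurable_fun setT g.
  by apply/(measurable_restrictT _ mAB); exact: measurable_funTS.
have g0 z : 0 <= g z.
  rewrite /g patchE; case: ifPn => // /set_mem [Az Bz]; exact: f0.
transitivity (\int[m1]_x \int[m2]_y g (x, y)).
  rewrite integral_mkcond; apply: eq_integral => x _; rewrite patchE.
  case: ifPn => xA.
    rewrite integral_mkcond; apply: eq_integral => y _; rewrite /g !patchE.
    by rewrite in_setX/= xA.
  by rewrite integral0_eq// => y _; rewrite /g patchE in_setX/= (negbTE xA).
rewrite fubini_tonelli// [RHS]integral_mkcond; apply: eq_integral => y _; rewrite patchE.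
case: ifPn => yB.
  rewrite [RHS]integral_mkcond; apply: eq_integral => x _; rewrite /g !patchE.
  by rewrite in_setX/= yB andbT.
by rewrite integral0_eq// => x _; rewrite /g patchE in_setX/= (negbTE yB) andbF.
Qed.

End tonelli.

(** * The Levy exponent *)

Section frullani.
Context {R : realType}.
Local Notation leb := (@lebesgue_measure R).

Lemma integral_expR_tail (s a : R) : 0 < s ->
  (\int[leb]_(x in `[a, +oo[) (expR (- (s * x)))%:E = (expR (- (s * a)) / s)%:E)%E.
Proof.
move=> s0.
have dF (x : R) : is_derive x (1 : R) (fun x => - s^-1 * expR (- (s * x))) (expR (- (s * x))).
  by derive_rule; field; rewrite gt_eqF.
have cf : continuous (fun x => expR (- (s * x))).
  move=> x; apply: is_derive_continuous; derive_rule; reflexivity.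
rewrite (@ge0_continuous_FTC2y _ _ (fun x => - s^-1 * expR (- (s * x))) a 0).
- by rewrite sub0e; congr EFin; field; rewrite gt_eqF.
- by move=> x _; exact: expR_ge0.
- exact: continuous_subspaceT.
- rewrite -[X in _ --> X](mulr0 (- s^-1)); apply: cvgM; first exact: cvg_cst.
  apply: (cvg_comp (fun x => s * x) (fun x => expR (- x)) _ (@cvgr_expR R)).
  exact: gt0_cvgMry.
- by move=> x _; have := dF x => h; exact: ex_derive.
- by apply/cvg_at_right_filter/(is_derive_continuous (dF _)).
- by move=> x _; rewrite derive1E; have := dF x => h; exact: derive_val.
Qed.

Lemma integral_expR_gt0 (s : R) : 0 < s ->
  (\int[leb]_(x in `]0%R, +oo[) (expR (- (s * x)))%:E = (s^-1)%:E)%E.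
Proof.
move=> s0; rewrite integral_itv_obnd_cbnd; last by apply/measurable_EFinP/measurable_funTS; mfun.
by rewrite integral_expR_tail// mulr0 oppr0 expR0 mul1r.
Qed.

(** The integrand is the integral of [exp (- s x)] over [s] in [[c, c + l]]; exchanging the two
    integrals leaves that of [1 / s]. *)
Lemma frullani (l c : R) : 0 <= l -> 0 < c ->
  (\int[leb]_(x in `]0%R, +oo[)
     ((1 - expR (- (l * x))) * (x^-1 * expR (- (x * c))))%:E = (ln (1 + l / c))%:E)%E.
Proof.
move=> l0 c0; have cl : c <= c + l by rewrite lerDl.
transitivity (\int[leb]_(x in `]0%R, +oo[) \int[leb]_(s in `[c, (c + l)%R])
    (expR (- (s * x)))%:E)%E.
  apply: eq_integral => x /set_mem/=; rewrite in_itv/= andbT => x0.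
  have dF (s : R) : c <= s <= c + l -> is_derive s (1 : R)
      (fun s => - x^-1 * expR (- (s * x))) (expR (- (s * x))).
    by move=> _; derive_rule; field; rewrite gt_eqF.
  rewrite (integral_antiderivative cl _ dF).
    by congr EFin; rewrite (mulrDl c l x) opprD expRD (mulrC x c); ring.
  by move=> s _; apply: is_derive_continuous; derive_rule; reflexivity.
rewrite fubini_tonelli_in//; last by apply/measurable_EFinP; mfun.
transitivity (\int[leb]_(s in `[c, (c + l)%R]) (s^-1)%:E)%E.
  apply: eq_integral => s /set_mem/=; rewrite in_itv/= => /andP[cs _].
  by rewrite integral_expR_gt0// (lt_le_trans c0).
have dln (s : R) : c <= s <= c + l -> is_derive s (1 : R) (@ln R) s^-1.
  by move=> /andP[cs _]; apply: is_derive1_ln; rewrite (lt_le_trans c0).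
rewrite (integral_antiderivative cl _ dln).
  congr EFin; rewrite -ln_div ?posrE ?(lt_le_trans c0)//.
  by congr ln; field; rewrite gt_eqF.
move=> s /andP[cs _]; apply: cvgV; last exact: cvg_id.
by rewrite gt_eqF// (lt_le_trans c0).
Qed.

End frullani.

Section cauchy_log.
Context {R : realType}.
Local Notation leb := (@lebesgue_measure R).

(** A primitive in [s] of the logistic function whose Cauchy average is known; the logarithm to be
    averaged is [lnD y r - lnD y 0]. *)
Let lnD (y s : R) : R := ln (expR (pi * y) + expR s).

Let lnD_arg_gt0 (y s : R) : 0 < expR (pi * y) + expR s.
Proof. by rewrite addr_gt0// expR_gt0. Qed.

Let lnD_derive (y s : R) : is_derive s (1 : R) (lnD y) (logistic (s - pi * y)).
Proof.
have d1 : is_derive s (1 : R) (fun s => expR (pi * y) + expR s) (expR s).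
  by derive_rule; ring.
have := @is_derive1_comp R (@ln R) (fun s => expR (pi * y) + expR s) s _ _
  (is_derive1_ln (lnD_arg_gt0 y s)) d1.
have -> : (expR (pi * y) + expR s)^-1 * expR s = logistic (s - pi * y); last by [].
rewrite /logistic opprB expRD expRN; have := expR_gt0 (pi * y); have := expR_gt0 s.
by move: (expR s) (expR _) => a b a0 b0; field; rewrite !gt_eqF// addr_gt0.
Qed.

Let cont_logistic (y : R) : continuous (fun s => logistic (s - pi * y)).
Proof.
move=> s; apply: (@continuous_comp _ _ _ (fun s => s - pi * y) logistic).
  by apply: cvgB; [exact: cvg_id|exact: cvg_cst].
exact: continuous_logistic.
Qed.

Let mlogistic (y : R) : measurable_fun setT (fun s : R => logistic (s - pi * y)).
Proof. by rewrite /logistic; mfun. Qed.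

Let integral_lnD (y a b : R) : a <= b ->
  (\int[leb]_(s in `[a, b]) (logistic (s - pi * y))%:E = (lnD y b - lnD y a)%:E)%E.
Proof.
move=> ab; rewrite (integral_antiderivative ab _ (fun s _ => lnD_derive y s))//.
by move=> s _; exact: cont_logistic.
Qed.

Let lnD_le (y a b : R) : a <= b -> 0 <= lnD y b - lnD y a <= b - a.
Proof.
move=> ab; rewrite -!lee_fin -integral_lnD//; apply/andP; split.
  by apply: integral_ge0 => s _; rewrite lee_fin ltW// logistic_gt0.
have <- : (\int[leb]_(s in `[a, b]) 1%:E = (b - a)%:E)%E.
  by rewrite integral_cst//= mul1e lebesgue_measure_itv/= lte_fin; case: ltgtP ab => // ->; rewrite subrr.
apply: ge0_le_integral => //.
- by move=> s _; rewrite lee_fin ltW// logistic_gt0.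
- by apply/measurable_EFinP/measurable_funTS; exact: mlogistic.
- by move=> s _; rewrite lee_fin logistic_le1.
Qed.

(** A primitive of the averaged logistic function; by [Lam_bounds] it tends to 0 at 0. *)
Let Lam (s : R) : R := ln (expR s - 1) - ln s.

Let expR_gt1 (s : R) : 0 < s -> 0 < expR s - 1.
Proof. by move=> s0; rewrite subr_gt0 -expR0 ltr_expR. Qed.

Let Lam_derive (s : R) : 0 < s ->
  is_derive s (1 : R) Lam (expR s / (expR s - 1) - s^-1).
Proof.
move=> s0; have d0 : is_derive s (1 : R) (fun s => expR s - 1) (expR s).
  by derive_rule; ring.
have d1 := @is_derive1_comp R (@ln R) (fun s => expR s - 1) s _ _
  (is_derive1_ln (expR_gt1 s0)) d0.
have d2 := is_derive1_ln s0.
have := is_deriveB d1 d2.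
by rewrite [(_ - 1)^-1 * _]mulrC.
Qed.

Let Lam_bounds (s : R) : 0 < s -> 0 <= Lam s <= s.
Proof.
move=> s0; rewrite /Lam subr_ge0 lerBlDr -{4}(expRK s) -lnM ?posrE ?expR_gt0//.
rewrite !ler_ln ?posrE ?expR_gt1// ?mulr_gt0 ?expR_gt0//.
have h1 := expR_ge1Dx s; have h2 := expR_ge1Dx (- s).
apply/andP; split; first by lra.
have : expR s * (1 + - s) <= expR s * expR (- s) by rewrite ler_pM2l ?expR_gt0.
by rewrite -expRD subrr expR0; lra.
Qed.

Let mlnD (s : R) : measurable_fun setT (fun y : R => lnD y s).
Proof. by rewrite /lnD; mfun. Qed.

Let mcauchy : measurable_fun setT (@cauchy_pdf R).
Proof. by apply: continuous_measurable_fun; exact: continuous_cauchy_pdf. Qed.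

Let integral_lnD_between (e r : R) : 0 < e -> e <= r ->
  (\int[leb]_y (cauchy_pdf y * (lnD y r - lnD y e))%:E = (Lam r - Lam e)%:E)%E.
Proof.
move=> e0 er.
transitivity (\int[leb]_y \int[leb]_(s in `[e, r])
    (cauchy_pdf y * logistic (s - pi * y))%:E)%E.
  apply: eq_integral => y _; rewrite EFinM -integral_lnD//.
  rewrite -ge0_integralZl_EFin//.
  - by move=> s _; rewrite lee_fin ltW// logistic_gt0.
  - by apply/measurable_EFinP/measurable_funTS; exact: mlogistic.
  - by rewrite ltW// cauchy_pdf_gt0.
rewrite fubini_tonelli_in//; last 2 first.
- apply/measurable_EFinP; apply: measurable_funM.
    by apply: (measurableT_comp mcauchy); mfun.
  by rewrite /logistic; mfun.
- by move=> y s _ _; rewrite lee_fin mulr_ge0 ?ltW ?logistic_gt0 ?cauchy_pdf_gt0.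
transitivity (\int[leb]_(s in `[e, r]) (expR s / (expR s - 1) - s^-1)%:E)%E.
  apply: eq_integral => s /set_mem/=; rewrite in_itv/= => /andP[es _].
  have s0 : 0 < s by exact: lt_le_trans es.
  have e1 : pi * (s / pi) = s by rewrite mulrC divfK// gt_eqF// pi_gt0.
  have := integral_cauchy_logistic (divr_gt0 s0 (pi_gt0 R)); rewrite e1 => <-.
  by apply: eq_integral => y _; rewrite mulrBr e1.
have dL s : e <= s <= r -> is_derive s (1 : R) Lam (expR s / (expR s - 1) - s^-1).
  by move=> /andP[es _]; apply: Lam_derive; exact: lt_le_trans es.
rewrite (integral_antiderivative er _ dL)//.
move=> s /andP[es _]; have s0 : 0 < s by exact: lt_le_trans es.
apply: cvgB; last by apply: cvgV; [rewrite gt_eqF|exact: cvg_id].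
apply: cvgM; first exact: continuous_expR.
apply: cvgV; first by rewrite gt_eqF// expR_gt1.
by apply: cvgB; [exact: continuous_expR|exact: cvg_cst].
Qed.

Let mdiff a b : measurable_fun setT (fun y => (cauchy_pdf y * (lnD y a - lnD y b))%:E).
Proof.
apply/measurable_EFinP/measurable_funM; first exact: mcauchy.
by apply: measurable_funB; exact: mlnD.
Qed.

(** On [[e, r]] the average is [Lam r - Lam e] by Tonelli. The remainder from 0 to [e] lies between
    0 and [e] because the logistic function lies between 0 and 1, and so does [Lam e]. *)
Lemma integral_cauchy_log_ratio (r : R) : 0 < r ->
  (\int[leb]_y (cauchy_pdf y *
     ln ((expR (pi * y) + expR r) / (expR (pi * y) + 1)))%:E
   = (ln ((expR r - 1) / r))%:E)%E.
Proof.
move=> r0.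
under eq_integral => y _.
  rewrite -expR0 ln_div ?posrE// -/(lnD y r) -/(lnD y 0).
  over.
rewrite ln_div ?posrE ?expR_gt1// -/(Lam r); set J := (\int[leb]_y _)%E.
have split e : 0 < e -> e <= r ->
    J = ((Lam r - Lam e)%:E + \int[leb]_y (cauchy_pdf y * (lnD y e - lnD y 0))%:E)%E.
  move=> e0 er; rewrite -integral_lnD_between// -ge0_integralD//.
  - by apply: eq_integral => y _; rewrite -EFinD -mulrDr; congr (_ * _)%:E; ring.
  - move=> y _; rewrite lee_fin mulr_ge0 ?(ltW (cauchy_pdf_gt0 _))//.
    by have /andP[] := lnD_le y er.
  - exact: mdiff.
  - move=> y _; rewrite lee_fin mulr_ge0 ?(ltW (cauchy_pdf_gt0 _))//.
    by have /andP[] := lnD_le y (ltW e0).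
  - exact: mdiff.
have small e : 0 < e -> (0 <= \int[leb]_y (cauchy_pdf y * (lnD y e - lnD y 0))%:E <= e%:E)%E.
  move=> e0; apply/andP; split.
    apply: integral_ge0 => y _; rewrite lee_fin mulr_ge0 ?(ltW (cauchy_pdf_gt0 _))//.
    by have /andP[] := lnD_le y (ltW e0).
  have <- : (\int[leb]_y (e%:E * (cauchy_pdf y)%:E) = e%:E)%E.
    rewrite ge0_integralZl_EFin ?integral_cauchy_pdf ?mule1// ?(ltW e0)//.
    - by move=> y _; rewrite lee_fin ltW// cauchy_pdf_gt0.
    - exact/measurable_EFinP.
  apply: ge0_le_integral => //.
  - move=> y _; rewrite lee_fin mulr_ge0 ?(ltW (cauchy_pdf_gt0 _))//.
    by have /andP[] := lnD_le y (ltW e0).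
  - exact: mdiff.
  - by apply: emeasurable_funM => //; exact/measurable_EFinP.
  - move=> y _; rewrite -EFinM lee_fin mulrC ler_wpM2r ?(ltW (cauchy_pdf_gt0 _))//.
    by have /andP[_] := lnD_le y (ltW e0); rewrite subr0.
have lower e : 0 < e -> e <= r -> ((Lam r - e)%:E <= J <= (Lam r + e)%:E)%E.
  move=> e0 er; rewrite (split e e0 er).
  have /andP[s1 s2] := small e e0; have /andP[b1 b2] := Lam_bounds e0.
  apply/andP; split.
    by rewrite -[X in (X <= _)%E]adde0 leeD// lee_fin lerD2l lerN2.
  by rewrite [X in (_ <= X)%E]EFinD leeD// lee_fin gerBl.
(* The case [e = r] already shows that [J] is finite. *)
have [J0 J1] : ((Lam r - r)%:E <= J /\ J <= (Lam r + r)%:E)%E.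
  by have /andP[] := lower r r0 (lexx _).
move: J0 J1 lower; case: J split => [j| |]//= _ _ _ h.
congr EFin; apply/eqP; rewrite -subr_eq0 -normr_le0; apply/ler_addgt0Pl => e e0.
rewrite addr0.
have m0 : 0 < Num.min e r by rewrite lt_min e0.
have mr : Num.min e r <= r by rewrite ge_min lexx orbT.
have me : Num.min e r <= e by rewrite ge_min lexx.
have := h _ m0 mr; rewrite !lee_fin => /andP[h1 h2].
by rewrite (le_trans _ me)// ler_norml; apply/andP; split; lra.
Qed.

End cauchy_log.

Section levy_exponent.
Context {R : realType}.
Local Notation leb := (@lebesgue_measure R).

Lemma expectationE d (T : measurableType d) (P : probability T R) (X : T -> R) :
  ('E_P[X] = \int[P]_w (X w)%:E)%E.
Proof. by rewrite unlock. Qed.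

Definition cauchy_to_G0 (y : R) : R := 1 / (1 + expR (pi * y)).

Lemma cauchy_to_G0_gt0 y : 0 < cauchy_to_G0 y.
Proof. by rewrite divr_gt0// addr_gt0// expR_gt0. Qed.

Lemma measurable_cauchy_to_G0 : measurable_fun setT cauchy_to_G0.
Proof. by rewrite /cauchy_to_G0; mfun. Qed.

Lemma measurable_cauchy_pdf : measurable_fun setT (@cauchy_pdf R).
Proof. by apply: continuous_measurable_fun; exact: continuous_cauchy_pdf. Qed.

Variables (mu : R).
Hypothesis mu_ge0 : 0 <= mu.

(** With [e^r = (a + l) / a], the argument of the logarithm is
    [a (e^(pi y) + e^r) / (e^(pi y) + 1)]. The average is therefore [ln a + ln ((e^r - 1) / r)], and
    [a (e^r - 1) = l]. *)
Lemma integral_cauchy_log (l : R) : 0 < l ->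
  (\int[leb]_y (cauchy_pdf y * ln (1 + l * (mu + cauchy_to_G0 y)))%:E
   = (ln (l / ln ((1 + l * (1 + mu)) / (1 + l * mu))))%:E)%E.
Proof.
move=> l0; set a := 1 + l * mu.
have a1 : 1 <= a by rewrite lerDl mulr_ge0// ltW.
have a0 : 0 < a := lt_le_trans ltr01 a1.
have -> : 1 + l * (1 + mu) = a + l by rewrite /a; ring.
set r := ln ((a + l) / a).
have al : 1 < (a + l) / a by rewrite ltr_pdivlMr// mul1r ltrDl.
have r0 : 0 < r by exact: ln_gt0.
have er : expR r = (a + l) / a by rewrite /r lnK// posrE divr_gt0// addr_gt0.
have e y : ln (1 + l * (mu + cauchy_to_G0 y))
    = ln a + ln ((expR (pi * y) + expR r) / (expR (pi * y) + 1)).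
  have e0 := expR_gt0 (pi * y).
  have q0 : 0 < (expR (pi * y) + expR r) / (expR (pi * y) + 1).
    by rewrite divr_gt0 ?addr_gt0 ?expR_gt0.
  rewrite -lnM ?posrE//; congr (ln _).
  rewrite er /cauchy_to_G0 (_ : 1 + l * _ = a + l / (1 + expR (pi * y))).
    by field; rewrite !gt_eqF// ?addr_gt0.
  by rewrite /a; field; rewrite gt_eqF// addr_gt0.
under eq_integral do rewrite e mulrDr EFinD.
have mc := measurable_cauchy_pdf.
rewrite ge0_integralD//; last 4 first.
- by move=> y _; rewrite lee_fin mulr_ge0 ?ln_ge0// ltW// cauchy_pdf_gt0.
- by apply/measurable_EFinP; mfun.
- move=> y _; rewrite lee_fin mulr_ge0 ?(ltW (cauchy_pdf_gt0 _))//.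
  have e0 := expR_gt0 (pi * y).
  rewrite ln_ge0// ler_pdivlMr ?addr_gt0// mul1r lerD2l -expR0 ler_expR.
  exact: ltW.
- by apply/measurable_EFinP; mfun.
rewrite integral_cauchy_log_ratio// er.
under eq_integral do rewrite mulrC EFinM.
rewrite integralZl//; last exact: integrable_cauchy_pdf.
rewrite integral_cauchy_pdf mule1 -EFinD -lnM ?posrE//; last first.
  by rewrite divr_gt0// subr_gt0.
by congr (ln _)%:E; field; rewrite !gt_eqF.
Qed.

Variables (dC : measure_display) (TC : measurableType dC) (PC : probability TC R)
  (C : {RV PC >-> R}) (dG : measure_display) (TG : measurableType dG)
  (PG : probability TG R) (G0 : {RV PG >-> R}).
Hypotheses (C_cauchy : standard_cauchy PC C)
  (G0_law : eq_law PG PC G0 (fun w => 1 / (1 + expR (pi * C w)))).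

Lemma integral_G0 (g : R -> \bar R) : measurable_fun setT g -> (forall x, 0 <= g x)%E ->
  (\int[PG]_w g (G0 w) = \int[leb]_y ((cauchy_pdf y)%:E * g (cauchy_to_G0 y)))%E.
Proof.
move=> mg g0; have mf := measurable_cauchy_to_G0.
have mC : measurable_fun setT C by exact: measurable_funPT.
have mfC : measurable_fun setT (fun w => 1 / (1 + expR (pi * C w))) by mfun.
have mgf : measurable_fun setT (fun y => g (cauchy_to_G0 y)).
  exact: measurableT_comp mg mf.
rewrite (eq_law_integral (measurable_funPT G0) mfC G0_law mg g0).
exact: (has_density_integral mC C_cauchy mgf).
Qed.

(** Tonelli brings the [x]-integral inside the expectation, where it is Frullani's with
    [c = 1 / (mu + G0)]. *)
Lemma levy_exponent (l : R) : 0 < l ->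
  (\int[leb]_(x in `]0%R, +oo[) ((1 - expR (- (l * x)))%:E *
     ((x^-1)%:E * 'E_PG[fun w => expR (- (x / (mu + G0 w)))%R])))%E
  = (ln (l / ln ((1 + l * (1 + mu)) / (1 + l * mu))))%:E.
Proof.
move=> l0; have mG := measurable_cauchy_to_G0; have mc := measurable_cauchy_pdf.
transitivity (\int[leb]_(x in `]0%R, +oo[) \int[leb]_y ((cauchy_pdf y) *
    ((1 - expR (- (l * x))) * (x^-1 * expR (- (x * (mu + cauchy_to_G0 y)^-1)))))%:E)%E.
  apply: eq_integral => x /set_mem/=; rewrite in_itv/= andbT => x0.
  rewrite expectationE.
  rewrite (@integral_G0 (fun g => (expR (- (x / (mu + g))))%:E)); last 2 first.
  - by apply/measurable_EFinP; mfun.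
  - by move=> g; rewrite lee_fin expR_ge0.
  have h0 : 0 <= 1 - expR (- (l * x)).
    by rewrite subr_ge0 -expR0 ler_expR oppr_le0 mulr_ge0// ltW.
  have k0 : 0 <= (1 - expR (- (l * x))) * x^-1 by rewrite mulr_ge0// invr_ge0 ltW.
  rewrite muleA -EFinM -ge0_integralZl_EFin//.
  - by apply: eq_integral => y _; rewrite -!EFinM; congr EFin; ring.
  - by move=> y _; rewrite -EFinM lee_fin mulr_ge0 ?expR_ge0// ltW// cauchy_pdf_gt0.
  - by apply: emeasurable_funM; apply/measurable_EFinP; mfun.
rewrite fubini_tonelli_in//; last 2 first.
- apply/measurable_EFinP; apply: measurable_funM.
    exact: (measurableT_comp mc measurable_snd).
  have mG2 : measurable_fun setT (fun z : R * R => cauchy_to_G0 z.2).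
    exact: (measurableT_comp mG measurable_snd).
  by mfun.
- move=> x y /=; rewrite in_itv/= andbT => x0 _.
  rewrite lee_fin mulr_ge0 ?(ltW (cauchy_pdf_gt0 _))// !mulr_ge0 ?expR_ge0//.
    by rewrite subr_ge0 -expR0 ler_expR oppr_le0 mulr_ge0// ltW.
  by rewrite invr_ge0 ltW.
rewrite -integral_cauchy_log//; apply: eq_integral => y _.
have g0 : 0 < mu + cauchy_to_G0 y by rewrite ltr_wpDl// cauchy_to_G0_gt0.
under eq_integral do rewrite EFinM.
rewrite ge0_integralZl_EFin//.
- rewrite frullani ?(ltW l0) ?invr_gt0//.
  by rewrite invrK.
- move=> x /=; rewrite in_itv/= andbT => x0.
  rewrite lee_fin !mulr_ge0 ?expR_ge0//.
    by rewrite subr_ge0 -expR0 ler_expR oppr_le0 mulr_ge0// ltW.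
  by rewrite invr_ge0 ltW.
- by apply/measurable_EFinP/measurable_funTS; mfun.
- by rewrite ltW// cauchy_pdf_gt0.
Qed.

End levy_exponent.

(** * Laplace transforms determine laws *)

Section hausdorff_kernel.
Context {R : realType}.
Implicit Types b x : R.

(* Polynomial in exp(-x), by the binomial formula; it converges to the indicator
   of ]b, +oo[ because (1 - q^n)^(n p^n) ~ exp(- n (p q)^n). *)
Definition hausdorff_kernel b (n : nat) x : R :=
  (1 - expR (- (n%:R * x))) ^+ Num.truncn (n%:R * expR (n%:R * b)).

Lemma bernoulli_ge x (m : nat) : 0 <= x <= 1 -> 1 - m%:R * x <= (1 - x) ^+ m.
Proof.
move=> /andP[x0 x1]; elim: m => [|m IH]; first by rewrite mul0r subr0 expr0.
rewrite exprS; apply: le_trans (ler_wpM2l _ IH); last by rewrite subr_ge0.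
rewrite -natr1 -subr_ge0.
by rewrite (_ : _ - _ = m%:R * x ^+ 2) ?mulr_ge0 ?sqr_ge0//; ring.
Qed.

(** At [n c] it bounds [n exp (- n c)] by [4 / (c^2 n)]. *)
Lemma expR_ge_sqr x : 0 <= x -> x ^+ 2 / 4 <= expR x.
Proof.
move=> x0; have -> : x = x / 2 + x / 2 by field.
rewrite expRD; have h : x / 2 <= expR (x / 2).
  by rewrite (le_trans _ (expR_ge1Dx _))// lerDr.
have -> : (x / 2 + x / 2) ^+ 2 / 4 = x / 2 * (x / 2) by field.
by rewrite ler_pM// divr_ge0.
Qed.

Let expN_bounds (n : nat) x : 0 <= x -> 0 <= expR (- (n%:R * x)) <= 1.
Proof.
move=> x0; rewrite expR_ge0/= -expR0 ler_expR oppr_le0.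
by rewrite mulr_ge0.
Qed.

Lemma hausdorff_kernel_bounds b n x : 0 <= x -> 0 <= hausdorff_kernel b n x <= 1.
Proof.
move=> /(expN_bounds n) /andP[h0 h1].
by rewrite exprn_ge0 ?exprn_ile1 ?subr_ge0// lerBlDr lerDl.
Qed.

Let natV_cvg : n%:R^-1 @[n --> \oo] --> (0 : R).
Proof. by rewrite -cvg_shiftS; exact: cvg_harmonic. Qed.

(** For [b < x], Bernoulli's inequality bounds the kernel below by [1 - n exp (- n (x - b))]. For
    [x <= b], [1 - q <= exp (- q)] bounds it above by [exp (1 - n)], the 1 paying for the truncation
    of the exponent to an integer. The factor [n] in that exponent gives the limit 0 at [x = b] as
    well, where it would otherwise be [exp (- 1)]. *)
Lemma hausdorff_kernel_cvg b x : 0 <= x ->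
  hausdorff_kernel b n x @[n --> \oo] --> (\1_`]b, +oo[%classic x : R).
Proof.
move=> x0.
have [bx|xb] := ltP b x.
  rewrite indicE mem_set/=; last by rewrite in_itv/= bx.
  pose c := x - b; have c0 : 0 < c by rewrite subr_gt0.
  apply: (@squeeze_cvgr _ _ _ _ (fun n : nat => 1 - 4 / c ^+ 2 * n%:R^-1) (fun=> 1)).
  - near=> n; have /andP[_ ->] := hausdorff_kernel_bounds b n x0; rewrite andbT.
    have n0 : 0 < n%:R :> R by rewrite ltr0n; near: n; exact: nbhs_infty_gt.
    apply: le_trans (bernoulli_ge _ (expN_bounds n x0)); rewrite lerD2l lerN2.
    apply: (@le_trans _ _ (n%:R * expR (n%:R * b) * expR (- (n%:R * x)))).
      by rewrite ler_wpM2r ?expR_ge0// truncn_le mulr_ge0 ?expR_ge0.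
    rewrite -mulrA -expRD (_ : _ + _ = - (n%:R * c)); last by rewrite /c; ring.
    rewrite expRN ler_pdivrMr ?expR_gt0//.
    have := @expR_ge_sqr (n%:R * c); rewrite mulr_ge0 ?(ltW c0)// => /(_ isT) h.
    apply: le_trans (ler_wpM2l _ h).
      rewrite le_eqVlt; apply/orP; left; apply/eqP; field.
      by rewrite !gt_eqF.
    by rewrite mulr_ge0 ?invr_ge0 ?divr_ge0 ?sqr_ge0// ltW.
  - rewrite -[X in _ --> X]subr0 -[X in _ --> _ - X](mulr0 (4 / c ^+ 2)).
    by apply: cvgB; [exact: cvg_cst|apply: cvgM; [exact: cvg_cst|exact: natV_cvg]].
  - exact: cvg_cst.
rewrite indicE memNset/=; last by rewrite in_itv/= andbT; apply/negP; rewrite -leNgt.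
apply: (@squeeze_cvgr _ _ _ _ (fun=> 0) (fun n : nat => expR 1 * expR (- n%:R))).
- near=> n; have /andP[-> _]/= := hausdorff_kernel_bounds b n x0.
  rewrite /hausdorff_kernel; set m := Num.truncn _; set q := expR (- _).
  have /andP[q0 q1] : 0 <= q <= 1 by exact: expN_bounds.
  have h : 1 - q <= expR (- q) by exact: expR_ge1Dx.
  apply: (@le_trans _ _ (expR (- q) ^+ m)).
    by rewrite lerXn2r ?nnegrE ?subr_ge0 ?expR_ge0.
  rewrite -expRM_natl -expRD ler_expR.
  have hm : n%:R * expR (n%:R * b) <= m%:R + 1 by rewrite natr1 ltW// truncnS_gt.
  have hq : expR (- (n%:R * b)) <= q.
    by rewrite ler_expR lerN2; apply: ler_wpM2l.
  have : n%:R <= (m%:R + 1) * q.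
    apply: le_trans (ler_wpM2r q0 hm); rewrite -mulrA ler_peMr//.
    apply: le_trans (ler_wpM2l (expR_ge0 _) hq).
    by rewrite -expRD subrr expR0.
  by rewrite mulrDl mul1r; lra.
- exact: cvg_cst.
- rewrite -[X in _ --> X](mulr0 (expR 1)); apply: cvgM; first exact: cvg_cst.
  exact: cvgn_expR.
Unshelve. all: end_near. Qed.

End hausdorff_kernel.

Section laplace_unique.
Context {R : realType}.

Lemma bounded_integrable d (T : measurableType d) (P : probability T R)
    (f : T -> R) (c : R) : measurable_fun setT f -> (forall x, `|f x| <= c) ->
  P.-integrable setT (EFin \o f).
Proof.
move=> mf fc; have PT : (P setT < +oo)%E by rewrite probability_setT ltry.
apply: (measurable_bounded_integrable measurableT PT mf).
exists c; split; first exact: num_real.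
by move=> x cx y _; exact: le_trans (fc y) (ltW cx).
Qed.

Lemma eq_measure_tails (m1 m2 : {measure set R -> \bar R}) :
  (m1 setT < +oo)%E -> m1 setT = m2 setT ->
  (forall b, m1 `]b, +oo[%classic = m2 `]b, +oo[%classic) ->
  forall A, measurable A -> m1 A = m2 A.
Proof.
move=> m1T m12T m12 A mA.
(* The whole line joins the rays so that the constant sequence [setT] exhausts the space within the
   generating class, which stays closed under intersection. *)
pose G : set (set R) := [set B | B = setT \/ exists b, B = `]b, +oo[%classic].
apply: (measure_unique G (fun=> setT)) => //.
- transitivity (<<s @RGenOInfty.G R >>); first exact: RGenOInfty.measurableE.
  apply/seteqP; split.
    apply: smallest_sub; first exact: smallest_sigma_algebra.
    by move=> B [b ->]; apply: sub_sigma_algebra; right; exists b.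
  have [s0 sC _] := smallest_sigma_algebra [set: R] (@RGenOInfty.G R).
  apply: smallest_sub; first exact: smallest_sigma_algebra.
  move=> B [->|[b ->]]; first by have := sC _ s0; rewrite setD0.
  by apply: sub_sigma_algebra; exists b.
- move=> B D [->|[b ->]] [->|[c ->]]; rewrite ?setTI ?setIT.
  + by left.
  + by right; exists c.
  + by right; exists b.
  + right; exists (Num.max b c); apply/seteqP; split => x /=;
      rewrite !in_itv/= !andbT gt_max.
      by move=> [-> ->].
    by move=> /andP[].
- by move=> _; left.
- by rewrite bigcup_const//; exists 0%N.
- by move=> B [->|[b ->]]; [exact: m12T|exact: m12].
Qed.

Lemma eq_law_tails d1 (T1 : measurableType d1) (P1 : probability T1 R)
    d2 (T2 : measurableType d2) (P2 : probability T2 R) (X : T1 -> R) (Y : T2 -> R) :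
  measurable_fun setT X -> measurable_fun setT Y ->
  (forall b, P1 (X @^-1` `]b, +oo[) = P2 (Y @^-1` `]b, +oo[)) -> eq_law P1 P2 X Y.
Proof.
move=> mX mY XY A mA.
pose m1 : {measure set R -> \bar R} := pushforward P1 X.
pose m2 : {measure set R -> \bar R} := pushforward P2 Y.
have XY' b : m1 mX `]b, +oo[%classic = m2 mY `]b, +oo[%classic by exact: XY.
apply: (eq_measure_tails _ _ XY' mA).
  by rewrite -[m1 mX setT]/(P1 (X @^-1` setT)) preimage_setT probability_setT ltry.
rewrite -[m1 mX setT]/(P1 (X @^-1` setT)) -[m2 mY setT]/(P2 (Y @^-1` setT)).
by rewrite !preimage_setT !probability_setT.
Qed.

Section nonnegative.
Context d1 (T1 : measurableType d1) (P1 : probability T1 R)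
    d2 (T2 : measurableType d2) (P2 : probability T2 R) (X : T1 -> R) (Y : T2 -> R).
Hypotheses (mX : measurable_fun setT X) (mY : measurable_fun setT Y)
  (X0 : forall w, 0 <= X w) (Y0 : forall w, 0 <= Y w).
Hypothesis XY : forall l, 0 < l ->
  (\int[P1]_w (expR (- (l * X w)))%:E = \int[P2]_w (expR (- (l * Y w)))%:E)%E.

(** The parameter [k] lets [moment_rec] expand the power one factor at a time, down to Laplace
    transforms, without binomial coefficients. *)
Let moment d (T : measurableType d) (P : probability T R) (Z : T -> R) (n m : nat) (k : R) :=
  \int[P]_w (expR (- (k * Z w)) * (1 - expR (- (n%:R * Z w))) ^+ m).

Let intZ d (T : measurableType d) (P : probability T R) (Z : T -> R) (n m : nat) (k : R) :
  measurable_fun setT Z -> (forall w, 0 <= Z w) -> 0 <= k -> P.-integrable setT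
    (EFin \o (fun w => expR (- (k * Z w)) * (1 - expR (- (n%:R * Z w))) ^+ m)).
Proof.
move=> mZ Z0 k0; apply: (@bounded_integrable _ _ _ _ 1) => [|w]; first by mfun.
have e01 c : 0 <= c -> 0 <= expR (- (c * Z w)) <= 1.
  by move=> c0; rewrite expR_ge0/= -expR0 ler_expR oppr_le0 mulr_ge0.
have /andP[a0 a1] := e01 _ k0; have /andP[b0 b1] := e01 n%:R (ler0n _ _).
rewrite ger0_norm ?mulr_ge0 ?exprn_ge0 ?subr_ge0//.
by rewrite mulr_ile1 ?exprn_ge0 ?exprn_ile1 ?subr_ge0// lerBlDr lerDl.
Qed.

Let moment_rec d (T : measurableType d) (P : probability T R) (Z : T -> R) (n m : nat) (k : R) :
  measurable_fun setT Z -> (forall w, 0 <= Z w) -> 0 <= k ->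
  moment P Z n m.+1 k = moment P Z n m k - moment P Z n m (k + n%:R).
Proof.
move=> mZ Z0 k0; rewrite -RintegralB//; last 2 first.
- exact: intZ.
- by apply: intZ => //; rewrite addr_ge0.
apply: eq_Rintegral => w _; rewrite mulrDl opprD expRD exprS; ring.
Qed.

Let moment_eq (n m : nat) (k : R) : 0 <= k -> moment P1 X n m k = moment P2 Y n m k.
Proof.
elim: m k => [|m IH] k k0; last by rewrite !moment_rec// !IH// addr_ge0.
rewrite /moment /Rintegral; congr fine.
under eq_integral do rewrite expr0 mulr1.
under [RHS]eq_integral do rewrite expr0 mulr1.
(* The hypothesis concerns positive arguments; at [k = 0] both sides are total masses. *)
move: k0; rewrite le_eqVlt => /predU1P[<-|]; last exact: XY.
under eq_integral do rewrite mul0r oppr0 expR0.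
under [RHS]eq_integral do rewrite mul0r oppr0 expR0.
by rewrite !integral_cst// ![_ setT]probability_setT.
Qed.

Let kernel_cvg d (T : measurableType d) (P : probability T R) (Z : T -> R) (b : R) :
  measurable_fun setT Z -> (forall w, 0 <= Z w) ->
  (\int[P]_w (hausdorff_kernel b n (Z w))%:E @[n --> \oo] --> P (Z @^-1` `]b, +oo[))%E.
Proof.
move=> mZ Z0; rewrite -integral_EFin_indic//.
apply: (@dominated_cvg_real _ _ _ P setT measurableT
  (fun n w => hausdorff_kernel b n (Z w)) _ (fun=> 1)) => //.
- by move=> n; rewrite /hausdorff_kernel; mfun.
- by move=> w _; exact: hausdorff_kernel_cvg.
- by apply: (@bounded_integrable _ _ _ _ 1) => // w; rewrite normr1.
- by move=> n w _; have /andP[h0 h1] := hausdorff_kernel_bounds b n (Z0 w); rewrite ger0_norm.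
Qed.

Let kernel_eq b n : (\int[P1]_w (hausdorff_kernel b n (X w))%:E =
  \int[P2]_w (hausdorff_kernel b n (Y w))%:E)%E.
Proof.
have h d (T : measurableType d) (P : probability T R) (Z : T -> R) :
    measurable_fun setT Z -> (forall w, 0 <= Z w) ->
    (\int[P]_w (hausdorff_kernel b n (Z w))%:E =
      (moment P Z n (Num.truncn (n%:R * expR (n%:R * b))) 0)%:E)%E.
  move=> mZ Z0; have := intZ P n (Num.truncn (n%:R * expR (n%:R * b))) mZ Z0 (lexx 0).
  move=> iZ; rewrite /moment /Rintegral fineK; last exact: integrable_fin_num.
  by apply: eq_integral => w _; rewrite mul0r oppr0 expR0 mul1r.
by rewrite !h// moment_eq.
Qed.

Lemma laplace_unique : eq_law P1 P2 X Y.
Proof.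
apply: eq_law_tails => // b.
have h1 := kernel_cvg (P := P1) (b := b) mX X0; have h2 := kernel_cvg (P := P2) (b := b) mY Y0.
rewrite (eq_cvg _ _ (kernel_eq b)) in h1.
exact: cvg_unique h1 h2.
Qed.

End nonnegative.
End laplace_unique.

Section almost_everywhere.
Context {R : realType}.

Lemma eq_law_trans d1 (T1 : measurableType d1) (P1 : probability T1 R)
    d2 (T2 : measurableType d2) (P2 : probability T2 R)
    d3 (T3 : measurableType d3) (P3 : probability T3 R) d' (T' : measurableType d')
    (X : T1 -> T') (Y : T2 -> T') (Z : T3 -> T') :
  eq_law P1 P2 X Y -> eq_law P2 P3 Y Z -> eq_law P1 P3 X Z.
Proof. by move=> XY YZ A mA; rewrite XY// YZ. Qed.

Lemma eq_law_sym d1 (T1 : measurableType d1) (P1 : probability T1 R)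
    d2 (T2 : measurableType d2) (P2 : probability T2 R) d' (T' : measurableType d')
    (X : T1 -> T') (Y : T2 -> T') :
  eq_law P1 P2 X Y -> eq_law P2 P1 Y X.
Proof. by move=> XY A mA; rewrite XY. Qed.

Lemma eq_law_comp d1 (T1 : measurableType d1) (P1 : probability T1 R)
    d2 (T2 : measurableType d2) (P2 : probability T2 R) d' (T' : measurableType d')
    d'' (T'' : measurableType d'') (f : T' -> T'')
    (X : T1 -> T') (Y : T2 -> T') : measurable_fun setT f ->
  eq_law P1 P2 X Y -> eq_law P1 P2 (f \o X) (f \o Y).
Proof.
move=> mf XY A mA; apply: (XY (f @^-1` A)).
by rewrite -[X in measurable X]setTI; exact: mf.
Qed.

Lemma eq_law_ae d (T : measurableType d) (P : probability T R)
    d' (T' : measurableType d') (X Y : T -> T') :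
  measurable_fun setT X -> measurable_fun setT Y ->
  {ae P, forall w, X w = Y w} -> eq_law P P X Y.
Proof.
move=> mX mY XY A mA; rewrite /pushforward -!integral_EFin_indic//.
apply: ae_eq_integral => //.
- by apply/measurable_EFinP; apply: measurableT_comp.
- by apply/measurable_EFinP; apply: measurableT_comp.
- by apply: filterS XY => w -> _.
Qed.

(** Each variable is replaced by its positive part, which changes neither its law nor its Laplace
    transform. *)
Lemma laplace_unique_ae d1 (T1 : measurableType d1) (P1 : probability T1 R)
    d2 (T2 : measurableType d2) (P2 : probability T2 R) (X : T1 -> R) (Y : T2 -> R) :
  measurable_fun setT X -> measurable_fun setT Y ->
  {ae P1, forall w, 0 <= X w} -> {ae P2, forall w, 0 <= Y w} ->
  (forall l, 0 < l -> (\int[P1]_w (expR (- (l * X w)))%:E =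
                       \int[P2]_w (expR (- (l * Y w)))%:E)%E) ->
  eq_law P1 P2 X Y.
Proof.
move=> mX mY X0 Y0 XY.
have mM d (T : measurableType d) (Z : T -> R) : measurable_fun setT Z ->
    measurable_fun setT (fun w => Num.max (Z w) 0).
  by move=> mZ; exact: measurable_maxr.
have eqM d (T : measurableType d) (P : probability T R) (Z : T -> R) :
    {ae P, forall w, 0 <= Z w} -> {ae P, forall w, Z w = Num.max (Z w) 0}.
  by apply: filterS => w Zw; rewrite max_l.
have mE d (T : measurableType d) (Z : T -> R) l : measurable_fun setT Z ->
    measurable_fun setT (fun w => (expR (- (l * Z w)))%:E).
  by move=> mZ; apply/measurable_EFinP; mfun.
have intM d (T : measurableType d) (P : probability T R) (Z : T -> R) l :
    measurable_fun setT Z -> {ae P, forall w, 0 <= Z w} ->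
    (\int[P]_w (expR (- (l * Num.max (Z w) 0)))%:E = \int[P]_w (expR (- (l * Z w)))%:E)%E.
  move=> mZ Z0; apply: ae_eq_integral => //; [exact/mE/mM|exact: mE|].
  by apply: filterS (eqM _ _ _ _ Z0) => w <-.
apply: (eq_law_trans (eq_law_ae mX (mM _ _ _ mX) (eqM _ _ _ _ X0))).
apply: (eq_law_trans _ (eq_law_sym (eq_law_ae mY (mM _ _ _ mY) (eqM _ _ _ _ Y0)))).
apply: laplace_unique => [| | | |l l0]; [exact: mM|exact: mM| | |].
- by move=> w; rewrite le_max lexx orbT.
- by move=> w; rewrite le_max lexx orbT.
- by rewrite (intM _ _ P1 X l mX X0) (intM _ _ P2 Y l mY Y0) XY.
Qed.

End almost_everywhere.

Section independence.
Context d (T : measurableType d) {R : realType} (P : probability T R).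

(** The joint law agrees with the product of the marginals on rectangles, hence everywhere; Tonelli
    concludes. *)
Lemma independent_integral (X Y : {RV P >-> R}) (g : R * R -> \bar R) :
  independent P X Y -> measurable_fun setT g -> (forall z, 0 <= g z)%E ->
  (\int[P]_w g (X w, Y w) =
   \int[distribution P Y]_y \int[distribution P X]_x g (x, y))%E.
Proof.
move=> XY mg g0.
have mXY : measurable_fun setT (fun w => (X w, Y w)).
  by apply: measurable_fun_pair; exact: measurable_funPT.
rewrite -[LHS](@ge0_integral_pushforward _ _ _ _ R _ mXY P setT g)//.
rewrite -(@fubini_tonelli2 _ _ _ _ _ (distribution P X) (distribution P Y) g mg g0).
apply: eq_measure_integral => A mA _; apply/esym.
have mu12 (A1 A2 : set R) : measurable A1 -> measurable A2 ->
  pushforward P (fun w => (X w, Y w)) (A1 `*` A2)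
    = (distribution P X A1 * distribution P Y A2)%E by exact: XY.
exact: (product_measure_unique (m' := pushforward P _) mu12).
Qed.

End independence.

Lemma measurable_EFin_indic {R : realType} d (T : measurableType d)
    d' (T' : measurableType d') (A : set T') (X : T -> T') :
  measurable A -> measurable_fun setT X ->
  measurable_fun setT (fun w => (\1_A (X w))%:E : \bar R).
Proof.
move=> mA mX; apply/measurable_EFinP.
exact: (measurableT_comp (measurable_indic mA)).
Qed.

(** * The laws of Gamma_1 and D_1 *)

Section exponential_variables.
Context {R : realType}.
Local Notation leb := (@lebesgue_measure R).

(** What a standard exponential and a gamma variable of parameter 1 have in common, so that
    [exponential_mul_tail] treats both [e (U + mu)] and [gamma_1 D]. *)
Definition exponential_tail d (T : measurableType d) (P : probability T R)
    (e : T -> R) := forall x, 0 <= x -> P (e @^-1` `]x, +oo[) = (expR (- x))%:E.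

Let integral_tail (x : R) :
  (\int[leb]_(z in `]x, +oo[) (expR (- z))%:E = (expR (- x))%:E)%E.
Proof.
rewrite integral_itv_obnd_cbnd; last by apply/measurable_EFinP/measurable_funTS; mfun.
have := @integral_expR_tail R 1 x ltr01; rewrite mul1r divr1 => <-.
by apply: eq_integral => z _; rewrite mul1r.
Qed.

Lemma standard_exponential_tail d (T : measurableType d) (P : probability T R)
    (e : T -> R) : standard_exponential P e -> exponential_tail P e.
Proof.
move=> he x x0; rewrite -[LHS]/(pushforward P e `]x, +oo[) he//.
rewrite /exponential_prob -integral_tail; apply: eq_integral => z /set_mem/=.
rewrite in_itv/= andbT => xz; rewrite exponential_pdfE ?mul1r ?mulN1r//.
by rewrite (le_trans x0)// ltW.
Qed.

Lemma Gamma1 : Gamma (1 : R) = 1.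
Proof.
rewrite /Gamma /Rintegral (_ : integral _ _ _ = (1%:E : \bar R))//.
have := @integral_expR_gt0 R 1 ltr01; rewrite invr1.
move=> <-; apply: eq_integral => x /set_mem/=; rewrite in_itv/= andbT => x0.
by rewrite subrr powRr0 !mul1r.
Qed.

Lemma gamma_variable1_tail d (T : measurableType d) (P : probability T R)
    (g : T -> R) : gamma_variable P 1 g -> exponential_tail P g.
Proof.
move=> [_ _ hg] x x0; rewrite -[LHS]/(pushforward P g `]x, +oo[) hg//.
rewrite -integral_tail; apply: eq_integral => z /set_mem/=.
rewrite in_itv/= andbT => xz; rewrite /gamma_pdf (le_lt_trans x0 xz).
by rewrite Gamma1 divr1 subrr powRr0 mulr1.
Qed.

(** Given [V = v > 0], the product exceeds [t] when [e] exceeds [t / v]. Positivity is almost sure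
    only, and is first transferred to the law of [V]. *)
Lemma exponential_mul_tail d (T : measurableType d) (P : probability T R)
    (e V : {RV P >-> R}) (t : R) : exponential_tail P e -> independent P e V ->
  {ae P, forall w, 0 < V w} -> 0 <= t ->
  P ((fun w => e w * V w) @^-1` `]t, +oo[) = (\int[P]_w (expR (- (t / V w)))%:E)%E.
Proof.
move=> he eV V0 t0.
have mV : measurable_fun setT V by exact: measurable_funPT.
have me : measurable_fun setT e by exact: measurable_funPT.
have mm : measurable_fun setT (fun z : R * R => z.1 * z.2) by mfun.
have mi := measurable_EFin_indic (R := R) (measurable_itv `]t, +oo[) mm.
rewrite -integral_EFin_indic//; last by mfun.
rewrite (independent_integral eV mi)//.
have mE : measurable_fun setT (fun v : R => (expR (- (t / v)))%:E).
  by apply/measurable_EFinP; mfun.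
transitivity (\int[distribution P V]_v (expR (- (t / v)))%:E)%E; last first.
  by rewrite ge0_integral_pushforward// => v _; rewrite lee_fin expR_ge0.
have mV0 : measurable (`]0, +oo[%classic : set R) by exact: measurable_itv.
have V0d : {ae distribution P V, forall v : R, 0 < v}.
  move: V0 => [N [mN PN VN]].
  exists (~` `]0, +oo[%classic); split; first exact: measurableC.
    apply/eqP; rewrite -measure_le0 -PN.
    rewrite -[X in (X <= _)%E]/(P (V @^-1` (~` `]0, +oo[))); apply: le_measure; rewrite ?inE//.
      by rewrite -[X in measurable X]setTI; apply: mV => //; exact: measurableC.
    by move=> w /= h; apply: VN => /= Vw; apply: h; rewrite /= in_itv/= Vw.
  by move=> v /= h; move=> hv; apply: h; move: hv; rewrite in_itv/= andbT.
apply: ae_eq_integral => //.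
- have := measurable_fun_fubini_tonelli_G (m1 := distribution P e) _ mi.
  by apply => z; rewrite lee_fin.
- apply: filterS V0d => v v0 _.
  rewrite -[RHS]he ?divr_ge0 ?(ltW v0)//.
  rewrite integral_EFin_indic//; last by mfun.
  rewrite /distribution /pushforward; congr (P _); apply/seteqP; split => w /=.
    by rewrite !in_itv/= !andbT ltr_pdivrMr.
  by rewrite !in_itv/= !andbT ltr_pdivrMr.
Qed.

End exponential_variables.

Section uniform_variables.
Context {R : realType}.
Local Notation leb := (@lebesgue_measure R).
Context d (T : measurableType d) (P : probability T R) (U : {RV P >-> R}).
Hypothesis U_uniform : uniform01 P U.

Lemma uniform01_integral (g : R -> \bar R) :
  measurable_fun setT g -> (forall x, 0 <= g x)%E ->
  (\int[P]_w g (U w) = \int[leb]_(y in `[0%R, 1%R]) g y)%E.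
Proof.
move=> mg g0.
have hd : has_density P U (EFin \o uniform_pdf 0 1).
  split; first by apply/measurable_EFinP; exact: measurable_uniform_pdf.
    by move=> x; rewrite lee_fin uniform_pdf_ge0.
  exact: U_uniform.
rewrite (has_density_integral (measurable_funPT U) hd mg g0) [RHS]integral_mkcond.
apply: eq_integral => y _; rewrite patchE mem_setE in_itv/= /uniform_pdf.
by case: ifPn => _; rewrite ?subr0 ?invr1 ?mul1e ?mul0e.
Qed.

Lemma uniform01_gt0 : {ae P, forall w, 0 < U w}.
Proof.
have mU : measurable_fun setT U by exact: measurable_funPT.
have mN : measurable (`]-oo, 0]%classic : set R) by exact: measurable_itv.
exists (U @^-1` `]-oo, 0]%classic); split.
- by rewrite -[X in measurable X]setTI; exact: mU.
- have mi := @measurable_EFin_indic R _ _ _ _ _ id mN (@measurable_id _ _ setT).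
  rewrite -integral_EFin_indic// (uniform01_integral mi)//.
  rewrite -integral_itv_obnd_cbnd; last exact: measurable_funTS.
  rewrite integral0_eq// => y /=; rewrite in_itv/= => /andP[y0 _].
  by rewrite indicE memNset//= in_itv/=; apply/negP; rewrite -ltNge.
- move=> w /= h; rewrite in_itv/= leNgt; exact/negP.
Qed.

End uniform_variables.

Section mixture.
Context {R : realType}.
Local Notation leb := (@lebesgue_measure R).

(** The tail of [Gamma_1] is wanted where no pair [e], [U] is given, for its density and for [D_1];
    such a pair is built on a product space. *)
Lemma exponential_uniform_model : exists (d : measure_display) (T : measurableType d)
  (P : probability T R) (e U : {RV P >-> R}),
  [/\ standard_exponential P e, uniform01 P U & independent P e U].
Proof.
pose PE : probability (measurableTypeR R) R := exponential_prob (1 : R).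
pose PU : probability (measurableTypeR R) R := uniform_prob (@ltr01 R).
pose P : probability (measurableTypeR R * measurableTypeR R)%type R := (PE ltr01 \x PU)%E.
pose f1 : measurableTypeR R * measurableTypeR R -> R := fst.
pose f2 : measurableTypeR R * measurableTypeR R -> R := snd.
have me : measurable_fun setT f1.
  exact: measurable_fst.
have mU : measurable_fun setT f2.
  exact: measurable_snd.
pose e : {RV P >-> R} := HB.pack f1 (isMeasurableFun.Build _ _ _ _ _ me).
pose U : {RV P >-> R} := HB.pack f2 (isMeasurableFun.Build _ _ _ _ _ mU).
have rect A B : measurable A -> measurable B -> P (A `*` B) = (PE ltr01 A * PU B)%E.
  by move=> mA mB; exact: product_measure1E.
have lawE A : measurable A -> P (e @^-1` A) = PE ltr01 A.
  move=> mA; rewrite (_ : _ @^-1` A = A `*` setT) ?rect//.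
    by rewrite -[RHS]mule1 -(probability_setT PU).
  by apply/seteqP; split => z //= -[].
have lawU A : measurable A -> P (U @^-1` A) = PU A.
  move=> mA; rewrite (_ : _ @^-1` A = setT `*` A) ?rect//.
    by rewrite -[RHS]mul1e -(probability_setT (PE ltr01)).
  by apply/seteqP; split => z //= -[].
exists _, _, P, e, U; split => //.
by move=> A B mA mB; rewrite lawE// lawU// -rect.
Qed.

Variable mu : R.
Hypothesis mu_ge0 : 0 <= mu.

(** The tail of [e (U + mu)] and also the Laplace transform of [1 / (U + mu)]: this double role
    identifies [D_1]. For [mu = 0], the default value of the quotient at [y = 0] concerns a null
    set. *)
Definition mixture_tail (x : R) : \bar R :=
  (\int[leb]_(y in `[0%R, 1%R]) (expR (- (x / (mu + y))))%:E)%E.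

Section product.
Context d (T : measurableType d) (P : probability T R) (e U : {RV P >-> R}).
Hypotheses (he : standard_exponential P e) (hU : uniform01 P U)
  (heU : independent P e U).

Let mshift : measurable_fun setT (fun w => U w + mu).
Proof. by apply: measurable_funD; [exact: measurable_funPT|exact: measurable_cst]. Qed.

Let V : {RV P >-> R} := HB.pack (fun w => U w + mu) (isMeasurableFun.Build _ _ _ _ _ mshift).

Lemma product_tail x : 0 <= x ->
  P ((fun w => e w * (U w + mu)) @^-1` `]x, +oo[) = mixture_tail x.
Proof.
move=> x0.
have eV : independent P e V.
  move=> A B mA mB; apply: (heU (B := (fun y => y + mu) @^-1` B)) => //.
  rewrite -[X in measurable X]setTI.
  by apply: (measurable_funD (@measurable_id _ _ setT) (measurable_cst mu)).
have V0 : {ae P, forall w, 0 < V w}.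
  by apply: filterS (uniform01_gt0 hU) => w Uw; rewrite ltr_wpDr.
rewrite (exponential_mul_tail (standard_exponential_tail he) eV V0 x0).
rewrite (uniform01_integral hU (g := fun y => (expR (- (x / (y + mu))))%:E)).
- by apply: eq_integral => y _; rewrite addrC.
- by apply/measurable_EFinP; mfun.
- by move=> y; rewrite lee_fin expR_ge0.
Qed.

(** Given [U = y], the exponential variable contributes [1 / (1 + l (y + mu))], whose integral over
    [[0, 1]] is the logarithm. *)
Lemma product_laplace l : 0 < l ->
  (\int[P]_w (expR (- (l * (e w * (U w + mu)))))%:E =
   (l^-1 * ln ((1 + l * (1 + mu)) / (1 + l * mu)))%:E)%E.
Proof.
move=> l0.
have mg : measurable_fun setT (fun z : R * R => (expR (- (l * (z.1 * (z.2 + mu)))))%:E).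
  by apply/measurable_EFinP; mfun.
rewrite (independent_integral heU mg)//.
have he' : has_density P e (EFin \o exponential_pdf 1).
  split; first by apply/measurable_EFinP; exact: measurable_exponential_pdf.
    by move=> x; rewrite lee_fin exponential_pdf_ge0.
  exact: he.
have inner y : 0 <= y ->
  (\int[distribution P e]_x (expR (- (l * (x * (y + mu)))))%:E =
    ((1 + l * (y + mu))^-1)%:E)%E.
  move=> y0; have my : measurable_fun setT (fun x : R => (expR (- (l * (x * (y + mu)))))%:E).
    by apply/measurable_EFinP; mfun.
  rewrite ge0_integral_pushforward//.
  have s0 : 0 < 1 + l * (y + mu) by rewrite ltr_wpDr// mulr_ge0 ?addr_ge0// ltW.
  rewrite preimage_setT.
  have /= -> := has_density_integral (measurable_funPT e) he' my (fun x => expR_ge0 _).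
  transitivity (\int[leb]_(x in `[0%R, +oo[) (expR (- ((1 + l * (y + mu)) * x)))%:E)%E.
    rewrite [RHS]integral_mkcond; apply: eq_integral => x _.
    rewrite patchE mem_setE in_itv/= andbT; case: (leP 0 x) => x0; last first.
      by rewrite lt0_exponential_pdf// mul0e.
    rewrite exponential_pdfE// mul1r -EFinM -expRD; congr (expR _)%:E; ring.
  by rewrite integral_expR_tail// mulr0 oppr0 expR0 mul1r.
transitivity (\int[leb]_(y in `[0%R, 1%R]) ((1 + l * (y + mu))^-1)%:E)%E.
  have mG : measurable_fun setT (fun y : R =>
      \int[distribution P e]_x (expR (- (l * (x * (y + mu)))))%:E)%E.
    have := measurable_fun_fubini_tonelli_G (m1 := distribution P e) _ mg.
    by apply => z; rewrite lee_fin.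
  rewrite ge0_integral_pushforward//; last by move=> y _; apply: integral_ge0 => x _; rewrite lee_fin expR_ge0.
  rewrite preimage_setT (uniform01_integral hU mG).
    by apply: eq_integral => y /set_mem/=; rewrite in_itv/= => /andP[y0 _]; exact: inner.
  by move=> y; apply: integral_ge0 => x _; rewrite lee_fin expR_ge0.
have s0 y : 0 <= y -> 0 < 1 + l * (y + mu).
  by move=> y0; rewrite ltr_wpDr// mulr_ge0 ?addr_ge0// ltW.
have dF (y : R) : 0 <= y <= 1 -> is_derive y (1 : R)
    (fun y => l^-1 * ln (1 + l * (y + mu))) (1 + l * (y + mu))^-1.
  move=> /andP[y0 _].
  have d1 : is_derive y (1 : R) (fun y => 1 + l * (y + mu)) l by derive_rule; ring.
  have d2 := @is_derive1_comp R (@ln R) (fun y => 1 + l * (y + mu)) y _ _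
    (is_derive1_ln (s0 _ y0)) d1.
  apply: is_derive_eq; rewrite /GRing.scale/=.
  by field; rewrite !gt_eqF// s0.
rewrite (integral_antiderivative ler01 _ dF).
  congr EFin; rewrite -mulrBr add0r -ln_div ?posrE ?s0//.
  by have := s0 _ (lexx 0); rewrite add0r.
move=> y /andP[y0 _]; apply: cvgV; first by rewrite gt_eqF// s0.
apply: (@is_derive_continuous R (fun y => 1 + l * (y + mu)) y l).
by derive_rule; ring.
Qed.

End product.
End mixture.

Section density_measure.
Context {R : realType} (f : R -> \bar R).
Hypotheses (mf : measurable_fun setT f) (f0 : forall x, (0 <= f x)%E).
Local Open Scope ereal_scope.

(** Made into a measure so that [eq_measure_tails] can compare it with a law. *)
Definition density_measure (A : set R) : \bar R :=
  \int[@lebesgue_measure R]_(x in A) f x.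

Let density0 : density_measure set0 = 0.
Proof. exact: integral_set0. Qed.

Let density_ge0 A : 0 <= density_measure A.
Proof. by apply: integral_ge0. Qed.

Let density_sigma_additive : semi_sigma_additive density_measure.
Proof.
move=> /= F mF tF mUF; rewrite /density_measure; apply: cvg_toP.
  apply: ereal_nondecreasing_is_cvgn => i j ij.
  by apply: lee_sum_nneg_natr => // k _ _; exact: integral_ge0.
by rewrite ge0_integral_bigcup//; exact: measurable_funTS.
Qed.

HB.instance Definition _ := isMeasure.Build _ R _
  density_measure density0 density_ge0 density_sigma_additive.

End density_measure.

Section mixture_law.
Context {R : realType}.
Local Notation leb := (@lebesgue_measure R).

Lemma ae_gt0_tail d (T : measurableType d) (P : probability T R) (X : T -> R) :
  measurable_fun setT X -> P (X @^-1` `]0, +oo[) = 1%E -> {ae P, forall w, 0 < X w}.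
Proof.
move=> mX PX; have mA : measurable (X @^-1` `]0, +oo[).
  by rewrite -[X in measurable X]setTI; exact: mX.
exists (~` (X @^-1` `]0, +oo[)); split; first exact: measurableC.
  by rewrite probability_setC// PX subee.
by move=> w /= h; move=> hw; apply: h; move: hw; rewrite in_itv/= andbT.
Qed.

Variable mu : R.
Hypothesis mu_ge0 : 0 <= mu.

Lemma mixture_tail0 : mixture_tail mu 0 = 1%E.
Proof.
rewrite /mixture_tail; under eq_integral do rewrite mul0r oppr0 expR0.
by rewrite integral_cst//= lebesgue_measure_itv/= lte01 mul1e sube0.
Qed.

Context d (T : measurableType d) (P : probability T R) (X : T -> R).
Hypotheses (mX : measurable_fun setT X) (X0 : {ae P, forall w, 0 <= X w}).
Hypothesis X_laplace : forall l, 0 < l ->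
  (\int[P]_w (expR (- (l * X w)))%:E =
   (l^-1 * ln ((1 + l * (1 + mu)) / (1 + l * mu)))%:E)%E.

Lemma mixture_law dE (TE : measurableType dE) (PE : probability TE R)
    (e U : {RV PE >-> R}) :
  standard_exponential PE e -> uniform01 PE U -> independent PE e U ->
  eq_law P PE X (fun w => e w * (U w + mu)).
Proof.
move=> he hU heU.
have me : measurable_fun setT e by exact: measurable_funPT.
have mU : measurable_fun setT U by exact: measurable_funPT.
apply: laplace_unique_ae => //; first by mfun.
  have he0 := standard_exponential_tail he (lexx 0).
  rewrite oppr0 expR0 in he0.
  have e0 := ae_gt0_tail me he0; have U0 := uniform01_gt0 hU.
  by apply: filterS2 e0 U0 => w ew Uw; rewrite mulr_ge0 ?addr_ge0// ltW.
by move=> l l0; rewrite X_laplace// -(product_laplace mu_ge0 he hU heU l0).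
Qed.

Lemma mixture_law_tail x : 0 <= x -> P (X @^-1` `]x, +oo[) = mixture_tail mu x.
Proof.
move=> x0; have [dE [TE [PE [e [U [he hU heU]]]]]] := @exponential_uniform_model R.
rewrite -(product_tail mu_ge0 he hU heU x0).
exact: (mixture_law he hU heU).
Qed.

Lemma mixture_law_D1 dD (TD : measurableType dD) (PD : probability TD R)
    (D : {RV PD >-> R}) dU (TU : measurableType dU) (PU : probability TU R)
    (U : {RV PU >-> R}) :
  is_D1 P PD X D -> uniform01 PU U -> eq_law PD PU D (fun w => U w + mu).
Proof.
move=> [d0 [T0 [P0 [g [D' [hg hD indep hX]]]]]] hU.
have mg : measurable_fun setT g by exact: measurable_funPT.
have mD' : measurable_fun setT D' by exact: measurable_funPT.
have mU : measurable_fun setT U by exact: measurable_funPT.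
have tail x : 0 <= x -> P0 ((fun w => g w * D' w) @^-1` `]x, +oo[) = mixture_tail mu x.
  by move=> x0; rewrite -mixture_law_tail//; apply/esym; exact: hX.
have g0 : {ae P0, forall w, 0 < g w}.
  by apply: ae_gt0_tail => //; rewrite (gamma_variable1_tail hg)// oppr0 expR0.
(* The product has tail 1 at 0, so it is almost surely positive, as is its factor [g]; hence [D']
   is. *)
have D0 : {ae P0, forall w, 0 < D' w}.
  have gD0 : {ae P0, forall w, 0 < g w * D' w}.
    by apply: ae_gt0_tail; [mfun|rewrite tail// mixture_tail0].
  by apply: filterS2 g0 gD0 => w gw; rewrite pmulr_rgt0.
have U0 : {ae PU, forall w, 0 < U w + mu}.
  by apply: filterS (uniform01_gt0 hU) => w Uw; rewrite ltr_wpDr.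
(* Inversion is an involution of the whole line, 0 included, so equality in law may be shown for the
   inverses. *)
suff : eq_law P0 PU (fun w => (D' w)^-1) (fun w => (U w + mu)^-1).
  move=> h; apply: (eq_law_trans (eq_law_sym hD)) => A mA.
  pose B := (fun x : R => x^-1) @^-1` A.
  have mB : measurable B by rewrite -[X in measurable X]setTI; exact: measurable_inv.
  have invK d' (T' : measurableType d') (V : T' -> R) :
    (fun w => (V w)^-1) @^-1` B = V @^-1` A.
    by apply/seteqP; split => w; rewrite /B/= invrK.
  have := h B mB; rewrite -[LHS]/(P0 _) -[RHS]/(PU _).
  by rewrite (invK _ _ D') (invK _ _ (fun w => U w + mu)).
apply: laplace_unique_ae; [by mfun|by mfun| | |].
- by apply: filterS D0 => w Dw; rewrite invr_ge0 ltW.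
- by apply: filterS U0 => w Uw; rewrite invr_ge0 ltW.
move=> l l0.
rewrite -(exponential_mul_tail (gamma_variable1_tail hg) indep D0 (ltW l0)) tail ?(ltW l0)//.
rewrite (uniform01_integral hU (g := fun y => (expR (- (l / (y + mu))))%:E)).
- by apply: eq_integral => y _; rewrite addrC.
- by apply/measurable_EFinP; mfun.
- by move=> y; rewrite lee_fin expR_ge0.
Qed.

End mixture_law.

Section mixture_density.
Context {R : realType}.
Local Notation leb := (@lebesgue_measure R).
Variable mu : R.
Hypothesis mu_ge0 : 0 <= mu.

(** At [x = 0] with [mu = 0], this is the integral of [1 / y], hence infinite. *)
Definition mixture_density (x : R) : \bar R :=
  ((\int[leb]_(y in `[0%R, 1%R]) ((mu + y)^-1 * expR (- (x / (mu + y))))%:E)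
     * (\1_`[0%R, +oo[ x)%:E)%E.

Let k (x y : R) : R := (mu + y)^-1 * expR (- (x / (mu + y))) * \1_(`[0, +oo[%classic : set R) x.

Let k_ge0 x y : 0 <= y -> 0 <= k x y.
Proof. by move=> y0; rewrite !mulr_ge0 ?expR_ge0// invr_ge0 addr_ge0. Qed.

Let mk : measurable_fun setT (fun z : R * R => (k z.1 z.2)%:E).
Proof.
have m1 : measurable_fun setT (fun z : R * R => \1_(`[0, +oo[%classic : set R) z.1 : R).
  exact: (measurableT_comp (measurable_indic (measurable_itv _)) measurable_fst).
by apply/measurable_EFinP; rewrite /k; mfun.
Qed.

(** The indicator moves under the integral for Tonelli, and [y = 0] is dropped so that [mu + y] is
    positive. *)
Let densityE x : mixture_density x = (\int[leb]_(y in `]0%R, 1%R]) (k x y)%:E)%E.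
Proof.
rewrite integral_itv_obnd_cbnd; last by apply/measurable_EFinP/measurable_funTS; rewrite /k; mfun.
rewrite /mixture_density muleC -ge0_integralZl_EFin//.
- by apply: eq_integral => y _; rewrite -EFinM mulrC.
- move=> y /=; rewrite in_itv/= => /andP[y0 _].
  by rewrite lee_fin !mulr_ge0 ?expR_ge0// invr_ge0 addr_ge0.
- by apply/measurable_EFinP/measurable_funTS; mfun.
Qed.

Lemma mixture_density_ge0 x : (0 <= mixture_density x)%E.
Proof.
rewrite densityE; apply: integral_ge0 => y /=; rewrite in_itv/= => /andP[y0 _].
by rewrite lee_fin k_ge0// ltW.
Qed.

Lemma measurable_mixture_density : measurable_fun setT mixture_density.
Proof.
have mI : measurable (`]0, 1]%classic : set R) by exact: measurable_itv.
pose g (z : R * R) : \bar R := (k z.1 z.2 * \1_(`]0, 1]%classic : set R) z.2)%:E.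
have mg : measurable_fun setT g.
  have m1 : measurable_fun setT (fun z : R * R => \1_(`]0, 1]%classic : set R) z.2 : R).
    exact: (measurableT_comp (measurable_indic mI) measurable_snd).
  apply/measurable_EFinP; apply: measurable_funM => //.
  exact/measurable_EFinP.
have g0 z : (0 <= g z)%E.
  rewrite /g indicE lee_fin; case: (boolP (_ \in _)); last by rewrite mulr0.
  by rewrite mulr1 inE/= in_itv/= => /andP[z0 _]; exact/k_ge0/ltW.
have := measurable_fun_fubini_tonelli_F (m2 := leb) g mg g0.
apply: eq_measurable_fun => x _.
rewrite densityE /fubini_F [RHS]integral_mkcond; apply: eq_integral => y _.
rewrite /g patchE indicE/=.
by case: (y \in _); rewrite ?mulr1 ?mulr0.
Qed.

(** After the exchange, the exponential density of rate [1 / (mu + y)] is integrated from [max b 0]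
    on; the maximum comes from the indicator. *)
Let density_tail b : (\int[leb]_(x in `]b, +oo[) mixture_density x)%E
  = mixture_tail mu (Num.max b 0).
Proof.
under eq_integral do rewrite densityE.
rewrite fubini_tonelli_in//; last first.
  by move=> x y _ /=; rewrite in_itv/= => /andP[y0 _]; rewrite lee_fin k_ge0// ltW.
rewrite /mixture_tail -[RHS]integral_itv_obnd_cbnd; last first.
  by apply/measurable_EFinP/measurable_funTS; mfun.
apply: eq_integral => y /set_mem/=; rewrite in_itv/= => /andP[y0 _].
have v0 : 0 < mu + y by rewrite ltr_wpDl.
transitivity (\int[leb]_(x in `[(Num.max b 0)%R, +oo[)
    (((mu + y)^-1)%:E * (expR (- ((mu + y)^-1 * x)))%:E))%E.
  rewrite integral_itv_obnd_cbnd; last first.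
    by apply/measurable_EFinP/measurable_funTS; rewrite /k; mfun.
  rewrite integral_mkcond [RHS]integral_mkcond; apply: eq_integral => x _.
  rewrite !patchE !mem_setE !in_itv/= !andbT ge_max /k indicE mem_setE in_itv/= andbT.
  case: (leP b x) => //= bx; case: (leP 0 x) => //= x0; last by rewrite mulr0.
  by rewrite mulr1 EFinM [x / _]mulrC.
rewrite ge0_integralZl_EFin//.
- rewrite integral_expR_tail ?invr_gt0// -EFinM; congr EFin.
  by rewrite [_^-1 * Num.max _ _]mulrC; field; rewrite gt_eqF.
- by apply/measurable_EFinP/measurable_funTS; mfun.
- by rewrite invr_ge0 ltW.
Qed.

Context d (T : measurableType d) (P : probability T R) (X : T -> R).
Hypotheses (mX : measurable_fun setT X)
  (X_tail : forall x, 0 <= x -> P (X @^-1` `]x, +oo[) = mixture_tail mu x).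

Lemma mixture_has_density : has_density P X mixture_density.
Proof.
have mXi b : measurable (X @^-1` `]b, +oo[).
  by rewrite -[A in measurable A]setTI; exact: mX.
have tail b : P (X @^-1` `]b, +oo[) = mixture_tail mu (Num.max b 0).
  have [b0|b0] := leP 0 b; first exact: X_tail.
  apply/eqP; rewrite mixture_tail0 eq_le probability_le1//= -(mixture_tail0 mu).
  rewrite -X_tail//; apply: le_measure; rewrite ?inE//.
  by move=> w /=; rewrite !in_itv/= !andbT; exact: lt_trans.
split; [exact: measurable_mixture_density|exact: mixture_density_ge0|].
move=> A mA.
pose m1 : {measure set R -> \bar R} := pushforward P X.
pose m2 : {measure set R -> \bar R} := density_measure mixture_density.
pose m2' := m2 measurable_mixture_density mixture_density_ge0.
have m12 b : m1 mX `]b, +oo[%classic = m2' `]b, +oo[%classic.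
  by rewrite -[LHS]/(P (X @^-1` `]b, +oo[)) tail -density_tail.
have m1T : m1 mX setT = 1%E.
  by rewrite -[LHS]/(P (X @^-1` setT)) preimage_setT probability_setT.
have m2T : m2' setT = 1%E.
  (* Any negative left end gives the total mass, since the density vanishes on the negative
     half-line. *)
  transitivity (\int[leb]_(x in `](-1)%R, +oo[) mixture_density x)%E; last first.
    by rewrite density_tail max_r// mixture_tail0.
  rewrite -[LHS]/(\int[leb]_x mixture_density x)%E [RHS]integral_mkcond.
  apply: eq_integral => x _; rewrite patchE mem_setE in_itv/= andbT.
  case: ltP => // x1; rewrite /mixture_density indicE memNset ?mule0//=.
  by rewrite in_itv/= andbT; apply/negP; rewrite -ltNge (le_lt_trans x1).
by apply: (eq_measure_tails _ _ m12 mA); rewrite ?m1T ?m2T// ltry.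
Qed.

End mixture_density.

(** * The Wiener-Gamma representation *)

Section independent_product.
Context d (T : measurableType d) {R : realType} (P : probability T R).
Variables (I : finType) (X : I -> T -> R).
Hypotheses (mX : forall i, measurable_fun setT (X i)) (indepX : mutually_independent P X).

Let indep_indic (A : I -> set R) : (forall i, measurable (A i)) ->
  (\int[P]_w (\prod_i \1_(A i) (X i w))%:E = \prod_i \int[P]_w (\1_(A i) (X i w))%:E)%E.
Proof.
move=> mA.
under [RHS]eq_bigr => i _ do rewrite integral_EFin_indic//.
rewrite -indepX//.
have mB : measurable (\bigcap_(i in [set: I]) (X i @^-1` A i)).
  apply: fin_bigcap_measurable; first exact: finite_finset.
  by move=> i _; rewrite -[B in measurable B]setTI; exact: mX.
rewrite -[in RHS](setIT (\bigcap_(i in _) _)) -integral_indic//.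
apply: eq_integral => w _; congr EFin; rewrite indicE.
case: (boolP (w \in _)) => hw.
  apply: big1 => i _; rewrite indicE mem_set//.
  by move/set_mem : hw => /(_ i Logic.I).
have [i hi] : exists i, ~ A i (X i w).
  apply/existsNP => h; move/negP : hw; apply; apply/mem_set => i _; exact: h.
by rewrite (bigD1 i)//= indicE memNset// mul0r.
Qed.

Lemma independent_prod (F : I -> R -> R) :
  (forall i, measurable_fun setT (F i)) -> (forall i x, 0 <= F i x <= 1) ->
  (\int[P]_w (\prod_i F i (X i w))%:E = \prod_i \int[P]_w (F i (X i w))%:E)%E.
Proof.
(* The indicators are replaced by the F i one index at a time. *)
suff ind (s : seq I) (G : I -> R -> R) :
    (forall i, measurable_fun setT (G i)) -> (forall i x, 0 <= G i x <= 1) ->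
    (forall i, i \notin s -> exists2 A, measurable A & G i = \1_A) ->
    (\int[P]_w (\prod_i G i (X i w))%:E = \prod_i \int[P]_w (G i (X i w))%:E)%E.
  by move=> mF F01; apply: (ind (enum I)) => // i; rewrite mem_enum.
elim: s G => [|i s IH] G mG G01 GA.
  have /choice[A hA] : forall i, exists A, measurable A /\ G i = \1_A.
    by move=> i; have [A mA GiA] := GA i isT; exists A.
  have -> : G = (fun i => \1_(A i)) by apply/funext => i; case: (hA i).
  by apply: indep_indic => i; case: (hA i).
have mGX j : measurable_fun setT (fun w => G j (X j w)).
  exact: measurableT_comp (mG j) (mX j).
pose w x := \prod_(j | j != i) G j (X j x).
have mw : measurable_fun setT w.
  have -> : w = fun x => \prod_(j <- [seq j <- index_enum I | j != i]) G j (X j x).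
    by apply/funext => x; rewrite big_filter.
  by apply: measurable_prod => j _; exact: mGX.
have w0 x : 0 <= w x by apply: prodr_ge0 => j _; have /andP[] := G01 j (X j x).
have E01 j : exists2 c, 0 <= c & (\int[P]_w (G j (X j w))%:E = c%:E)%E.
  have G0 x : (0 <= (G j (X j x))%:E)%E by rewrite lee_fin; have /andP[] := G01 j (X j x).
  have : (\int[P]_w (G j (X j w))%:E < +oo)%E.
    apply: (@le_lt_trans _ _ (\int[P]_w 1%:E)%E).
      apply: ge0_le_integral => //; first exact/measurable_EFinP.
      by move=> x _; rewrite lee_fin; have /andP[] := G01 j (X j x).
    rewrite integral_cst// mul1e.
    by apply: le_lt_trans (probability_le1 P measurableT) _; exact: ltry.
  have : (0 <= \int[P]_w (G j (X j w))%:E)%E by exact: integral_ge0.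
  by case: (\int[P]_w _)%E => // r r0 _; exists r.
(* The bound by 1 on the factors makes the product of expectations a real number, which will be the
   constant weight. *)
have [c c0 Ec] : exists2 c, 0 <= c &
    (\prod_(j | j != i) \int[P]_w (G j (X j w))%:E = c%:E)%E.
  apply: (big_ind (fun e : \bar R => exists2 c, 0 <= c & e = c%:E)).
  - by exists 1.
  - by move=> _ _ [a a0 ->] [b b0 ->]; exists (a * b); rewrite ?mulr_ge0.
  - by move=> j _; exact: E01.
pose m2 : {measure set R -> \bar R} := pushforward P (X i).
have wv A : measurable A -> (\int[P]_x (w x * \1_A (X i x))%:E =
    \int[m2 (mX i)]_y (c * \1_A y)%:E)%E.
  (* With an indicator in place of the function of index [i], the induction hypothesis becomes the
     assumption of [weighted_integral] for the weights [w] and [c]. *)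
  move=> mA; pose G' j := if j == i then \1_A else G j.
  have mI : measurable_fun setT (\1_A : R -> R) by exact: measurable_indic.
  have := IH G'; rewrite /G'.
  have -> : (\int[P]_w0 (\prod_i0 (if i0 == i then \1_A else G i0) (X i0 w0))%:E
     = \int[P]_x (w x * \1_A (X i x))%:E)%E.
    apply: eq_integral => x _; rewrite (bigD1 i)//= eqxx mulrC; congr (_ * _)%:E.
    by apply: eq_bigr => j /negbTE ->.
  move=> ->.
  - rewrite (bigD1 i)//= eqxx; under eq_bigr => j ji do rewrite (negbTE ji).
    rewrite Ec ge0_integral_pushforward//=; last 2 first.
      by apply/measurable_EFinP; mfun.
      by move=> y _; rewrite lee_fin mulr_ge0.
    rewrite preimage_setT; under [RHS]eq_integral do rewrite EFinM.
    rewrite ge0_integralZl_EFin//; first by rewrite muleC.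
    exact: measurable_EFin_indic.
  - by move=> j; case: eqP.
  - by move=> j x; case: eqP => // _; rewrite indicE; case: (_ \in _); rewrite /= ?lexx ?ler01.
  - move=> j js; case: eqP => [_|/eqP ji]; first by exists A.
    by apply: GA; rewrite inE negb_or ji.
have mGi : measurable_fun setT (fun x => (G i x)%:E) by exact/measurable_EFinP.
have Gi0 x : (0 <= (G i x)%:E)%E by rewrite lee_fin; have /andP[] := G01 i x.
have key := weighted_integral (m2 := m2 (mX i)) (mX i) mw (measurable_cst c) w0
  (fun=> c0) wv mGi Gi0.
transitivity (\int[P]_x ((w x)%:E * (G i (X i x))%:E))%E.
  by apply: eq_integral => x _; rewrite (bigD1 i)//= mulrC.
rewrite key [RHS](bigD1 i)//= Ec muleC ge0_integral_pushforward//=; last 2 first.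
- by apply: emeasurable_funM => //; exact: measurable_cst.
- by move=> y _; rewrite mule_ge0.
rewrite preimage_setT ge0_integralZl_EFin//.
exact/measurable_EFinP.
Qed.

End independent_product.

(** * Riemann sums of Stieltjes integrals *)

Section riemann_stieltjes.
Context {R : realType}.
Variables (t : R).
Hypothesis t_gt0 : 0 < t.

Definition part_pt (n i : nat) : R := t * i%:R / n.+1%:R.

Definition riemann_sum (h F : R -> R) (n : nat) : R :=
  \sum_(i < n.+1) h (part_pt n i.+1) * (F (part_pt n i.+1) - F (part_pt n i)).

Lemma part_pt_le n i j : (i <= j)%N -> part_pt n i <= part_pt n j.
Proof. by move=> ij; rewrite ler_pM2r ?invr_gt0// ler_pM2l// ler_nat. Qed.

Lemma part_pt0 n : part_pt n 0 = 0. Proof. by rewrite /part_pt mulr0 mul0r. Qed.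

Lemma part_ptn n : part_pt n n.+1 = t.
Proof. by rewrite /part_pt mulfK// pnatr_eq0. Qed.

Lemma part_ptS n i : part_pt n i.+1 = part_pt n i + t / n.+1%:R.
Proof. by rewrite /part_pt -natr1 mulrDr mulr1 mulrDl. Qed.

Variable h : R -> R.

Definition step_fun n u : R :=
  \sum_(i < n.+1) h (part_pt n i.+1) * \1_(`]part_pt n i, part_pt n i.+1]%classic : set R) u.

(** [v] is the right end of the cell that contains [u]; being at most [t], it equals [t] when [u]
    does. *)
Lemma step_funE n u : 0 < u <= t ->
  exists2 v, u <= v <= Num.min t (u + t / n.+1%:R) & step_fun n u = h v.
Proof.
move=> /andP[u0 ut].
have exk : exists k, u <= part_pt n k by exists n.+1; rewrite part_ptn.
case: (ex_minnP exk) => k uk kmin.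
case: k => [|k] in uk kmin *; first by move: uk; rewrite part_pt0 leNgt u0.
have kn : (k < n.+1)%N by apply: kmin; rewrite part_ptn.
have ku : part_pt n k < u by rewrite ltNge; apply/negP => /kmin; rewrite ltnn.
exists (part_pt n k.+1).
  have pk : part_pt n k.+1 <= t by rewrite -[leRHS](part_ptn n) part_pt_le.
  by rewrite uk/= le_min pk/= part_ptS lerD2r ltW.
rewrite /step_fun (bigD1 (Ordinal kn))//= indicE mem_set/= ?in_itv/= ?ku//.
rewrite mulr1 big1 ?addr0// => j jk; rewrite indicE memNset ?mulr0//=.
rewrite in_itv/= => /andP[ju uj]; move/negP: jk; apply; apply/eqP/val_inj => /=.
apply/eqP; rewrite eqn_leq; apply/andP; split; rewrite leqNgt; apply/negP => jk.
  by have := lt_le_trans ju uk; rewrite ltNge part_pt_le.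
by have := lt_le_trans ku uj; rewrite ltNge part_pt_le.
Qed.

Variable M : R.
Hypotheses (h_ge0 : forall u, 0 <= h u)
  (h_le : forall u, h u <= M) (ch : forall u, 0 < u < t -> {for u, continuous h}).

Lemma step_fun_cvg u : 0 < u <= t -> step_fun n u @[n --> \oo] --> h u.
Proof.
move=> /andP[u0 ut].
have /choice[v hv] : forall n : nat, exists v,
    u <= v <= Num.min t (u + t / n.+1%:R) /\ step_fun n u = h v.
  by move=> n; have [v v1 v2] := @step_funE n u (introT andP (conj u0 ut)); exists v.
have -> : (fun n => step_fun n u) = h \o v by apply/funext => n; case: (hv n).
(* At [u = t] the evaluation point is constantly [t]. This covers the Wiener-Gamma kernel, which
   jumps at [t] because the cotangent takes its default value there. *)
move: ut; rewrite le_eqVlt => /predU1P[ut|ut].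
  have -> : h \o v = cst (h u); last exact: cvg_cst.
  apply/funext => n /=; have [/andP[v1]] := hv n.
  rewrite le_min => /andP[v2 _] _; congr h; apply/eqP; rewrite eq_le v1 andbT.
  by rewrite [leRHS]ut.
have cu : {for u, continuous h} by apply: ch; rewrite u0.
apply: (cvg_comp v h _ cu).
apply: (@squeeze_cvgr _ _ _ _ (fun=> u) (fun n => u + t / n.+1%:R)).
- near=> n; have [/andP[-> ]] := hv n.
  by rewrite le_min => /andP[_ ->].
- exact: cvg_cst.
- rewrite -[X in _ --> X]addr0 -[X in _ --> _ + X](mulr0 t).
  apply: cvgD; first exact: cvg_cst.
  by apply: cvgM; [exact: cvg_cst|exact: cvg_harmonic].
Unshelve. all: end_near. Qed.

Lemma stieltjes_measure_itv (G : cumulative R R) a b : a <= b ->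
  lebesgue_stieltjes_measure G `]a, b]%classic = (G b - G a)%:E.
Proof.
move=> ab; rewrite /lebesgue_stieltjes_measure /measure_extension/=.
rewrite measurable_mu_extE/=; last exact: is_ocitv.
by rewrite wlength_itv_bnd.
Qed.

(** The sum is the integral of a step function dominated by [M]. A general [G] serves twice: for the
    paths of the gamma process and, as the identity, for Lebesgue measure. *)
Lemma riemann_sum_cvg (G : cumulative R R) :
  ((riemann_sum h G n)%:E @[n --> \oo] -->
   \int[lebesgue_stieltjes_measure G]_(u in `]0%R, t]) (h u)%:E)%E.
Proof.
have mI a b : measurable (`]a, b]%classic : set R) by exact: measurable_itv.
have mi a b : measurable_fun setT (fun u : R => \1_(`]a, b]%classic : set R) u : R).
  exact: measurable_indic.
have mstep n : measurable_fun setT (step_fun n).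
  apply: measurable_sum => i; apply: measurable_funM; first exact: measurable_cst.
  exact: measurable_indic.
have -> : (fun n => (riemann_sum h G n)%:E) =
    (fun n => \int[lebesgue_stieltjes_measure G]_(u in `]0%R, t]) (step_fun n u)%:E)%E.
  apply/funext => n; rewrite /step_fun.
  under eq_integral do rewrite -sumEFin.
  rewrite ge0_integral_sum//; last 2 first.
  - move=> i; apply/measurable_EFinP/measurable_funM; first exact: measurable_cst.
    exact: (measurable_funTS (mi _ _)).
  - by move=> i u _; rewrite lee_fin mulr_ge0.
  rewrite /riemann_sum -sumEFin; apply: eq_bigr => i _.
  under eq_integral do rewrite EFinM.
  rewrite ge0_integralZl_EFin//; last first.
    by apply/measurable_EFinP; exact: (measurable_funTS (mi _ _)).
  rewrite integral_indic// setIidl; last first.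
    apply: subset_itv; rewrite bnd_simp.
      by rewrite -(part_pt0 n) part_pt_le.
    by rewrite -[leRHS](part_ptn n) part_pt_le.
  by rewrite EFinM; congr (_ * _)%E; apply/esym; apply: stieltjes_measure_itv; exact: part_pt_le.
apply: (@dominated_cvg_real _ _ _ (lebesgue_stieltjes_measure G) `]0, t]%classic
  (mI 0 t) step_fun h (fun=> M)).
- move=> n; exact: measurable_funTS (mstep n).
- by move=> u /=; rewrite in_itv; exact: step_fun_cvg.
- have GT : (lebesgue_stieltjes_measure G `]0%R, t]%classic < +oo)%E.
    by have -> := stieltjes_measure_itv G (ltW t_gt0); exact: ltry.
  apply: (@measurable_bounded_integrable _ (measurableTypeR R) R
    (lebesgue_stieltjes_measure G) (fun=> M) _ (mI 0 t) GT); first exact: measurable_cst.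
  exists `|M|; split; first exact: num_real.
  by move=> x Mx y _; exact: ltW.
- move=> n u /=; rewrite in_itv/= => ut; have [v _ ->] := step_funE n ut.
  by rewrite ger0_norm.
Qed.

End riemann_stieltjes.

(** * The cotangent of a uniform variable *)

Section cotangent_substitution.
Context {R : realType}.
Local Notation leb := (@lebesgue_measure R).
Variable t : R.
Hypothesis t_gt0 : 0 < t.

Definition ncot (u : R) : R := - cot (pi * u / t).

(** [t] times the Cauchy distribution function, inverse to [ncot] on []0, t[]. The substitution
    [u = F x] has Jacobian [t * cauchy_pdf x]. *)
Let F (x : R) : R := t / pi * (atan x + pi / 2).

Lemma ncotE (u : R) : ncot u = tan (pi * u / t - pi / 2).
Proof. by rewrite /ncot /cot /tan sinBpihalf cosBpihalf mulNr. Qed.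

Let arg_bounds (u : R) : 0 < u < t -> - (pi / 2) < pi * u / t - pi / 2 < pi / 2.
Proof.
move=> /andP[u0 ut]; have p0 := pi_gt0 R.
have h1 : 0 < pi * u / t by rewrite divr_gt0 ?mulr_gt0.
have h2 : pi * u / t < pi by rewrite ltr_pdivrMr// ltr_pM2l.
by move: h1 h2 p0; set a := _ / t; set p := pi => h1 h2 p0; apply/andP; split; lra.
Qed.

Let ncotK (u : R) : 0 < u < t -> F (ncot u) = u.
Proof.
move=> hu; rewrite ncotE /F tanK ?in_itv/= ?arg_bounds// subrK.
by move: (pi_gt0 R); move: pi => p p0; field; rewrite !gt_eqF.
Qed.

Let FK (x : R) : ncot (F x) = x.
Proof.
rewrite ncotE (_ : _ - _ = atan x) ?atanK// /F.
by move: (pi_gt0 R); move: (atan x) => a; move: pi => p p0; field; rewrite !gt_eqF.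
Qed.

Let F_bounds (x : R) : 0 < F x < t.
Proof.
have p0 := pi_gt0 R; have h1 := atan_gtNpi2 x; have h2 := atan_ltpi2 x.
rewrite mulr_gt0 ?divr_gt0//=; last by rewrite -ltrBlDr sub0r.
rewrite /F mulrAC ltr_pdivrMr// ltr_pM2l//.
by move: h2; set a := atan x; set p := pi => h2; lra.
Qed.

Lemma continuous_ncot (u : R) : 0 < u < t -> {for u, continuous ncot}.
Proof.
move=> hu; have h := arg_bounds hu.
have -> : ncot = tan \o (fun u => pi * u / t - pi / 2) by apply/funext => v; exact: ncotE.
apply: continuous_comp.
  apply: cvgB; last exact: cvg_cst.
  by apply: cvgM; [apply: cvgM; [exact: cvg_cst|exact: cvg_id]|exact: cvg_cst].
by apply: continuous_tan; rewrite gt_eqF// cos_gt0_pihalf.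
Qed.

Lemma measurable_ncot : measurable_fun setT ncot.
Proof.
have ms : measurable_fun setT (fun u : R => sin (pi * u / t)).
  by apply: (measurableT_comp (f := @sin R)); [apply: continuous_measurable_fun; exact: continuous_sin|mfun].
have mc : measurable_fun setT (fun u : R => cos (pi * u / t)).
  by apply: (measurableT_comp (f := @cos R)); [apply: continuous_measurable_fun; exact: continuous_cos|mfun].
by rewrite /ncot /cot; mfun.
Qed.

Let dF (x : R) : is_derive x (1 : R) F (t * cauchy_pdf x).
Proof.
rewrite /F; derive_rule.
have : 0 < 1 + x ^+ 2 by rewrite ltr_wpDr ?sqr_ge0.
rewrite /cauchy_pdf; move: (pi_gt0 R); move: pi => p p0 x0.
by field; rewrite !gt_eqF.
Qed.

Let F'E : F^`()%classic = (fun x => t * cauchy_pdf x).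
Proof. by apply/funext => x; rewrite derive1E; have := dF x => h; exact: derive_val. Qed.

Let F_incr : {homo F : x y / x < y}.
Proof.
by move=> x y xy; rewrite ltr_pM2l ?divr_gt0 ?pi_gt0// ltrD2r; exact: lt_atan.
Qed.

Variable phi : R -> R.
Hypotheses (cphi : continuous phi) (phi0 : forall x, 0 <= phi x).

Let subst_n (n : nat) :
  (\int[leb]_(u in `[F (- n%:R), F n%:R]) (phi (ncot u))%:E =
   \int[leb]_(x in `[(- n%:R)%R, n%:R]) (t * cauchy_pdf x * phi x)%:E)%E.
Proof.
have cF' : continuous F^`()%classic.
  by rewrite F'E => x; apply: cvgM; [exact: cvg_cst|exact: continuous_cauchy_pdf].
rewrite (@integration_by_substitution_increasing R F (phi \o ncot)).
- apply: eq_integral => x _; rewrite F'E; congr EFin.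
  by rewrite -[LHS]/(phi (ncot (F x)) * (t * cauchy_pdf x)) FK mulrC.
- by rewrite (le_trans (y := 0))// oppr_le0.
- by move=> x y _ _; exact: F_incr.
- by move=> x _; exact: cF'.
- by apply/cvg_ex; exists (F^`()%classic (- n%:R)); apply/cvg_at_right_filter/cF'.
- by apply/cvg_ex; exists (F^`()%classic n%:R); apply/cvg_at_left_filter/cF'.
- split => [x _||].
  + by have := dF x => h; exact: ex_derive.
  + exact/cvg_at_right_filter/(is_derive_continuous (dF _)).
  + exact/cvg_at_left_filter/(is_derive_continuous (dF _)).
- apply: continuous_in_subspaceT => u /set_mem /=; rewrite in_itv/= => /andP[u0 u1].
  have /andP[f0 _] := F_bounds (- n%:R); have /andP[_ f1] := F_bounds n%:R.
  apply: (@continuous_comp _ _ _ ncot phi); last exact: cphi.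
  by apply: continuous_ncot; rewrite (lt_le_trans f0 u0) (le_lt_trans u1 f1).
Qed.

Let mphi : measurable_fun setT phi.
Proof. exact: continuous_measurable_fun. Qed.

Let mcauchy := @measurable_cauchy_pdf R.

(** The segments [[F (- n), F n]] exhaust []0, t[] while avoiding the singularities of the cotangent
    at its ends. *)
Lemma integral_ncot :
  (\int[leb]_(u in `]0%R, t]) (phi (ncot u))%:E =
   t%:E * \int[leb]_x (cauchy_pdf x * phi x)%:E)%E.
Proof.
have mpn : measurable_fun setT (fun u => (phi (ncot u))%:E).
  by apply/measurable_EFinP; exact: measurableT_comp measurable_ncot.
have nn n : - n%:R <= n%:R :> R by rewrite (le_trans (y := 0))// oppr_le0.
have leN m n : (m <= n)%N -> - n%:R <= - m%:R :> R by move=> mn; rewrite lerN2 ler_nat.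
have Fle x y : x <= y -> F x <= F y.
  by rewrite le_eqVlt => /predU1P[->//|/F_incr/ltW].
rewrite -integral_itv_bndo_bndc; last exact: measurable_funTS.
have h1 : (\int[leb]_(u in `[F (- n%:R), F n%:R]) (phi (ncot u))%:E @[n --> \oo] -->
    \int[leb]_(u in `]0%R, t[) (phi (ncot u))%:E)%E.
  have -> : `]0%R, t[%classic = \bigcup_n `[F (- n%:R), F n%:R]%classic.
    apply/seteqP; split => u /=.
      rewrite in_itv/= => hu; pose n := (Num.truncn `|ncot u|).+1.
      have : `|ncot u| <= n%:R by rewrite ltW// truncnS_gt.
      rewrite ler_norml => /andP[n0 n1]; exists n => //=.
      by rewrite in_itv/= -(ncotK hu) !Fle.
    move=> [n _ /=]; rewrite !in_itv/= => /andP[u0 u1].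
    have /andP[f0 _] := F_bounds (- n%:R); have /andP[_ f1] := F_bounds n%:R.
    by rewrite (lt_le_trans f0 u0) (le_lt_trans u1 f1).
  apply: ge0_nondecreasing_set_cvg_integral => //.
  - move=> m n mn; apply/subsetPset/subset_itv; rewrite bnd_simp Fle ?leN//.
    by rewrite ler_nat.
  - by move=> n; exact: measurable_funTS.
  - by move=> n u _; rewrite lee_fin.
have h2 : (\int[leb]_(x in `[(- n%:R)%R, n%:R]) (t * cauchy_pdf x * phi x)%:E @[n --> \oo] -->
    \int[leb]_x (t * cauchy_pdf x * phi x)%:E)%E.
  have -> : [set: measurableTypeR R] = \bigcup_n `[- n%:R, n%:R]%classic.
    apply/seteqP; split => // u _; pose n := (Num.truncn `|u|).+1.
    have : `|u| <= n%:R by rewrite ltW// truncnS_gt.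
    by rewrite ler_norml => h; exists n => //=; rewrite in_itv.
  apply: ge0_nondecreasing_set_cvg_integral => //.
  - move=> m n mn; apply/subsetPset/subset_itv; rewrite bnd_simp ?leN//.
    by rewrite ler_nat.
  - by move=> n; apply/measurable_EFinP/measurable_funTS; mfun.
  - move=> n u _; rewrite lee_fin !mulr_ge0// ?ltW//; exact: cauchy_pdf_gt0.
rewrite (eq_cvg _ _ subst_n) in h1.
rewrite (cvg_unique _ h1 h2)//.
under eq_integral do rewrite -mulrA EFinM.
rewrite ge0_integralZl_EFin// ?(ltW t_gt0)//.
- by move=> x _; rewrite lee_fin mulr_ge0// ltW// cauchy_pdf_gt0.
- by apply/measurable_EFinP; mfun.
Qed.

End cotangent_substitution.

Section gamma_riemann_sums.
Context {R : realType} d (T : measurableType d) (P : probability T R).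
Variable gam : R -> {RV P >-> R}.
Hypothesis gam_process : gamma_process gam.

Let gam_sub : is_subordinator gam := gam_process.1.

Lemma gamma_laplace (c s : R) : 0 <= c -> 0 <= s ->
  (\int[P]_w (expR (- (c * gam s w)))%:E = (expR (- (s * ln (1 + c))))%:E)%E.
Proof.
move=> c0 s0; rewrite -expectationE gam_process.2//.
under eq_integral => x _.
  rewrite -EFinM (_ : expR (- x) / x = x^-1 * expR (- (x * 1))); last by rewrite mulr1 mulrC.
  over.
by rewrite frullani// divr1 -EFinM.
Qed.

Variables (t : R) (h : R -> R).
Hypotheses (t_gt0 : 0 < t) (h_ge0 : forall u, 0 <= h u).

Let pt_ge0 n i : 0 <= part_pt t n i.
Proof. by rewrite /part_pt divr_ge0// mulr_ge0// ltW. Qed.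

Let mgam s : measurable_fun setT (gam s). Proof. exact: measurable_funPT. Qed.

Let incr n i w := gam (part_pt t n i.+1) w - gam (part_pt t n i) w.

Let mincr n i : measurable_fun setT (incr n i).
Proof. by apply: measurable_funB. Qed.

Let incr_ge0 : {ae P, forall w, forall n i, 0 <= incr n i w}.
Proof.
apply: filterS (subordinator_nondecreasing gam_sub) => w hw n i.
by rewrite subr_ge0 hw// part_pt_le.
Qed.


Lemma measurable_riemann_sum n :
  measurable_fun setT (fun w => riemann_sum t h (gam ^~ w) n).
Proof.
apply: measurable_sum => i; apply: measurable_funM; first exact: measurable_cst.
exact: mincr.
Qed.

(** Independence of the increments gives a product, whose factors are [1 + l h] to the power
    [- t / (n + 1)]; these cell lengths are the increments of [idfun]. *)
Lemma riemann_sum_laplace (l : R) n : 0 <= l ->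
  (\int[P]_w (expR (- (l * riemann_sum t h (gam ^~ w) n)))%:E =
   (expR (- riemann_sum t (fun u => ln (1 + l * h u)) idfun n))%:E)%E.
Proof.
move=> l0; pose c i := l * h (part_pt t n i.+1).
have c0 i : 0 <= c i by rewrite mulr_ge0.
have mM : measurable_fun setT (fun x : R => Num.max x 0) by exact: measurable_maxr.
(* [independent_prod] asks for factors in [[0, 1]] everywhere, while the increments are nonnegative
   almost surely only: hence the positive part. *)
pose F (i : 'I_n.+1) (x : R) := expR (- (c i * Num.max x 0)).
have mF i : measurable_fun setT (F i) by rewrite /F; mfun.
have F01 i x : 0 <= F i x <= 1.
  rewrite expR_ge0/= -expR0 ler_expR oppr_le0 mulr_ge0//.
  by rewrite le_max lexx orbT.
have indep : mutually_independent P (fun i : 'I_n.+1 => incr n i).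
  apply: (subordinator_independent gam_sub (t := part_pt t n)) => // i.
  exact: part_pt_le.
have prod := independent_prod (fun i : 'I_n.+1 => mincr n i) indep mF F01.
transitivity (\int[P]_w (\prod_(i < n.+1) F i (incr n i w))%:E)%E.
  apply: ae_eq_integral => //.
  - by apply/measurable_EFinP; have := measurable_riemann_sum n => mS; mfun.
  - apply/measurable_EFinP; apply: measurable_prod => i _.
    exact: measurableT_comp (mF i) (mincr n i).
  - apply: filterS incr_ge0 => w hw _; congr EFin.
    rewrite /riemann_sum mulr_sumr -sumrN expR_sum; apply: eq_bigr => i _.
    by rewrite /F /c max_l// mulrA.
rewrite prod /riemann_sum -sumrN expR_sum -prodEFin; apply: eq_bigr => i _.
have mE : measurable_fun setT (fun x : R => (expR (- (c i * x)))%:E).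
  by apply/measurable_EFinP; mfun.
transitivity (\int[P]_w (expR (- (c i * incr n i w)))%:E)%E.
  apply: ae_eq_integral => //.
  - by apply/measurable_EFinP; exact: measurableT_comp (mF i) (mincr n i).
  - exact: measurableT_comp mE (mincr n i).
  - by apply: filterS incr_ge0 => w hw _; rewrite /F max_l.
have tn : 0 <= t / n.+1%:R by rewrite divr_ge0// ltW.
have law : eq_law P P (incr n i) (gam (t / n.+1%:R)).
  by have := subordinator_stationary gam_sub (pt_ge0 n i) tn; rewrite -part_ptS.
rewrite (eq_law_integral (mincr n i) (mgam _) law mE)//.
rewrite gamma_laplace//; congr (expR (- _))%:E.
by rewrite /c [in RHS]/= !part_ptS; set b := ln _; ring.
Qed.

End gamma_riemann_sums.

Section cumulative_extension.
Context {R : realType} (f : R -> R).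
Hypotheses (f_nd : forall s t, 0 <= s -> s <= t -> f s <= f t)
  (f_rc : forall t, 0 <= t -> f u @[u --> t^'+] --> f t).

Let g (u : R) : R := f (Num.max u 0).

Let g_nd : nondecreasing g.
Proof.
move=> x y xy; apply: f_nd; first by rewrite le_max lexx orbT.
by rewrite ge_max !le_max xy lexx orbT.
Qed.

Let g_rc : right_continuous g.
Proof.
move=> x; have [x0|x0] := leP 0 x.
  rewrite /g (max_l x0); apply: cvg_trans (f_rc x0); apply: near_eq_cvg.
  near=> u; rewrite max_l//; apply: (le_trans x0); near: u.
  exact: nbhs_right_ge.
rewrite /g (max_r (ltW x0)); apply: cvg_near_cst.
by near=> u; rewrite max_r//; near: u; exact: nbhs_right_le.
Unshelve. all: end_near. Qed.

Lemma cumulative_extension :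
  exists G : cumulative R R, forall u, 0 <= u -> G u = f u.
Proof.
exists (HB.pack_for (cumulative R R) g (isCumulative.Build R _ R g g_nd g_rc)) => u u0 /=.
by rewrite /g max_l.
Qed.

End cumulative_extension.

Section wiener_gamma.
Context {R : realType}.
Local Notation leb := (@lebesgue_measure R).
Variables (mu t : R).
Hypotheses (mu_ge0 : 0 <= mu) (t_gt0 : 0 < t).

Local Notation h := (wiener_gamma_kernel mu t).

(** The kernel applies to [ncot] the map that makes [mu + G0] out of a Cauchy variable. *)
Let kernelE u : h u = mu + cauchy_to_G0 (ncot t u).
Proof.
rewrite /wiener_gamma_kernel /cauchy_to_G0 /ncot mulrN.
by have := expR_gt0 (- (pi * cot (pi * u / t))); set e := expR _ => e0; field; rewrite gt_eqF// addr_gt0.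
Qed.

Lemma wiener_gamma_kernel_bounds u : 0 <= h u <= mu + 1.
Proof.
rewrite kernelE addr_ge0 ?(ltW (cauchy_to_G0_gt0 _))//= lerD2l.
by rewrite ler_pdivrMr ?addr_gt0 ?expR_gt0// mul1r lerDl expR_ge0.
Qed.

Lemma continuous_cauchy_to_G0 : continuous (@cauchy_to_G0 R).
Proof.
move=> y; apply: cvgM; first exact: cvg_cst.
apply: cvgV; first by rewrite gt_eqF// addr_gt0// expR_gt0.
apply: cvgD; first exact: cvg_cst.
apply: (@continuous_comp _ _ _ (fun y => pi * y) expR); last exact: continuous_expR.
by apply: cvgM; [exact: cvg_cst|exact: cvg_id].
Qed.

Let kernel_fun : h = (fun y => mu + cauchy_to_G0 y) \o ncot t.
Proof. by apply/funext => u; rewrite kernelE. Qed.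

Let mh : measurable_fun setT h.
Proof.
rewrite kernel_fun; apply: (measurableT_comp (f := fun y => mu + cauchy_to_G0 y)).
  by apply: measurable_funD; [exact: measurable_cst|exact: measurable_cauchy_to_G0].
exact: measurable_ncot.
Qed.

Let ch u : 0 < u < t -> {for u, continuous h}.
Proof.
move=> hu; rewrite kernel_fun; apply: continuous_comp; first exact: continuous_ncot.
by apply: cvgD; [exact: cvg_cst|exact: continuous_cauchy_to_G0].
Qed.

Let h0 u : 0 <= h u. Proof. by have /andP[] := wiener_gamma_kernel_bounds u. Qed.
Let h1 u : h u <= mu + 1. Proof. by have /andP[] := wiener_gamma_kernel_bounds u. Qed.

Let q (l : R) : R := ln (l / ln ((1 + l * (1 + mu)) / (1 + l * mu))).

Let riemann_log_cvg (l : R) : 0 < l ->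
  riemann_sum t (fun u => ln (1 + l * h u)) idfun n @[n --> \oo] --> t * q l.
Proof.
move=> l0.
have a0 u : 1 <= 1 + l * h u by rewrite lerDl mulr_ge0// ltW.
have phi0 x : 0 <= ln (1 + l * (mu + cauchy_to_G0 x)).
  by rewrite ln_ge0// lerDl mulr_ge0 ?addr_ge0 ?(ltW l0) ?(ltW (cauchy_to_G0_gt0 _)).
have cphi : continuous (fun x => ln (1 + l * (mu + cauchy_to_G0 x))).
  move=> x; apply: (@continuous_comp _ _ _ (fun x => 1 + l * (mu + cauchy_to_G0 x)) (@ln R)).
    apply: cvgD; first exact: cvg_cst.
    apply: cvgM; first exact: cvg_cst.
    by apply: cvgD; [exact: cvg_cst|exact: continuous_cauchy_to_G0].
  apply: continuous_ln; rewrite ltr_wpDr// mulr_ge0 ?(ltW l0)// addr_ge0//.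
  exact/ltW/cauchy_to_G0_gt0.
have lim : (\int[leb]_(u in `]0%R, t]) (ln (1 + l * h u))%:E = (t * q l)%:E)%E.
  under eq_integral do rewrite kernelE.
  rewrite (integral_ncot t_gt0 cphi phi0) integral_cauchy_log//.
have f0 u : 0 <= ln (1 + l * h u) by rewrite ln_ge0.
have fM u : ln (1 + l * h u) <= ln (1 + l * (mu + 1)).
  have hu := h1 u; rewrite ler_ln ?posrE; first by rewrite lerD2l ler_pM2l.
    exact: lt_le_trans (a0 u).
  by rewrite ltr_wpDr// mulr_ge0 ?(ltW l0)// addr_ge0.
have cu u : 0 < u < t -> {for u, continuous (fun u => ln (1 + l * h u))}.
  move=> hu; apply: (@continuous_comp _ _ _ (fun u => 1 + l * h u) (@ln R)).
    apply: cvgD; first exact: cvg_cst.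
    by apply: cvgM; [exact: cvg_cst|exact: ch].
  by apply: continuous_ln; exact: lt_le_trans (a0 u).
(* The Stieltjes measure of the identity is Lebesgue measure. *)
have := riemann_sum_cvg t_gt0 f0 fM cu (G := idfun).
by rewrite lim => /fine_cvg.
Qed.

Context d (T : measurableType d) (P : probability T R) (X : T -> R).
Hypotheses (mX : measurable_fun setT X) (X0 : {ae P, forall w, 0 <= X w}).
Hypothesis X_laplace : forall l, 0 < l ->
  (\int[P]_w (expR (- (l * X w)))%:E = (expR (- (t * q l)))%:E)%E.
Context dg (Tg : measurableType dg) (Pg : probability Tg R) (gam : R -> {RV Pg >-> R}).
Hypothesis gam_process : gamma_process gam.

Let S n w : R := riemann_sum t h (gam ^~ w) n.

Let mS n : measurable_fun setT (S n).
Proof. exact: measurable_riemann_sum. Qed.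

(** The Stieltjes integral is obtained path by path outside a null set. The upper limit of the
    Riemann sums is measurable on the whole space and agrees with it there. *)
Let Y w : \bar R := limn_esup (fun n => (S n w)%:E).

Let mY : measurable_fun setT Y.
Proof. by apply: measurable_fun_limn_esup => n; apply/measurable_EFinP. Qed.

Let Y_spec : {ae Pg, forall w, exists y : R, [/\ Y w = y%:E,
  S n w @[n --> \oo] --> y, (forall n, 0 <= S n w) &
  is_stieltjes_integral (gam ^~ w) h t (Y w)]}.
Proof.
have nd := subordinator_nondecreasing gam_process.1.
have rc := subordinator_right_continuous gam_process.1.
apply: filterS2 nd rc => w ndw rcw.
have [G hG] := cumulative_extension ndw rcw.
have pt0 n i : 0 <= part_pt t n i by rewrite divr_ge0// mulr_ge0// ltW.
have SG n : S n w = riemann_sum t h G n.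
  by apply: eq_bigr => i _; rewrite !hG.
have S0 n : 0 <= S n w.
  apply: sumr_ge0 => i _; rewrite mulr_ge0// subr_ge0 ndw//.
  exact: part_pt_le.
have cv := riemann_sum_cvg t_gt0 h0 h1 ch (G := G).
have SE : (fun n => (S n w)%:E) = (fun n => (riemann_sum t h G n)%:E).
  by apply/funext => n; rewrite SG.
have YE : (Y w = \int[lebesgue_stieltjes_measure G]_(u in `]0%R, t]) (h u)%:E)%E.
  by rewrite /Y SE; case: (cvg_limn_einf_sup cv).
have Y0 : (0 <= Y w)%E by rewrite YE; apply: integral_ge0 => u _; rewrite lee_fin.
have Yy : (Y w < +oo)%E.
  rewrite YE; apply: (@le_lt_trans _ _
    (\int[lebesgue_stieltjes_measure G]_(u in `]0%R, t]) (mu + 1)%:E)%E).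
    apply: ge0_le_integral => //.
    - by move=> u _; rewrite lee_fin.
    - by apply/measurable_EFinP; exact: (measurable_funTS mh).
    - by move=> u _; rewrite lee_fin.
  by rewrite integral_cst//= (stieltjes_measure_itv G (ltW t_gt0)) -EFinM ltry.
have Yfin : Y w \is a fin_num by rewrite ge0_fin_numE.
exists (fine (Y w)); split => //; first by rewrite fineK.
  move: cv; rewrite -SE -YE -(fineK Yfin); exact: fine_cvg.
by exists G.
Qed.

Let y w : R := fine (Y w).

Let my : measurable_fun setT y.
Proof. exact: (measurableT_comp (fine_measurable measurableT) mY). Qed.

Let y_laplace (l : R) : 0 < l ->
  (\int[Pg]_w (expR (- (l * y w)))%:E = (expR (- (t * q l)))%:E)%E.
Proof.
move=> l0.
have mE (Z : Tg -> R) : measurable_fun setT Z ->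
    measurable_fun setT (fun w => (expR (- (l * Z w)))%:E).
  by move=> mZ; apply/measurable_EFinP; mfun.
have [_ _ c1] : [/\ Pg.-integrable setT (fun w => (expR (- (l * y w)))%:E),
    ([sequence \int[Pg]_w `|(expR (- (l * S n w)))%:E - (expR (- (l * y w)))%:E|]_n @ \oo --> 0)%E &
    ([sequence \int[Pg]_w (expR (- (l * S n w)))%:E]_n @ \oo --> \int[Pg]_w (expR (- (l * y w)))%:E)%E].
  apply: (@dominated_convergence _ _ _ Pg setT measurableT
    (fun n w => (expR (- (l * S n w)))%:E) _ (fun=> 1%:E)) => //.
  - by move=> n; exact: mE.
  - exact: mE.
  - apply: filterS Y_spec => w [z [Yz Sz _ _]] _.
    have c : - (l * S n w) @[n --> \oo] --> - (l * y w).
      by rewrite /y Yz/=; apply: cvgN; apply: cvgM; [exact: cvg_cst|exact: Sz].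
    apply: cvg_EFin; first exact: nearW.
    by apply: (cvg_comp _ expR c); exact: continuous_expR.
  - by apply: (@bounded_integrable _ _ _ Pg (fun=> 1) 1) => // w; rewrite normr1.
  - apply: filterS Y_spec => w [z [_ _ S0 _]] n _.
    rewrite /= lee_fin ger0_norm ?expR_ge0// -expR0 ler_expR oppr_le0.
    by rewrite mulr_ge0// ltW.
have c2 : ([sequence \int[Pg]_w (expR (- (l * S n w)))%:E]_n @ \oo --> (expR (- (t * q l)))%:E)%E.
  have -> : ([sequence \int[Pg]_w (expR (- (l * S n w)))%:E]_n)%E =
     (fun n => (expR (- riemann_sum t (fun u => ln (1 + l * h u)) idfun n))%:E).
    by apply/funext => n; rewrite /= (riemann_sum_laplace gam_process t_gt0 h0)// ltW.
  have c : - riemann_sum t (fun u => ln (1 + l * h u)) idfun n @[n --> \oo] --> - (t * q l).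
    by apply: cvgN; exact: riemann_log_cvg.
  apply: cvg_EFin; first exact: nearW.
  by apply: (cvg_comp _ expR c); exact: continuous_expR.
exact: cvg_unique c1 c2.
Qed.

Lemma wiener_gamma_law : exists Y : {RV Pg >-> \bar R},
  {ae Pg, forall w, is_stieltjes_integral (gam ^~ w) h t (Y w)} /\
  eq_law P Pg (fun w => (X w)%:E) Y.
Proof.
exists (HB.pack_for {RV Pg >-> \bar R} Y (isMeasurableFun.Build _ _ _ _ Y mY)); split.
  by apply: filterS Y_spec => w [z []].
have law : eq_law P Pg X y.
  apply: laplace_unique_ae => //.
    apply: filterS Y_spec => w [z [Yz Sz S0 _]]; rewrite /y Yz/=.
    have <- : lim (S n w @[n --> \oo]) = z by exact: cvg_lim.
    by apply: limr_ge; [apply/cvg_ex; exists z|exact: nearW].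
  by move=> l l0; rewrite X_laplace// y_laplace.
apply: (eq_law_trans (eq_law_comp (@EFin_measurable R setT) law)).
apply: eq_law_ae => //.
  exact: (measurableT_comp (@EFin_measurable R setT) my).
by apply: filterS Y_spec => w [z [Yz _ _ _]]; rewrite /= /y Yz.
Qed.

End wiener_gamma.

(** * Subordinators at time 0, and the theorem *)

Section subordinator_facts.
Context {R : realType} d (T : measurableType d) (P : probability T R).
Variables (X : R -> {RV P >-> R}).
Hypothesis X_sub : is_subordinator X.

Lemma subordinator_ge0 t : 0 <= t -> {ae P, forall w, 0 <= X t w}.
Proof.
move=> t0; apply: filterS2 (subordinator0 X_sub) (subordinator_nondecreasing X_sub).
by move=> w X0 nd; rewrite -[leLHS]X0 nd.
Qed.

Lemma subordinator_stieltjes0 (h : R -> R) :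
  {ae P, forall w, is_stieltjes_integral (X ^~ w) h 0 0%E}.
Proof.
apply: filterS2 (subordinator_nondecreasing X_sub) (subordinator_right_continuous X_sub).
move=> w nd rc; have [G hG] := cumulative_extension nd rc.
by exists G => //; rewrite set_itvoc0 integral_set0.
Qed.

Lemma subordinator0_law dg (Tg : measurableType dg) (Pg : probability Tg R) :
  eq_law P Pg (fun w => (X 0 w)%:E) (cst 0%E).
Proof.
have mX : measurable_fun setT (fun w => (X 0 w)%:E).
  by apply/measurable_EFinP; exact: measurable_funPT.
apply: (@eq_law_trans _ _ _ _ _ _ P _ _ _ _ _ _ (cst 0%E)).
  apply: eq_law_ae => //.
  by apply: filterS (subordinator0 X_sub) => w ->.
move=> A mA; rewrite /pushforward !preimage_cst.
by case: (_ \in A); rewrite ?measure0// !probability_setT.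
Qed.

End subordinator_facts.

Theorem theorem3 (R : realType) (mu : R) (mu_ge0 : 0 <= mu)
  (* the variables C and G0 *)
  (dC : measure_display) (TC : measurableType dC) (PC : probability TC R)
  (C : {RV PC >-> R}) (C_cauchy : standard_cauchy PC C)
  (dG : measure_display) (TG : measurableType dG) (PG : probability TG R)
  (G0 : {RV PG >-> R})
  (G0_law : eq_law PG PC G0 (fun w => 1 / (1 + expR (pi * C w))))
  (* the subordinator Gamma_t (1 / (mu + G0)) *)
  (d : measure_display) (T : measurableType d) (P : probability T R)
  (Gam : R -> {RV P >-> R})
  (Gam_sub : driftless_subordinator
     (fun x : R => ((x^-1)%:E * 'E_PG[fun w => expR (- (x / (mu + G0 w)))%R])%E)
     Gam) :
  (* 1. Laplace transform *)
  (forall lambda t : R, 0 < lambda -> 0 <= t ->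
     ('E_P[fun w => expR (- (lambda * Gam t w))%R])%E =
     ((lambda^-1 * ln ((1 + lambda * (1 + mu)) / (1 + lambda * mu))) `^ t)%:E)
  /\
  (* 2. laws of Gamma_1 and D_1, and density of Gamma_1 *)
  (forall (dE : measure_display) (TE : measurableType dE)
     (PE : probability TE R) (e U : {RV PE >-> R}),
     standard_exponential PE e -> uniform01 PE U -> independent PE e U ->
     eq_law P PE (Gam 1) (fun w => e w * (U w + mu)) /\
     (mu = 0 -> eq_law P PE (Gam 1) (fun w => e w * U w)))
  /\
  (forall (dD : measure_display) (TD : measurableType dD)
     (PD : probability TD R) (D : {RV PD >-> R})
     (dU : measure_display) (TU : measurableType dU)
     (PU : probability TU R) (U : {RV PU >-> R}),
     is_D1 P PD (Gam 1) D -> uniform01 PU U ->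
     eq_law PD PU D (fun w => U w + mu) /\
     (mu = 0 -> eq_law PD PU D U))
  /\
  has_density P (Gam 1) (fun x : R =>
    ((\int[lebesgue_measure]_(y in `[0%R, 1%R])
        ((mu + y)^-1 * expR (- (x / (mu + y))))%:E)
     * (\1_`[0%R, +oo[ x)%:E)%E)
  /\
  (* 3. Wiener-Gamma representation *)
  (forall (dg : measure_display) (Tg : measurableType dg)
     (Pg : probability Tg R) (gam : R -> {RV Pg >-> R}),
     gamma_process gam ->
     forall t : R, 0 <= t ->
     exists Y : {RV Pg >-> \bar R},
       {ae Pg, forall w, is_stieltjes_integral (gam ^~ w)
                           (wiener_gamma_kernel mu t) t (Y w)} /\
       eq_law P Pg (fun w => (Gam t w)%:E) Y).
Proof.
have lap l t : 0 < l -> 0 <= t -> ('E_P[fun w => expR (- (l * Gam t w))] =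
    (expR (- (t * ln (l / ln ((1 + l * (1 + mu)) / (1 + l * mu))))))%:E)%E.
  move=> l0 t0; rewrite Gam_sub.2 ?(ltW l0)//.
  by rewrite (levy_exponent mu_ge0 C_cauchy G0_law l0) -EFinM.
have part1 l t : 0 < l -> 0 <= t -> ('E_P[fun w => expR (- (l * Gam t w))%R])%E =
    ((l^-1 * ln ((1 + l * (1 + mu)) / (1 + l * mu))) `^ t)%:E.
  move=> l0 t0; rewrite lap//; set r := ln ((1 + _) / _).
  have a0 : 0 < 1 + l * mu by rewrite ltr_wpDr// mulr_ge0// ltW.
  have r0 : 0 < r.
    rewrite ln_gt0// ltr_pdivlMr// mul1r ltrD2l ltr_pM2l//.
    by rewrite ltrDr.
  (* The base is positive because [r] is, so the power is the exponential of [t] times its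
     logarithm. *)
  rewrite /powR gt_eqF ?mulr_gt0 ?invr_gt0//; congr (expR _)%:E.
  by rewrite -mulrN -lnV ?posrE ?divr_gt0// invf_div [r / l]mulrC.
have mG t : measurable_fun setT (Gam t) by exact: measurable_funPT.
have G_ge0 t : 0 <= t -> {ae P, forall w, 0 <= Gam t w}.
  by case: Gam_sub => sub _; exact: subordinator_ge0 sub _.
have lap1 l : 0 < l -> (\int[P]_w (expR (- (l * Gam 1 w)))%:E =
    (l^-1 * ln ((1 + l * (1 + mu)) / (1 + l * mu)))%:E)%E.
  move=> l0; rewrite -expectationE part1// powRr1// mulr_ge0 ?invr_ge0 ?(ltW l0)//.
  rewrite ln_ge0// ler_pdivlMr ?mul1r; first by rewrite lerD2l ler_pM2l// lerDr.
  by rewrite ltr_wpDr// mulr_ge0// ltW.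
split; [exact: part1|split; [|split; [|split]]].
- move=> dE TE PE e U he hU heU.
  have law := mixture_law mu_ge0 (mG 1) (G_ge0 1 ler01) lap1 he hU heU.
  split; first exact: law.
  move=> mu0; have -> // : (fun w => e w * U w) = (fun w => e w * (U w + mu)).
  by apply/funext => w; rewrite mu0 addr0.
- move=> dD TD PD D dU TU PU U hD hU.
  have law := mixture_law_D1 mu_ge0 (mG 1) (G_ge0 1 ler01) lap1 hD hU.
  split=> // mu0; have <- // : (fun w => U w + mu) = U.
  by apply/funext => w; rewrite mu0 addr0.
- apply: (mixture_has_density mu_ge0 (mG 1)).
  exact: (mixture_law_tail mu_ge0 (mG 1) (G_ge0 1 ler01) lap1).
move=> dg Tg Pg gam hgam t; rewrite le_eqVlt => /predU1P[<-|t0].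
  (* At [t = 0], where the kernel divides by [t], the interval []0, 0]] is empty and both sides are
     0. *)
  exists (cst 0%E); split; first exact: subordinator_stieltjes0 hgam.1 _.
  by case: Gam_sub => sub _ A mA; rewrite (subordinator0_law sub Pg).
apply: (wiener_gamma_law mu_ge0 t0 (mG t) (G_ge0 t (ltW t0)) _ hgam) => l l0.
by rewrite -expectationE lap// ltW.
Qed.
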